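(* Let $0<\varepsilon<1/3$. Let $N,m$ be nonnegative integers and let $\nu,\lambda_0,\dots,\lambda_m,\Lambda,a_0,\dots,a_m$ be complex numbers. Assume $\operatorname{Re}\nu>-1$, $-1<\operatorname{Re}\lambda_0<\operatorname{Re}\lambda_1<\cdots<\operatorname{Re}\lambda_m<\operatorname{Re}\Lambda$, $N\le\operatorname{Re}\Lambda$ and $\operatorname{Re}\lambda_0\le N-1$. Assume that the function $\phi(t)$ in $0<t<1$ satisfies $$\phi(t)=\sum_{k=0}^{m}a_k(1-t)^{\lambda_k}+(1-t)^{\Lambda}\psi(t),\qquad 1-2\varepsilon<t<1,$$ where $a_0\ne0$ and $\psi$ is an infinitely differentiable function on $(0,1)$ such that $\psi^{(k)}$ is integrable on $(1-2\varepsilon,1)$ for $0\le k\le N$. Let $\chi_1$ be an infinitely differentiable function such that $\chi_1(t)=0$ for $0<t\le1-2\varepsilon$ and $\chi_1(t)=1$ for $1-\varepsilon\le t<1$. Set $$\tilde\phi(t)=\sum_{k=0}^{m}a_k(1-t)^{\lambda_k}+\chi_1(t)(1-t)^{\Lambda}\psi(t),\qquad 0<t<1 .$$ Then, as $r\to\infty$, $$\int_0^1 s^{\nu+1}\tilde\phi(s^2)J_\nu(rs)\,ds=a_0\frac{2^{\lambda_0+1/2}}{\pi^{1/2}}\Gamma(\lambda_0+1)\,r^{-(\lambda_0+3/2)}\cos\Bigl(r-\frac{\pi}{2}(\nu+\lambda_0+1)-\frac{\pi}{4}\Bigr)+o\bigl(r^{-\operatorname{Re}(\lambda_0+3/2)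}\bigr).$$
   Context: $J_\nu$ denotes the Bessel function of the first kind of order $\nu$, $\Gamma$ the Gamma function, and $r$ is a positive real variable. Complex powers of positive reals are $x^{a}=e^{a\log x}$. Functions are complex-valued. *)

(* Defs.v *)
From HB Require Import structures.
From mathcomp Require Import all_boot all_order all_algebra.
From mathcomp Require Import all_classical all_reals all_analysis.
From mathcomp Require Import complex.

Set Implicit Arguments.
Unset Strict Implicit.
Unset Printing Implicit Defensive.

Import Order.TTheory GRing.Theory Num.Theory.
Import numFieldNormedType.Exports.

Local Open Scope classical_set_scope.
Local Open Scope ring_scope.
Local Open Scope complex_scope.

(* The Landau notations need the filter of neighborhoods of +oo as a filter_on. *)
Canonical pinfty_filter_on (R : numFieldType) :=
  FilterType (pinfty_nbhs R) (@filter_filter R _ (@proper_pinfty_nbhs R)).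

Section ComplexFunctions.
Context {R : realType}.
Implicit Types (x t : R) (z nu : R[i]) (A : set R) (f : R -> R[i]).

Definition cexp z : R[i] :=
  (expR (complex.Re z))%:C * (cos (complex.Im z) +i* sin (complex.Im z)).

Definition ccos z : R[i] := (cexp ('i * z) + cexp (- ('i * z))) / 2%:R.

(* Only meaningful for 0 < x. *)
Definition cpow x z : R[i] := cexp (z * (ln x)%:C).

(* R[i] is not a normed space over R in the library, so integration and
   differentiation of functions R -> R[i] are done on real and imaginary parts. *)
Definition cintegral A f : R[i] :=
  (\int[lebesgue_measure]_(t in A) complex.Re (f t))
  +i* (\int[lebesgue_measure]_(t in A) complex.Im (f t)).

Definition cintegrable A f : Prop :=
  lebesgue_measure.-integrable A (fun t => (complex.Re (f t))%:E) /\
  lebesgue_measure.-integrable A (fun t => (complex.Im (f t))%:E).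

Definition cderiv (k : nat) f : R -> R[i] := fun t =>
  derive1n k (fun u => complex.Re (f u)) t
  +i* derive1n k (fun u => complex.Im (f u)) t.

(* Meant for an open set A: the values of f outside A are then irrelevant. *)
Definition csmooth A f : Prop := forall (k : nat) t, A t ->
  derivable (fun u => complex.Re (cderiv k f u)) t 1 /\
  derivable (fun u => complex.Im (cderiv k f u)) t 1.

(* Euler's integral when 0 < Re z, extended to the other z by
   Gamma(z) = Gamma(z + n) / (z (z + 1) ... (z + n - 1)) with Re (z + n) > 0.
   At the poles z = 0, -1, -2, ... one factor vanishes, so the value is 0
   and its inverse is the correct value 0 of 1 / Gamma. *)
Definition euler_integral z : R[i] :=
  cintegral `]0, +oo[ (fun t => cpow t (z - 1) * (expR (- t))%:C).

Definition Gamma_shift z : nat :=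
  if 0 < complex.Re z then 0%N else (Num.truncn (- complex.Re z)).+1.

Definition Gamma z : R[i] :=
  let n := Gamma_shift z in
  euler_integral (z + n%:R) / \prod_(k < n) (z + k%:R).

Definition besselJ_term nu x (k : nat) : R[i] :=
  (-1) ^+ k / (k`!%:R * Gamma (nu + k%:R + 1)) * cpow (x / 2) (nu + k.*2%:R).

(* J_nu(x) for 0 < x; the limit is taken in R[i] with its norm topology. *)
Definition besselJ nu x : R[i] :=
  limn (fun n : nat => \sum_(0 <= k < n) besselJ_term nu x k : R[i]^o).

End ComplexFunctions.

(* Main.v *)
Require Import Defs.
(* With t = s^2 the integral becomes (1/2) int_0^1 phit(t) K_nu(t) dt, where
   K_nu(t) = t^(nu/2) J_nu(r sqrt t) satisfies K_(nu+1)' = (r/2) K_nu. Sonine's integral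
   evaluates each term a_k (1-t)^lambda_k exactly, as
   a_k 2^lambda_k Gamma(lambda_k + 1) r^(-lambda_k-1) J_(nu+lambda_k+1)(r). The remaining term
   chi1 (1-t)^Lambda psi is integrated by parts N times without boundary terms, which gains r^-N,
   and Riemann-Lebesgue gains o(r^(-1/2)); this suffices as Re lambda_0 <= N - 1.
   The first order asymptotics of J_mu is obtained from Poisson's integral, whose endpoint
   singularity is compared with the explicit integral int_0^oo u^la e^(-(1+ix)u) du, and is
   extended to all Re mu > -1 by the three term recurrence. *)
From HB Require Import structures.
From mathcomp Require Import all_boot all_order all_algebra.
From mathcomp Require Import all_classical all_reals all_analysis.
From mathcomp Require Import measurable_realfun.
From mathcomp Require Import complex.
From mathcomp Require Import ring lra.

Set Implicit Arguments.
Unset Strict Implicit.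
Unset Printing Implicit Defensive.

Import Order.TTheory GRing.Theory Num.Theory.
Import numFieldNormedType.Exports.
Import Normc.

Local Open Scope classical_set_scope.
Local Open Scope ring_scope.
Local Open Scope complex_scope.

Local Notation Re := complex.Re.
Local Notation Im := complex.Im.

(** * Complex exponentials and powers *)

(** Only absolutely convergent integrals occur, but their integrands may be singular at the ends of
    the interval. The fundamental theorem, substitution and integration by parts are therefore
    carried out on compact intervals exhausting the domain and then passed to the limit. The Bessel
    series divides by Gamma, so Gamma(z) <> 0 for Re z > 0 is needed early; it comes from Gauss's
    product, which also gives the Beta formula without a double integral. In the model integral, 1 +
    ix replaces ix because e^(-u) keeps it absolutely convergent. Cutting Poisson's interval at its
    centre u = 1 creates an artificial endpoint, where the two oscillations e^(ix(1-u)) and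
    e^(-ix(1-u)) leave opposite terms of order 1/x: these cancel in the cosine form, and in the sine
    form the weight vanishes there. Each form is used only for Re la <= 0, where an error o(1/x)
    survives multiplication by x^(la+1). The cosine form then covers a strip of orders of width 1
    and the sine form the adjacent one, and a strip of width 2 is what a three term recurrence needs
    to start. *)

Section ComplexBasics.
Context {R : realType}.
Implicit Types (x y t : R) (z w : R[i]).

Lemma ReD z w : Re (z + w) = Re z + Re w. Proof. by case: z w => [a b] [c d]. Qed.
Lemma ImD z w : Im (z + w) = Im z + Im w. Proof. by case: z w => [a b] [c d]. Qed.
Lemma ReN z : Re (- z) = - Re z. Proof. by case: z. Qed.
Lemma ImN z : Im (- z) = - Im z. Proof. by case: z. Qed.
Lemma ReM z w : Re (z * w) = Re z * Re w - Im z * Im w.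
Proof. by case: z w => [a b] [c d]. Qed.
Lemma ImM z w : Im (z * w) = Re z * Im w + Im z * Re w.
Proof. by case: z w => [a b] [c d]. Qed.
Lemma ReCr x : Re x%:C = x. Proof. by []. Qed.
Lemma ImCr x : Im x%:C = 0. Proof. by []. Qed.
Lemma Re1 : Re (1 : R[i]) = 1. Proof. by []. Qed.
Lemma Im1 : Im (1 : R[i]) = 0. Proof. by []. Qed.
Lemma realCM x y : (x * y)%:C = x%:C * y%:C :> R[i]. Proof. exact: rmorphM. Qed.
Lemma realCD x y : (x + y)%:C = x%:C + y%:C :> R[i]. Proof. exact: rmorphD. Qed.
Lemma realCN x : (- x)%:C = - x%:C :> R[i]. Proof. exact: rmorphN. Qed.
Lemma realCB x y : (x - y)%:C = x%:C - y%:C :> R[i]. Proof. exact: rmorphB. Qed.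
Lemma realCV x : x^-1%:C = x%:C^-1 :> R[i]. Proof. exact: fmorphV. Qed.
Lemma realCX x n : (x ^+ n)%:C = x%:C ^+ n :> R[i]. Proof. exact: rmorphXn. Qed.
Lemma realC_eq0 x : (x%:C == 0 :> R[i]) = (x == 0). Proof. exact: fmorph_eq0. Qed.
Lemma natC n : (n%:R : R[i]) = (n%:R)%:C. Proof. by rewrite rmorph_nat. Qed.
Lemma Re_nat n : Re (n%:R : R[i]) = n%:R. Proof. by rewrite natC. Qed.
Lemma Im_nat n : Im (n%:R : R[i]) = 0. Proof. by rewrite natC. Qed.

Definition ReImE := (ReD, ImD, ReN, ImN, ReM, ImM, ReCr, ImCr, Re1, Im1, Re_nat, Im_nat).

Lemma complex_eqP z w : Re z = Re w -> Im z = Im w -> z = w.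
Proof. by case: z w => [a b] [c d] /= -> ->. Qed.

Lemma normc_sqrtE z : normc z = Num.sqrt (Re z ^+ 2 + Im z ^+ 2).
Proof. by case: z. Qed.

Lemma normc_norm z : `|z| = (normc z)%:C. Proof. by rewrite normc_def normc_sqrtE. Qed.

Lemma normc_ge0 z : 0 <= normc z. Proof. by rewrite normc_sqrtE sqrtr_ge0. Qed.

Lemma Re_le_normc z : `|Re z| <= normc z.
Proof. by rewrite normc_sqrtE -sqrtr_sqr ler_wsqrtr // lerDl sqr_ge0. Qed.

Lemma Im_le_normc z : `|Im z| <= normc z.
Proof. by rewrite normc_sqrtE -sqrtr_sqr ler_wsqrtr // lerDr sqr_ge0. Qed.

Lemma normc_real x : normc x%:C = `|x|.
Proof. by rewrite normc_sqrtE /= expr0n addr0 sqrtr_sqr. Qed.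

Lemma normc_nat n : normc (n%:R : R[i]) = n%:R.
Proof. by rewrite natC normc_real ger0_norm. Qed.

Lemma normcD z w : normc (z + w) <= normc z + normc w.
Proof. exact: le_normcD. Qed.

Lemma normcNE z : normc (- z) = normc z. Proof. exact: normcN. Qed.

Lemma normcB z w : normc (z - w) <= normc z + normc w.
Proof. by rewrite -(normcNE w) normcD. Qed.

(* The notation 'i is ambiguous between Complex 0 1 and the imaginary unit of numClosedFieldType. *)
Definition cI : R[i] := Complex 0 1.

Lemma sqr_cI : cI * cI = -1.
Proof. by rewrite -expr2 /cI; exact: sqr_i. Qed.

Lemma normc_cI : normc cI = 1.
Proof. by rewrite normc_sqrtE /= expr0n expr1n add0r sqrtr1. Qed.

Lemma normc_Im z : normc (0 +i* 1 * z) = normc z.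
Proof. by rewrite normcM /= expr0n expr1n add0r sqrtr1 mul1r. Qed.

Lemma normc_le_ReIm z : normc z <= `|Re z| + `|Im z|.
Proof.
rewrite {1}(complexE z); apply: le_trans (normcD _ _) _.
by rewrite normc_Im !normc_real.
Qed.

Lemma normc_sum I (r : seq I) (P : pred I) (F : I -> R[i]) :
  normc (\sum_(i <- r | P i) F i) <= \sum_(i <- r | P i) normc (F i).
Proof.
elim/big_rec2 : _ => [|i y z _ h]; first by rewrite normc0.
by apply: le_trans (normcD _ _) _; rewrite lerD2l.
Qed.

Lemma normcX z n : normc (z ^+ n) = normc z ^+ n.
Proof. by elim: n => [|n IH]; rewrite ?expr0 ?normc1 // !exprS normcM IH. Qed.

Lemma normc_eq0 z : (normc z == 0) = (z == 0).
Proof. by apply/eqP/eqP => [/eq0_normc//|->]; rewrite normc0. Qed.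

Lemma normc_gt0 z : (0 < normc z) = (z != 0).
Proof. by rewrite lt_def normc_ge0 andbT normc_eq0. Qed.

Lemma cexpD z w : cexp (z + w) = cexp z * cexp w.
Proof.
apply: complex_eqP; rewrite /cexp !ReImE /= expRD sinD cosD; ring.
Qed.

Lemma cexp0 : cexp (0 : R[i]) = 1.
Proof. by apply: complex_eqP; rewrite /cexp !ReImE /= expR0 sin0 cos0; ring. Qed.

Lemma normc_cexp z : normc (cexp z) = expR (Re z).
Proof.
by rewrite /cexp normcM normc_real ger0_norm ?expR_ge0 //= cos2Dsin2 sqrtr1 mulr1.
Qed.

Lemma cexp_neq0 z : cexp z != 0.
Proof. by rewrite -normc_gt0 normc_cexp expR_gt0. Qed.

Lemma cexpN z : cexp (- z) = (cexp z)^-1.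
Proof.
by apply: (mulfI (cexp_neq0 z)); rewrite -cexpD subrr cexp0 divff // cexp_neq0.
Qed.

Lemma cexp_real x : cexp x%:C = (expR x)%:C.
Proof. by apply: complex_eqP; rewrite /cexp !ReImE /= sin0 cos0; ring. Qed.

Lemma cpowD x z w : cpow x (z + w) = cpow x z * cpow x w.
Proof. by rewrite /cpow mulrDl cexpD. Qed.

Lemma cpow0 x : cpow x (0 : R[i]) = 1. Proof. by rewrite /cpow mul0r cexp0. Qed.

Lemma cpow_neq0 x z : cpow x z != 0. Proof. exact: cexp_neq0. Qed.

Lemma cpowN x z : cpow x (- z) = (cpow x z)^-1.
Proof. by rewrite /cpow mulNr cexpN. Qed.

Lemma cpowB x z w : cpow x (z - w) = cpow x z / cpow x w.
Proof. by rewrite cpowD cpowN. Qed.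

Lemma cpow_real x y : 0 < x -> cpow x y%:C = (x `^ y)%:C.
Proof.
by move=> x0; rewrite /cpow -rmorphM cexp_real /powR gt_eqF.
Qed.

Lemma cpow1 x : 0 < x -> cpow x (1 : R[i]) = x%:C.
Proof. by move=> x0; rewrite (cpow_real 1 x0) powRr1 // ltW. Qed.

Lemma cpow_nat x n : 0 < x -> cpow x (n%:R : R[i]) = x%:C ^+ n.
Proof. by move=> x0; rewrite natC cpow_real // powR_mulrn ?ltW // rmorphXn. Qed.

Lemma cpowS x z : 0 < x -> cpow x (z + 1) = x%:C * cpow x z.
Proof. by move=> x0; rewrite cpowD cpow1 // mulrC. Qed.

Lemma cpowP x z : 0 < x -> cpow x (z - 1) = cpow x z / x%:C.
Proof. by move=> x0; rewrite cpowB cpow1. Qed.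

Lemma cpowM x y z : 0 < x -> 0 < y -> cpow (x * y) z = cpow x z * cpow y z.
Proof. by move=> x0 y0; rewrite /cpow lnM // rmorphD mulrDr cexpD. Qed.

Lemma cpow1l z : cpow 1 z = 1. Proof. by rewrite /cpow ln1 mulr0 cexp0. Qed.

Lemma cpowV x z : 0 < x -> cpow x^-1 z = (cpow x z)^-1.
Proof.
move=> x0; apply: (mulfI (cpow_neq0 x z)).
by rewrite -cpowM ?invr_gt0 // divff ?gt_eqF // cpow1l divff // cpow_neq0.
Qed.

Lemma cpow_div x y z : 0 < x -> 0 < y -> cpow (x / y) z = cpow x z / cpow y z.
Proof. by move=> x0 y0; rewrite cpowM ?invr_gt0 // cpowV. Qed.

Lemma cpow_sqr x z : 0 < x -> cpow (x ^+ 2) z = cpow x (2%:R * z).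
Proof. by move=> x0; rewrite expr2 cpowM // -cpowD mulr_natl mulr2n. Qed.

Lemma normc_cpow x z : 0 < x -> normc (cpow x z) = x `^ Re z.
Proof.
move=> x0; rewrite /cpow normc_cexp !ReImE mulr0 subr0.
by rewrite /powR gt_eqF.
Qed.

End ComplexBasics.

(** * Limits and derivatives *)

Section Limits.
Context {R : realType}.

(* Limits, derivatives and integrals are taken on real and imaginary parts, as in Defs. *)
Definition cto {T : Type} (F : set_system T) (f : T -> R[i]) (l : R[i]) : Prop :=
  (Re (f x) @[x --> F] --> Re l) /\ (Im (f x) @[x --> F] --> Im l).

Section Filter.
Context {T : Type} (F : set_system T) {FF : Filter F}.
Implicit Types (f g : T -> R[i]) (k l : R[i]).

Lemma cto_cst k : cto F (fun=> k) k.
Proof. by split; apply: cvg_cst. Qed.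

Lemma cto_real (h : T -> R) (l : R) : h x @[x --> F] --> l ->
  cto F (fun x => (h x)%:C) l%:C.
Proof. by move=> hl; split => //=; apply: cvg_cst. Qed.

Lemma ctoD f g k l : cto F f k -> cto F g l -> cto F (fun x => f x + g x) (k + l).
Proof.
move=> [f1 f2] [g1 g2]; split; rewrite ?ReD ?ImD;
  under eq_fun do rewrite ?ReD ?ImD; exact: cvgD.
Qed.

Lemma ctoN f k : cto F f k -> cto F (fun x => - f x) (- k).
Proof.
move=> [f1 f2]; split; rewrite ?ReN ?ImN;
  under eq_fun do rewrite ?ReN ?ImN; exact: cvgN.
Qed.

Lemma ctoB f g k l : cto F f k -> cto F g l -> cto F (fun x => f x - g x) (k - l).
Proof. by move=> fk gl; apply: ctoD => //; apply: ctoN. Qed.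

Lemma ctoM f g k l : cto F f k -> cto F g l -> cto F (fun x => f x * g x) (k * l).
Proof.
move=> [f1 f2] [g1 g2]; split; rewrite ?ReM ?ImM;
  under eq_fun do rewrite ?ReM ?ImM.
- by apply: cvgB; apply: cvgM.
- by apply: cvgD; apply: cvgM.
Qed.

Lemma cto_normc f k : cto F f k -> normc (f x) @[x --> F] --> normc k.
Proof.
move=> [f1 f2]; under eq_fun do rewrite normc_sqrtE; rewrite normc_sqrtE.
apply: (continuous_cvg _ (@sqrt_continuous R _)).
by apply: cvgD; apply: cvgM.
Qed.

Lemma cto_sum I (r : seq I) (f : I -> T -> R[i]) (k : I -> R[i]) :
  (forall i, cto F (f i) (k i)) ->
  cto F (fun x => \sum_(i <- r) f i x) (\sum_(i <- r) k i).
Proof.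
move=> fk; elim: r => [|i r IH].
  by rewrite big_nil; under eq_fun do rewrite big_nil; exact: cto_cst.
by rewrite big_cons; under eq_fun do rewrite big_cons; exact: ctoD.
Qed.

Lemma cto_near f g k : (\forall x \near F, f x = g x) -> cto F f k -> cto F g k.
Proof.
move=> fg [f1 f2]; split; [move: f1|move: f2]; apply: cvg_trans; apply: near_eq_cvg;
  by apply: filterS fg => x ->.
Qed.

Lemma cto_ext f g k : (forall x, f x = g x) -> cto F f k -> cto F g k.
Proof. by move=> fg; apply: cto_near; apply: nearW. Qed.

Lemma cto0_le f (h : T -> R) : (\forall x \near F, normc (f x) <= h x) ->
  h x @[x --> F] --> 0 -> cto F f 0.
Proof.
move=> fh h0; have hN : - h x @[x --> F] --> 0.
  by rewrite -oppr0; apply: cvgN.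
split; (apply: (squeeze_cvgr _ hN h0); apply: filterS fh => x fh;
  rewrite -ler_norml; apply: le_trans fh).
- exact: Re_le_normc.
- exact: Im_le_normc.
Qed.

Lemma cto0_normc f : cto F f 0 <-> normc (f x) @[x --> F] --> 0.
Proof.
split => [/cto_normc|h]; first by rewrite normc0.
by apply: cto0_le h; apply: nearW.
Qed.

Lemma cto0_bnd f g (M : R) : (\forall x \near F, normc (f x) <= M) -> cto F g 0 ->
  cto F (fun x => f x * g x) 0.
Proof.
move=> fM /cto0_normc g0.
apply: (@cto0_le _ (fun x => M * normc (g x))).
  by apply: filterS fM => x fM; rewrite normcM ler_wpM2r // normc_ge0.
by rewrite -(mulr0 M); apply: cvgM => //; apply: cvg_cst.
Qed.

End Filter.

Lemma cto_uniq {T : Type} (F : set_system T) {FF : ProperFilter F} (f : T -> R[i]) k l :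
  cto F f k -> cto F f l -> k = l.
Proof.
move=> [a b] [c d]; apply: complex_eqP.
- exact: (cvg_unique (@Rhausdorff R) a c).
- exact: (cvg_unique (@Rhausdorff R) b d).
Qed.

Lemma cto_comp {T U : Type} (F : set_system T) (G : set_system U) (h : T -> U) f l :
  h x @[x --> F] --> G -> cto G f l -> cto F (fun x => f (h x)) l.
Proof. by move=> hG [f1 f2]; split; [exact: cvg_comp hG f1|exact: cvg_comp hG f2]. Qed.

Lemma cto_cexp {T : Type} (F : set_system T) {FF : Filter F} (f : T -> R[i]) k :
  cto F f k -> cto F (fun x => cexp (f x)) (cexp k).
Proof.
move=> [f1 f2]; rewrite /cexp; apply: ctoM.
  by apply: cto_real; apply: (continuous_cvg _ (@continuous_expR R _)).
split => /=.
- by apply: (continuous_cvg _ (@continuous_cos R _)).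
- by apply: (continuous_cvg _ (@continuous_sin R _)).
Qed.

End Limits.

(** * Derivatives and smoothness classes of complex-valued functions *)

Section Derivatives.
Context {R : realType}.
Implicit Types (t : R) (f g : R -> R[i]) (k l : R[i]) (D : set R).

Definition isd f t l : Prop :=
  is_derive t 1 (fun u => Re (f u)) (Re l) /\ is_derive t 1 (fun u => Im (f u)) (Im l).

Lemma isd_eq f t k l : isd f t k -> k = l -> isd f t l.
Proof. by move=> ? <-. Qed.

Lemma isd_cst k t : isd (fun=> k) t 0.
Proof. by split; apply: is_derive_cst. Qed.

Lemma isdD f g t k l : isd f t k -> isd g t l -> isd (fun u => f u + g u) t (k + l).
Proof.
move=> [f1 f2] [g1 g2]; split; rewrite ?ReD ?ImD;
  under eq_fun do rewrite ?ReD ?ImD; exact: is_deriveD.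
Qed.

Lemma isdN f t k : isd f t k -> isd (fun u => - f u) t (- k).
Proof.
move=> [f1 f2]; split; rewrite ?ReN ?ImN;
  under eq_fun do rewrite ?ReN ?ImN; exact: is_deriveN.
Qed.

Lemma isdM f g t k l : isd f t k -> isd g t l ->
  isd (fun u => f u * g u) t (k * g t + f t * l).
Proof.
move=> [f1 f2] [g1 g2]; split; rewrite !ReImE;
  under eq_fun do rewrite !ReImE.
- apply: is_derive_eq (is_deriveB (is_deriveM f1 g1) (is_deriveM f2 g2)) _.
  by rewrite /GRing.scale /=; ring.
- apply: is_derive_eq (is_deriveD (is_deriveM f1 g2) (is_deriveM f2 g1)) _.
  by rewrite /GRing.scale /=; ring.
Qed.

Lemma isdZ k f t l : isd f t l -> isd (fun u => k * f u) t (k * l).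
Proof. by move=> fl; apply: isd_eq (isdM (isd_cst k t) fl) _; rewrite mul0r add0r. Qed.

Lemma isd_real (h : R -> R) t (a : R) : is_derive t 1 h a ->
  isd (fun u => (h u)%:C) t a%:C.
Proof. by move=> ha; split => //=; apply: is_derive_cst. Qed.

Lemma isd_comp f (h : R -> R) t (a : R) l : is_derive t 1 h a -> isd f (h t) l ->
  isd (fun u => f (h u)) t (a%:C * l).
Proof.
move=> ha [f1 f2]; split; rewrite !ReImE.
- by apply: is_derive_eq (is_derive1_comp f1 ha) _; rewrite /GRing.scale /=; ring.
- by apply: is_derive_eq (is_derive1_comp f2 ha) _; rewrite /GRing.scale /=; ring.
Qed.

Lemma isd_cexp f t l : isd f t l -> isd (fun u => cexp (f u)) t (l * cexp (f t)).
Proof.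
move=> [f1 f2]; rewrite /cexp; split; rewrite !ReImE /=.
- rewrite (_ : (fun u => _) = (fun u => expR (Re (f u)) * cos (Im (f u)))); last first.
    by apply/funext => u; rewrite mul0r subr0.
  have e := is_derive1_comp (is_derive_expR (Re (f t))) f1.
  have c := is_derive1_comp (is_derive_cos (Im (f t))) f2.
  by apply: is_derive_eq (is_deriveM e c) _; rewrite /GRing.scale /=; ring.
- rewrite (_ : (fun u => _) = (fun u => expR (Re (f u)) * sin (Im (f u)))); last first.
    by apply/funext => u; rewrite mul0r addr0.
  have e := is_derive1_comp (is_derive_expR (Re (f t))) f1.
  have c := is_derive1_comp (is_derive_sin (Im (f t))) f2.
  by apply: is_derive_eq (is_deriveM e c) _; rewrite /GRing.scale /=; ring.
Qed.

Lemma isd_cpow z t : 0 < t -> isd (fun u => cpow u z) t (z * cpow t (z - 1)).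
Proof.
move=> t0; apply: isd_eq (isd_cexp (isdZ z (isd_real (is_derive1_ln t0)))) _.
by rewrite -/(cpow t z) cpowP // rmorphV ?unitfE ?gt_eqF //=; ring.
Qed.

Lemma isd_cpowr z (b : R) t : t < b ->
  isd (fun u => cpow (b - u) z) t (- z * cpow (b - t) (z - 1)).
Proof.
move=> tb; have bt : 0 < b - t by rewrite subr_gt0.
have d : is_derive t 1 (fun u : R => b - u) (-1).
  by apply: is_derive_eq (is_deriveB (is_derive_cst b t 1) (is_derive_id t 1)) _; rewrite sub0r.
by apply: isd_eq (isd_comp d (isd_cpow z bt)) _; rewrite rmorphN1; ring.
Qed.

Lemma isd_lin k t : isd (fun u => k * u%:C) t k.
Proof. by apply: isd_eq (isdZ k (isd_real (is_derive_id t 1))) _; rewrite mulr1. Qed.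

Lemma isd_cto f t l : isd f t l -> cto (nbhs t) f (f t).
Proof.
by move=> [[f1 _] [f2 _]]; split; apply: differentiable_continuous;
  apply/derivable1_diffP.
Qed.

Lemma isd_near f g t l : (\forall u \near t, f u = g u) -> isd f t l -> isd g t l.
Proof.
move=> fg [f1 f2]; split.
- by apply: (near_eq_is_derive _ f1); rewrite ?oner_eq0 //; apply: filterS fg => u ->.
- by apply: (near_eq_is_derive _ f2); rewrite ?oner_eq0 //; apply: filterS fg => u ->.
Qed.

Lemma isd_ext f g t l : (forall u, f u = g u) -> isd f t l -> isd g t l.
Proof. by move=> fg; have -> : g = f by apply/funext. Qed.

Lemma isd_uniq f t k l : isd f t k -> isd f t l -> k = l.
Proof.
move=> [f1 f2] [g1 g2]; apply: complex_eqP.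
- by rewrite -(@derive_val _ _ _ _ _ _ _ f1) -(@derive_val _ _ _ _ _ _ _ g1).
- by rewrite -(@derive_val _ _ _ _ _ _ _ f2) -(@derive_val _ _ _ _ _ _ _ g2).
Qed.

(** Derivatives enter as existential witnesses, so that closed forms can be supplied. Continuity at
    level 0 is two-sided at every point of [D]; for a closed interval this includes both sides of
    its end points. *)
Fixpoint Ck (n : nat) D f : Prop :=
  match n with
  | 0%N => forall t, D t -> cto (nbhs t) f (f t)
  | n'.+1 => exists g, (forall t, D t -> isd f t (g t)) /\ Ck n' D g
  end.

Lemma Ck_pred n D f : Ck n.+1 D f -> Ck n D f.
Proof.
elim: n f => [|n IH] f /= [g [fg cg]]; first by move=> t Dt; apply: isd_cto (fg t Dt).
by exists g; split => //; apply: IH.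
Qed.

Lemma Ck_le m n D f : (m <= n)%N -> Ck n D f -> Ck m D f.
Proof.
move=> /subnK <-; elim: (n - m)%N => // k IH; rewrite addSn => h.
by apply: IH; apply: Ck_pred.
Qed.

Lemma Ck_cont n D f : Ck n D f -> forall t, D t -> cto (nbhs t) f (f t).
Proof. exact: (@Ck_le 0). Qed.

Lemma Ck_sub n D E f : E `<=` D -> Ck n D f -> Ck n E f.
Proof.
move=> ED; elim: n f => [|n IH] f /=; first by move=> h t /ED; exact: h.
by move=> [g [fg /IH cg]]; exists g; split => // t /ED; exact: fg.
Qed.

Lemma Ck_cst n D k : Ck n D (fun=> k).
Proof.
elim: n k => [|n IH] k /=; first by move=> t _; exact: cto_cst.
by exists (fun=> 0); split => // t _; exact: isd_cst.
Qed.

Lemma CkD n D f g : Ck n D f -> Ck n D g -> Ck n D (fun u => f u + g u).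
Proof.
elim: n f g => [|n IH] f g /=; first by move=> cf cg t Dt; apply: ctoD; [exact: cf|exact: cg].
move=> [f' [ff cf]] [g' [gg cg]]; exists (fun u => f' u + g' u); split; last exact: IH.
by move=> t Dt; apply: isdD; [exact: ff|exact: gg].
Qed.

Lemma CkM n D f g : Ck n D f -> Ck n D g -> Ck n D (fun u => f u * g u).
Proof.
elim: n f g => [|n IH] f g; first by move=> cf cg t Dt; apply: ctoM; [exact: cf|exact: cg].
move=> hf hg; case: (hf) (hg) => [f' [ff cf]] [g' [gg cg]].
exists (fun u => f' u * g u + f u * g' u); split.
  by move=> t Dt; apply: isdM; [exact: ff|exact: gg].
by apply: CkD; apply: IH => //; apply: Ck_pred.
Qed.

Lemma CkZ n D k f : Ck n D f -> Ck n D (fun u => k * f u).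
Proof. by move=> cf; apply: CkM => //; apply: Ck_cst. Qed.

Lemma CkB n D f g : Ck n D f -> Ck n D g -> Ck n D (fun u => f u - g u).
Proof.
move=> cf cg; rewrite (_ : (fun u => _) = fun u => f u + (-1) * g u); last first.
  by apply/funext => u; rewrite mulN1r.
by apply: CkD => //; apply: CkZ.
Qed.

Lemma Ck_sum n D I (r : seq I) (f : I -> R -> R[i]) : (forall i, Ck n D (f i)) ->
  Ck n D (fun u => \sum_(i <- r) f i u).
Proof.
move=> cf; elim: r => [|i r IH].
  by under eq_fun do rewrite big_nil; exact: Ck_cst.
by under eq_fun do rewrite big_cons; exact: CkD.
Qed.

Lemma Ck_near n D f g : open D -> (forall t, D t -> f t = g t) -> Ck n D f -> Ck n D g.
Proof.
move=> oD fg; have near_fg t : D t -> \forall u \near t, f u = g u.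
  by move=> Dt; apply: filterS fg _; exact: open_nbhs_nbhs.
case: n => [|n] /=.
  by move=> cf t Dt; rewrite -(fg _ Dt); apply: cto_near (cf t Dt); exact: near_fg.
move=> [f' [ff cf]]; exists f'; split => // t Dt.
by apply: isd_near (ff t Dt); exact: near_fg.
Qed.

Lemma Ck_cpow n D z : (forall t, D t -> 0 < t) -> Ck n D (fun u => cpow u z).
Proof.
move=> D0; elim: n z => [|n IH] z /=; first by move=> t /D0/(isd_cpow z)/isd_cto.
exists (fun u => z * cpow u (z - 1)); split; first by move=> t /D0; exact: isd_cpow.
exact: CkZ.
Qed.

Lemma Ck_cpowr n D b z : (forall t, D t -> t < b) -> Ck n D (fun u => cpow (b - u) z).
Proof.
move=> D0; elim: n z => [|n IH] z /=; first by move=> t /D0/(isd_cpowr z)/isd_cto.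
exists (fun u => - z * cpow (b - u) (z - 1)); split; first by move=> t /D0; exact: isd_cpowr.
exact: CkZ.
Qed.

Lemma Ck_real_id n D : Ck n D (fun u => u%:C).
Proof.
case: n => [|n] /=; first by move=> t _; apply: cto_real; exact: cvg_id.
by exists (fun=> 1); split; [move=> t _; apply: isd_real|exact: Ck_cst].
Qed.

Lemma Ck_cexp_lin n D k l : Ck n D (fun u => cexp (k * u%:C + l)).
Proof.
have d t : isd (fun u => cexp (k * u%:C + l)) t (k * cexp (k * t%:C + l)).
  by apply: isd_eq (isd_cexp (isdD (isd_lin k t) (isd_cst l t))) _; rewrite addr0.
elim: n => [|n IH] /=; first by move=> t _; exact: isd_cto (d t).
by exists (fun u => k * cexp (k * u%:C + l)); split => //; apply: CkZ.
Qed.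

End Derivatives.

(** * Integrals *)

Section Integrals.
Context {R : realType}.
Local Notation mu := (@lebesgue_measure R).
Local Notation mbl D := (@measurable _ (measurableTypeR R) D).
Implicit Types (t : R) (f g : R -> R[i]) (h : R -> R) (k : R[i]) (D E : set R).

Definition rint D h : Prop := mu.-integrable D (EFin \o h).

Lemma meas_cont D h : mbl D -> (forall t, D t -> {for t, continuous h}) ->
  measurable_fun D h.
Proof.
move=> mD ch; apply: subspace_continuous_measurable_fun => //.
by apply: continuous_in_subspaceT => x; rewrite inE => Dx; exact: ch.
Qed.

Lemma rint_meas D h : rint D h -> measurable_fun D h.
Proof. by move=> /(measurable_int mu)/measurable_EFinP. Qed.

Lemma rint_le D h (g' : R -> R) : mbl D -> measurable_fun D h ->
  (forall t, D t -> `|h t| <= g' t) -> rint D g' -> rint D h.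
Proof.
move=> mD mh hg; apply: le_integrable => //; first exact/measurable_EFinP.
by move=> t Dt /=; rewrite lee_fin (le_trans (hg t Dt)) // ler_norm.
Qed.

Lemma rintD D h1 h2 : mbl D -> rint D h1 -> rint D h2 -> rint D (fun t => h1 t + h2 t).
Proof.
move=> mD i1 i2; have := integrableD mD i1 i2.
by apply: eq_integrable => // t _; rewrite /= EFinD.
Qed.

Lemma rintZ D a h : mbl D -> rint D h -> rint D (fun t => a * h t).
Proof.
move=> mD i1; have := integrableZl mD a i1.
by apply: eq_integrable => // t _; rewrite /= EFinM.
Qed.

Lemma rintB D h1 h2 : mbl D -> rint D h1 -> rint D h2 -> rint D (fun t => h1 t - h2 t).
Proof.
move=> mD i1 i2; have := integrableB mD i1 i2.
by apply: eq_integrable => // t _; rewrite /= EFinB.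
Qed.

Lemma rint_ext D h1 h2 : mbl D -> (forall t, D t -> h1 t = h2 t) ->
  rint D h1 -> rint D h2.
Proof. by move=> mD e; apply: eq_integrable => // t; rewrite inE => Dt; rewrite /= e. Qed.

Lemma rint_sub D E h : mbl D -> mbl E -> E `<=` D -> rint D h -> rint E h.
Proof. by move=> mD mE ED; apply: integrableS. Qed.

Lemma rint_cc a b h : (forall t, a <= t <= b -> {for t, continuous h}) -> rint `[a, b] h.
Proof.
move=> ch; apply: continuous_compact_integrable; first exact: segment_compact.
by apply: continuous_in_subspaceT => x; rewrite inE /= in_itv /=; exact: ch.
Qed.

Lemma cint_re D f : Re (cintegral D f) = \int[mu]_(t in D) Re (f t). Proof. by []. Qed.
Lemma cint_im D f : Im (cintegral D f) = \int[mu]_(t in D) Im (f t). Proof. by []. Qed.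

Lemma cint_ext D f g : (forall t, D t -> f t = g t) -> cintegral D f = cintegral D g.
Proof.
by move=> e; apply: complex_eqP => /=; apply: eq_Rintegral => t; rewrite inE => Dt; rewrite e.
Qed.

Lemma cintegrable_ext D f g : mbl D -> (forall t, D t -> f t = g t) ->
  cintegrable D f -> cintegrable D g.
Proof.
by move=> mD e [i1 i2]; split; [move: i1|move: i2]; apply: rint_ext => // t Dt; rewrite e.
Qed.

Lemma cintegrable_sub D E f : mbl D -> mbl E -> E `<=` D ->
  cintegrable D f -> cintegrable E f.
Proof. by move=> mD mE ED [i1 i2]; split; [move: i1|move: i2]; apply: rint_sub. Qed.

Lemma cintegrableD D f g : mbl D -> cintegrable D f -> cintegrable D g ->
  cintegrable D (fun t => f t + g t).
Proof.
move=> mD [f1 f2] [g1 g2]; split.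
- by apply: rint_ext (rintD mD f1 g1) => // t _; rewrite ReD.
- by apply: rint_ext (rintD mD f2 g2) => // t _; rewrite ImD.
Qed.

Lemma cintegrableZ D k f : mbl D -> cintegrable D f -> cintegrable D (fun t => k * f t).
Proof.
move=> mD [f1 f2]; split.
- by apply: rint_ext (rintB mD (rintZ (Re k) mD f1) (rintZ (Im k) mD f2)) => // t _; rewrite ReM.
- by apply: rint_ext (rintD mD (rintZ (Re k) mD f2) (rintZ (Im k) mD f1)) => // t _; rewrite ImM.
Qed.

Lemma cintegrableB D f g : mbl D -> cintegrable D f -> cintegrable D g ->
  cintegrable D (fun t => f t - g t).
Proof.
move=> mD fi gi; apply: cintegrable_ext (cintegrableD mD fi (cintegrableZ (-1) mD gi)) => // t _.
by rewrite mulN1r.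
Qed.

Lemma cintD D f g : mbl D -> cintegrable D f -> cintegrable D g ->
  cintegral D (fun t => f t + g t) = cintegral D f + cintegral D g.
Proof.
move=> mD [f1 f2] [g1 g2]; apply: complex_eqP.
- rewrite ReD /= -RintegralD //; apply: eq_Rintegral => t _; exact: ReD.
- rewrite ImD /= -RintegralD //; apply: eq_Rintegral => t _; exact: ImD.
Qed.

Lemma cintZ D k f : mbl D -> cintegrable D f ->
  cintegral D (fun t => k * f t) = k * cintegral D f.
Proof.
move=> mD [f1 f2]; apply: complex_eqP.
- rewrite ReM /= -!RintegralZl // -RintegralB //; last 2 first.
  + exact: (rintZ (Re k) mD f1).
  + exact: (rintZ (Im k) mD f2).
  by apply: eq_Rintegral => t _; exact: ReM.
- rewrite ImM /= -!RintegralZl // -RintegralD //; last 2 first.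
  + exact: (rintZ (Re k) mD f2).
  + exact: (rintZ (Im k) mD f1).
  by apply: eq_Rintegral => t _; exact: ImM.
Qed.

Lemma cintB D f g : mbl D -> cintegrable D f -> cintegrable D g ->
  cintegral D (fun t => f t - g t) = cintegral D f - cintegral D g.
Proof.
move=> mD fi gi; have gi' := cintegrableZ (-1) mD gi.
rewrite -mulN1r -cintZ // -cintD //; apply: cint_ext => t _; by rewrite mulN1r.
Qed.

Lemma cintegrable0 D : mbl D -> cintegrable D (fun=> 0).
Proof. by move=> mD; split; exact: integrable0. Qed.

Lemma cint0 D : cintegral D (fun=> 0) = 0.
Proof. by apply: complex_eqP; rewrite /= /Rintegral integral0. Qed.

Lemma cintegrable_sum D I (r : seq I) (f : I -> R -> R[i]) : mbl D ->
  (forall i, cintegrable D (f i)) -> cintegrable D (fun t => \sum_(i <- r) f i t).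
Proof.
move=> mD fi; elim: r => [|i r IH].
  by under eq_fun do rewrite big_nil; exact: cintegrable0.
by under eq_fun do rewrite big_cons; exact: cintegrableD.
Qed.

Lemma cint_sum D I (r : seq I) (f : I -> R -> R[i]) : mbl D ->
  (forall i, cintegrable D (f i)) ->
  cintegral D (fun t => \sum_(i <- r) f i t) = \sum_(i <- r) cintegral D (f i).
Proof.
move=> mD fi; elim: r => [|i r IH].
  by under eq_fun do rewrite big_nil; rewrite big_nil cint0.
under eq_fun do rewrite big_cons; rewrite big_cons cintD // ?IH //.
exact: cintegrable_sum.
Qed.

Definition cmeas D f : Prop :=
  measurable_fun D (fun t => Re (f t)) /\ measurable_fun D (fun t => Im (f t)).

Lemma cmeas_Ck D f : mbl D -> Ck 0 D f -> cmeas D f.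
Proof.
by move=> mD cf; split; apply: meas_cont => // t /cf[].
Qed.

Lemma cintegrable_meas D f : cintegrable D f -> cmeas D f.
Proof. by move=> [/rint_meas ? /rint_meas]. Qed.

Lemma cmeas_normc D f : cmeas D f -> measurable_fun D (fun t => normc (f t)).
Proof.
move=> [f1 f2]; under eq_fun do rewrite normc_sqrtE.
have ms : measurable_fun [set: R] (@Num.sqrt R).
  by apply: continuous_measurable_fun; exact: sqrt_continuous.
apply: (measurableT_comp ms).
by apply: measurable_funD; apply: measurable_funX.
Qed.

Lemma cintegrable_le D f h : mbl D -> cmeas D f ->
  (forall t, D t -> normc (f t) <= h t) -> rint D h -> cintegrable D f.
Proof.
move=> mD [f1 f2] fh hi; split; apply: rint_le hi => // t Dt.
- exact: le_trans (Re_le_normc _) (fh t Dt).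
- exact: le_trans (Im_le_normc _) (fh t Dt).
Qed.

Lemma rint_normc D f : mbl D -> cintegrable D f -> rint D (fun t => normc (f t)).
Proof.
move=> mD fi; have [f1 f2] := fi.
have hi : rint D (fun t => `|Re (f t)| + `|Im (f t)|).
  by apply: rintD => //; exact: integrable_norm.
apply: rint_le hi => //; first exact: cmeas_normc (cintegrable_meas fi).
by move=> t Dt; rewrite ger0_norm ?normc_ge0 // normc_le_ReIm.
Qed.

(** The factor 2 comes from bounding the real and the imaginary part separately; it is harmless in
    estimates up to a constant. *)
Lemma normc_cint_le D f h : mbl D -> cintegrable D f -> rint D h ->
  (forall t, D t -> normc (f t) <= h t) ->
  normc (cintegral D f) <= 2 * \int[mu]_(t in D) h t.
Proof.
move=> mD [f1 f2] hi fh; apply: le_trans (normc_le_ReIm _) _.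
have le (k : R -> R) : rint D k -> (forall t, D t -> `|k t| <= h t) ->
    `|\int[mu]_(t in D) k t| <= \int[mu]_(t in D) h t.
  move=> ki kh; apply: le_trans (le_normr_Rintegral mD ki) _.
  by apply: le_Rintegral => //; exact: integrable_norm.
rewrite mulr_natl mulr2n; apply: lerD; apply: le => // t Dt.
- exact: le_trans (Re_le_normc _) (fh t Dt).
- exact: le_trans (Im_le_normc _) (fh t Dt).
Qed.

Lemma cintegrable_cc a b f : Ck 0 `[a, b] f -> cintegrable `[a, b] f.
Proof.
by move=> cf; split; apply: rint_cc => t tab;
  have [] := cf t _ => //=; rewrite in_itv.
Qed.

(* D is the union of the increasing compact intervals [a n, b n]. *)
Definition exh D (a b : nat -> R) : Prop :=
  [/\ forall n, a n < b n, forall n m, (n <= m)%N -> a m <= a n,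
      forall n m, (n <= m)%N -> b n <= b m & forall t, D t <-> exists n, a n <= t <= b n].

Lemma exh_bigcup D a b : exh D a b -> D = \bigcup_n `[a n, b n]%classic.
Proof.
move=> [_ _ _ Dab]; apply/seteqP; split => t.
- by move=> /Dab[n tn]; exists n => //=; rewrite in_itv.
- by move=> [n _ /=]; rewrite in_itv /= => tn; apply/Dab; exists n.
Qed.

Lemma exh_sub D a b n : exh D a b -> `[a n, b n] `<=` D.
Proof. by move=> [_ _ _ Dab] t /=; rewrite in_itv /= => tn; apply/Dab; exists n. Qed.

Lemma exh_meas D a b : exh D a b -> mbl D.
Proof. by move=> /exh_bigcup ->; apply: bigcup_measurable. Qed.

Lemma exh_homo D a b : exh D a b ->
  {homo (fun n => `[a n, b n]%classic : set R) : n m / (n <= m)%N >-> (n <= m)%O}.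
Proof.
move=> [_ am bm _] n m nm; apply/subsetPset => t /=; rewrite !in_itv /= => /andP[a1 b1].
by rewrite (le_trans (am _ _ nm)) // (le_trans b1) // bm.
Qed.

Lemma cvg_exh_ge0 D a b h : exh D a b -> rint D h -> (forall t, D t -> 0 <= h t) ->
  \int[mu]_(t in `[a n, b n]) h t @[n --> \oo] --> \int[mu]_(t in D) h t.
Proof.
move=> e ih h0; have mD := exh_meas e.
have := @ge0_nondecreasing_set_cvg_integral _ (measurableTypeR R) R _ (EFin \o h) mu (exh_homo e).
rewrite -(exh_bigcup e) => H; apply: fine_cvg; rewrite fineK ?integrable_fin_num //.
apply: H => //.
- move=> n; apply: measurable_funS (exh_sub (n := n) e) _ => //.
  exact: (measurable_int mu).
- by move=> n t /(exh_sub e) Dt; rewrite lee_fin; exact: h0.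
Qed.

(** Both |h| + h and |h| are nonnegative, so monotone convergence applies to each, and [h] is their
    difference. *)
Lemma cvg_exh D a b h : exh D a b -> rint D h ->
  \int[mu]_(t in `[a n, b n]) h t @[n --> \oo] --> \int[mu]_(t in D) h t.
Proof.
move=> e ih; have mD := exh_meas e.
have ia : rint D (fun t => `|h t|) by exact: integrable_norm.
have ip : rint D (fun t => `|h t| + h t) by exact: rintD.
have p0 t : D t -> 0 <= `|h t| + h t.
  by move=> _; rewrite -lerBlDr sub0r; case: (ler_normlP _ _ (lexx `|h t|)).
have c1 := cvg_exh_ge0 e ip p0.
have c2 := cvg_exh_ge0 e ia (fun t _ => normr_ge0 (h t)).
rewrite (_ : \int[mu]_(t in D) h t =
    \int[mu]_(t in D) (`|h t| + h t) - \int[mu]_(t in D) `|h t|); last first.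
  by rewrite RintegralD // addrAC subrr add0r.
rewrite (_ : (fun n => \int[mu]_(t in `[a n, b n]) h t) = fun n =>
    \int[mu]_(t in `[a n, b n]) (`|h t| + h t) - \int[mu]_(t in `[a n, b n]) `|h t|).
  exact: cvgB.
apply/funext => n; have s := exh_sub (n := n) e; rewrite RintegralD //.
- by rewrite addrAC subrr add0r.
- exact: rint_sub ia.
- exact: rint_sub ih.
Qed.

Lemma cint_exh D a b f : exh D a b -> cintegrable D f ->
  cto \oo (fun n => cintegral `[a n, b n] f) (cintegral D f).
Proof. by move=> e [f1 f2]; split => /=; exact: cvg_exh. Qed.

(** By monotone convergence the integral over [D] is the limit of the truncated ones, hence at most
    [M] and in particular finite. *)
Lemma rint_exh D a b h M : exh D a b -> (forall t, D t -> {for t, continuous h}) ->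
  (forall t, D t -> 0 <= h t) -> (forall n, \int[mu]_(t in `[a n, b n]) h t <= M) ->
  rint D h.
Proof.
move=> e ch h0 hM; have mD := exh_meas e; have mh := meas_cont mD ch.
apply/integrableP; split; first exact/measurable_EFinP.
have H := @ge0_nondecreasing_set_cvg_integral _ (measurableTypeR R) R _ (EFin \o h) mu (exh_homo e).
rewrite (_ : (\int[mu]_(x in D) `|(EFin \o h) x|)%E = (\int[mu]_(x in D) (EFin \o h) x)%E);
  last first.
  by apply: eq_integral => t; rewrite inE => Dt /=; rewrite ger0_norm // h0.
have mhn n : measurable_fun (`[a n, b n]%classic : set (measurableTypeR R)) (EFin \o h).
  by apply/measurable_EFinP; apply: measurable_funS mh => //; exact: (exh_sub (n := n) e).
have {}H := H (fun n => measurable_itv _) mhn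
  (fun n t tn => h0 t (exh_sub (n := n) e tn)).
rewrite (exh_bigcup e); apply: (@le_lt_trans _ _ M%:E); last exact: ltry.
rewrite -(cvg_lim _ H) //; apply: lime_le; first by apply/cvg_ex; eexists; exact: H.
near=> n.
have ri : rint `[a n, b n] h.
  by apply: rint_cc => t tn; apply: ch; apply: (exh_sub e (n := n)); rewrite /= in_itv.
by rewrite -[leLHS]fineK ?integrable_fin_num // lee_fin; exact: hM.
Unshelve. all: end_near. Qed.

Lemma ftc_cc (F h : R -> R) (a b : R) : a < b ->
  (forall t, a <= t <= b -> is_derive t 1 F (h t)) ->
  (forall t, a <= t <= b -> {for t, continuous h}) ->
  \int[mu]_(t in `[a, b]) h t = F b - F a.
Proof.
move=> ab dF ch; have cF t : a <= t <= b -> {for t, continuous F}.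
  by move=> /dF[d _]; apply: differentiable_continuous; exact/derivable1_diffP.
rewrite /Rintegral (@continuous_FTC2 _ h F) //.
- by apply: continuous_in_subspaceT => x; rewrite inE /= in_itv /=; exact: ch.
- split.
  + by move=> t; rewrite in_itv /= => /andP[/ltW ? /ltW ?]; case: (dF t) => //; apply/andP.
  + by apply: cvg_at_right_filter; apply: cF; rewrite lexx ltW.
  + by apply: cvg_at_left_filter; apply: cF; rewrite lexx ltW.
- move=> t; rewrite in_itv /= => /andP[/ltW ? /ltW ?].
  by rewrite derive1E; case: (dF t) => //; apply/andP.
Qed.

Lemma cftc_cc F f (a b : R) : a < b -> (forall t, a <= t <= b -> isd F t (f t)) ->
  Ck 0 `[a, b] f -> cintegral `[a, b] f = F b - F a.
Proof.
move=> ab dF cf; apply: complex_eqP; rewrite ?ReD ?ImD ?ReN ?ImN ?cint_re ?cint_im.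
- apply: (@ftc_cc (fun t => Re (F t)) (fun t => Re (f t))) => // t tab; first by case: (dF t tab).
  by have [] := cf t _ => //=; rewrite in_itv.
- apply: (@ftc_cc (fun t => Im (F t)) (fun t => Im (f t))) => // t tab; first by case: (dF t tab).
  by have [] := cf t _ => //=; rewrite in_itv.
Qed.

Lemma cftc D a b F f A B : exh D a b -> (forall t, D t -> isd F t (f t)) -> Ck 0 D f ->
  cintegrable D f -> cto \oo (fun n => F (a n)) A -> cto \oo (fun n => F (b n)) B ->
  cintegral D f = B - A.
Proof.
move=> e dF cf fi FA FB; apply: cto_uniq (cint_exh e fi) _.
apply: cto_ext (ctoB FB FA) => n; rewrite -(@cftc_cc F f) //; first by case: e.
- by move=> t tn; apply: dF; apply: (exh_sub e (n := n)); rewrite /= in_itv.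
- exact: Ck_sub (exh_sub e) cf.
Qed.

(** A bounded primitive bounds every truncated integral by 2M, so integrability follows without
    knowing limits of [G] at the ends. *)
Lemma rint_prim D a b G h M : exh D a b -> (forall t, D t -> is_derive t 1 G (h t)) ->
  (forall t, D t -> {for t, continuous h}) -> (forall t, D t -> 0 <= h t) ->
  (forall t, D t -> `|G t| <= M) -> rint D h.
Proof.
move=> e dG ch h0 GM; apply: (rint_exh (M := M + M) e) => // n.
have [anbn _ _ _] := e; have s := exh_sub (n := n) e.
have Dn t : a n <= t <= b n -> D t by move=> tn; apply: s; rewrite /= in_itv.
have -> := @ftc_cc G h (a n) (b n) (anbn n) (fun t tn => dG t (Dn t tn)) (fun t tn => ch t (Dn t tn)).
apply: le_trans (ler_norm _) _; apply: le_trans (ler_normB _ _) _.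
by apply: lerD; apply: GM; apply: Dn; rewrite lexx ltW.
Qed.

Lemma archi_inv (x : R) : 0 < x -> exists n : nat, n.+2%:R^-1 < x.
Proof.
move=> x0; exists (Num.truncn x^-1).
rewrite -[ltRHS]invrK ltf_pV2 ?posrE ?invr_gt0 // ?ltr0n //.
by apply: lt_trans (truncnS_gt _) _; rewrite ltr_nat.
Qed.

(** The offset 3 makes each cut at most a third of the length, so the truncated interval is
    nondegenerate already for n = 0. *)
Lemma exh_oo (a b : R) : a < b ->
  exh `]a, b[ (fun n => a + (b - a) / n.+3%:R) (fun n => b - (b - a) / n.+3%:R).
Proof.
move=> ab; have d0 : 0 < b - a by rewrite subr_gt0.
have le n m : (n <= m)%N -> (b - a) / m.+3%:R <= (b - a) / n.+3%:R.
  by move=> nm; rewrite ler_pM2l // lef_pV2 ?posrE ?ltr0n // ler_nat.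
have p n : 0 < (b - a) / n.+3%:R by rewrite divr_gt0.
have l3 n : (b - a) / n.+3%:R <= (b - a) / 3%:R by exact: (le 0%N).
split.
- by move=> n; move: (l3 n); set q := _ / n.+3%:R; lra.
- by move=> n m /le; set q := _ / n.+3%:R; set q' := _ / m.+3%:R; lra.
- by move=> n m /le; set q := _ / n.+3%:R; set q' := _ / m.+3%:R; lra.
- move=> t /=; rewrite in_itv /=; split.
  + move=> /andP[a1 b1].
    have [|n hn] := @archi_inv (Num.min (t - a) (b - t) / (b - a)).
      by rewrite divr_gt0 // lt_min !subr_gt0 a1.
    exists n; have h : (b - a) / n.+3%:R <= Num.min (t - a) (b - t).
      rewrite mulrC -ler_pdivlMr //; apply: ltW; apply: le_lt_trans hn.
      by rewrite lef_pV2 ?posrE ?ltr0n // ler_nat.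
    by move: h; rewrite le_min => /andP[]; set q := _ / n.+3%:R; lra.
  + by move=> [n]; move: (p n); set q := _ / n.+3%:R; lra.
Qed.

Lemma exh_0y : exh `]0 : R, +oo[ (fun n => n.+2%:R^-1) (fun n => n.+2%:R).
Proof.
split.
- by move=> n; apply: (@lt_trans _ _ 1); rewrite ?ltr1n // invf_lt1 ?ltr1n // ltr0n.
- by move=> n m nm; rewrite lef_pV2 ?posrE ?ltr0n // ler_nat.
- by move=> n m nm; rewrite ler_nat.
- move=> t /=; rewrite in_itv /= andbT; split; last first.
    by move=> [n /andP[+ _]]; apply: lt_le_trans; rewrite invr_gt0 ltr0n.
  move=> t0; have [n hn] := archi_inv t0; exists (n + Num.truncn t)%N.
  apply/andP; split.
    by apply: le_trans (ltW hn); rewrite lef_pV2 ?posrE ?ltr0n // ler_nat !ltnS leq_addr.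
  apply: le_trans (ltW (truncnS_gt _)) _; rewrite ler_nat ltnS.
  by rewrite (leq_trans (leq_addl n _)).
Qed.

End Integrals.

(** * Integration on open intervals: limits at the ends, Riemann-Lebesgue, substitution *)

Section Substitution.
Context {R : realType}.
Local Notation mu := (@lebesgue_measure R).
Local Notation mbl D := (@measurable _ (measurableTypeR R) D).
Implicit Types (t : R) (f g : R -> R[i]) (h : R -> R) (k : R[i]) (D E : set R).

Lemma inv_natS3 (c : R) : c / n.+3%:R @[n --> \oo] --> 0.
Proof.
rewrite -(mulr0 c); apply: cvgM; first exact: cvg_cst.
apply: (@squeeze_cvgr _ _ _ _ (fun=> 0) (@harmonic R)); last 2 first.
- exact: cvg_cst.
- exact: cvg_harmonic.
near=> n; rewrite invr_ge0 ler0n /= lef_pV2 ?posrE ?ltr0n // ler_nat.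
by rewrite ltnW // ltnW.
Unshelve. all: end_near. Qed.

Lemma seq_at_right (a : R) (u : nat -> R) : (forall n, a < u n) ->
  u n @[n --> \oo] --> a -> u n @[n --> \oo] --> a^'+.
Proof.
by move=> au ua P h; have [N _ hN] := ua _ h; exists N => // n Nn; exact: (hN n Nn (au n)).
Qed.

Lemma seq_at_left (a : R) (u : nat -> R) : (forall n, u n < a) ->
  u n @[n --> \oo] --> a -> u n @[n --> \oo] --> a^'-.
Proof.
by move=> au ua P h; have [N _ hN] := ua _ h; exists N => // n Nn; exact: (hN n Nn (au n)).
Qed.

Lemma natS2_infty : (n.+2%:R : R) @[n --> \oo] --> +oo.
Proof.
apply/cvgryPge => A; exists (Num.truncn A) => // n /= hn.
by apply: le_trans (ltW (truncnS_gt _)) _; rewrite ler_nat ltnS (leq_trans hn).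
Qed.

Lemma inv_natS2 : (n.+2%:R : R)^-1 @[n --> \oo] --> 0^'+.
Proof.
apply: seq_at_right; first by move=> n; rewrite invr_gt0 ltr0n.
apply: (@squeeze_cvgr _ _ _ _ (fun=> 0) (@harmonic R)); last 2 first.
- exact: cvg_cst.
- exact: cvg_harmonic.
near=> n; rewrite invr_ge0 ler0n /= lef_pV2 ?posrE ?ltr0n // ler_nat //.
Unshelve. all: end_near. Qed.

Lemma cftc_oo (a b : R) F f A B : a < b -> (forall t, a < t < b -> isd F t (f t)) ->
  Ck 0 `]a, b[ f -> cintegrable `]a, b[ f -> cto a^'+ F A -> cto b^'- F B ->
  cintegral `]a, b[ f = B - A.
Proof.
move=> ab dF cf fi FA FB; apply: (cftc (exh_oo ab) _ cf fi).
- by move=> t /=; rewrite in_itv; exact: dF.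
- apply: cto_comp FA; apply: seq_at_right.
    by move=> n; rewrite ltrDl divr_gt0 // subr_gt0.
  by rewrite -[X in _ --> X]addr0; apply: cvgD; [exact: cvg_cst|exact: inv_natS3].
- apply: cto_comp FB; apply: seq_at_left.
    by move=> n; rewrite gtrDl oppr_lt0 divr_gt0 // subr_gt0.
  by rewrite -[X in _ --> X]subr0; apply: cvgB; [exact: cvg_cst|exact: inv_natS3].
Qed.

Lemma cftc_0y F f A B : (forall t, 0 < t -> isd F t (f t)) ->
  Ck 0 `]0, +oo[ f -> cintegrable `]0, +oo[ f -> cto 0^'+ F A -> cto +oo F B ->
  cintegral `]0, +oo[ f = B - A.
Proof.
move=> dF cf fi FA FB; apply: (cftc exh_0y _ cf fi).
- by move=> t /=; rewrite in_itv /= andbT; exact: dF.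
- by apply: cto_comp FA; exact: inv_natS2.
- by apply: cto_comp FB; exact: natS2_infty.
Qed.

Lemma Rintegral_split D E h : mbl D -> mbl E -> E `<=` D -> rint D h ->
  \int[mu]_(t in D) h t = \int[mu]_(t in E) h t + \int[mu]_(t in D `\` E) h t.
Proof.
move=> mD mE ED hi; have mDE : mbl (D `\` E) by exact: measurableD.
rewrite -Rintegral_setU ?setDUK //.
by apply/disj_setPS => t [Et []].
Qed.

Lemma cint_split D E f : mbl D -> mbl E -> E `<=` D -> cintegrable D f ->
  cintegral D f = cintegral E f + cintegral (D `\` E) f.
Proof.
move=> mD mE ED [f1 f2]; apply: complex_eqP; rewrite ?ReD ?ImD !(cint_re, cint_im).
- exact: Rintegral_split.
- exact: Rintegral_split.
Qed.

Lemma rint_split D E h : mbl D -> mbl E -> rint E h -> rint (D `\` E) h -> rint D h.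
Proof.
move=> mD mE i1 i2; have mDE : mbl (D `\` E) by exact: measurableD.
have /(rint_sub _ mD) : rint (E `|` D `\` E) h.
  rewrite /rint; apply/integrableP; have := i1; have := i2.
  move=> /integrableP[m2 l2] /integrableP[m1 l1]; split.
    by apply/measurable_funU.
  rewrite ge0_integral_setU //.
  - by apply: lte_add_pinfty.
  - by apply: measurableT_comp => //; apply/measurable_funU.
  - by apply/disj_setPS => t [Et []].
apply; first exact: measurableU.
by move=> t Dt; case: (pselect (E t)) => Et; [left|right].
Qed.

Lemma cintegrable_split D E f : mbl D -> mbl E -> cintegrable E f ->
  cintegrable (D `\` E) f -> cintegrable D f.
Proof. by move=> mD mE [i1 i2] [j1 j2]; split; apply: rint_split; eassumption. Qed.

Lemma Rintegral_subset D E h : mbl D -> mbl E -> E `<=` D -> rint D h ->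
  (forall t, D t -> 0 <= h t) -> \int[mu]_(t in E) h t <= \int[mu]_(t in D) h t.
Proof.
move=> mD mE ED hi h0; rewrite (Rintegral_split mD mE ED hi) lerDl.
by apply: Rintegral_ge0 => t [Dt _]; exact: h0.
Qed.

(* The integrand is cut at a compact [a n, b n]: there one integration by parts gives
   O(1/x), and the two remaining pieces are small uniformly in x. *)
Lemma riemann_lebesgue D a b (h p q : R -> R[i]) (theta theta' : R -> R) (s : R) :
  exh D a b -> Ck 0 D h -> cintegrable D h ->
  (forall t, D t -> isd q t (p t)) -> Ck 0 D p ->
  (forall t, D t -> is_derive t 1 theta (theta' t)) ->
  (forall t, D t -> q t * (theta' t)%:C = h t) -> s != 0 ->
  cto +oo (fun x => cintegral D (fun t => h t * cexp (cI * (s * x * theta t)%:C))) 0.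
Proof.
move=> e ch hi dq cp dth qth s0; have mD := exh_meas e.
pose E (x : R) t := cexp (cI * (s * x * theta t)%:C).
have nE x t : normc (E x t) = 1.
  by rewrite /E normc_cexp !ReImE /= mul0r mulr0 subrr expR0.
have dE x t : D t -> isd (E x) t (cI * (s * x)%:C * (theta' t)%:C * E x t).
  move=> Dt; apply: isd_eq (isd_cexp _) _; last by [].
  have /(isdZ (cI * (s * x)%:C)) := isd_real (dth t Dt).
  by apply: isd_ext => u; rewrite (realCM (s * x)) mulrA.
have cE x : Ck 0 D (E x) by move=> t /(dE x)/isd_cto.
have chE x : Ck 0 D (fun t => h t * E x t) by exact: CkM.
have hEi x : cintegrable D (fun t => h t * E x t).
  apply: cintegrable_le (rint_normc mD hi) => //; first exact: cmeas_Ck.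
  by move=> t Dt; rewrite normcM nE mulr1.
have hni := rint_normc mD hi.
suff: cto +oo (fun x => cintegral D (fun t => h t * E x t)) 0 by [].
apply/cto0_normc/cvgr0Pnorm_le => eps eps0.
(* A quarter of [eps], because [normc_cint_le] doubles it; the outer pieces then use up one half of
   [eps]. *)
have [n hn] : exists n, \int[mu]_(t in D) normc (h t) -
    \int[mu]_(t in `[a n, b n]) normc (h t) <= eps / 4.
  have := cvg_exh_ge0 e hni (fun t _ => normc_ge0 (h t)).
  move=> /cvgrPdist_le/(_ (eps / 4) _)[|n _ /(_ n (leqnn n)) /=]; first by rewrite divr_gt0.
  by move=> hn; exists n; apply: le_trans hn; exact: ler_norm.
have sub := exh_sub (n := n) e; have [/(_ n) ab _ _ _] := e.
have mI : mbl `[a n, b n] by [].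
have cpI : Ck 0 `[a n, b n] p by exact: Ck_sub cp.
have pni := rint_normc mI (cintegrable_cc cpI).
pose C := normc (q (b n)) + normc (q (a n)) + 2 * \int[mu]_(t in `[a n, b n]) normc (p t).
have C0 : 0 <= C.
  rewrite /C addr_ge0 ?addr_ge0 ?normc_ge0 // mulr_ge0 //.
  by apply: Rintegral_ge0 => t _; exact: normc_ge0.
near=> x; have x0 : 0 < x by near: x; exact: nbhs_pinfty_gt.
rewrite ger0_norm ?normc_ge0 // (cint_split mD mI sub (hEi x)).
apply: le_trans (normcD _ _) _; rewrite [eps]splitr; apply: lerD; last first.
  have mDI : mbl (D `\` `[a n, b n]) by exact: measurableD.
  have sDI : D `\` `[a n, b n] `<=` D by move=> t [].
  apply: (le_trans (normc_cint_le mDI (cintegrable_sub mD mDI sDI (hEi x))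
    (rint_sub mD mDI sDI hni) _)).
    by move=> t _; rewrite normcM nE mulr1.
  by move: hn; rewrite (Rintegral_split mD mI sub hni) addrAC subrr add0r; lra.
have I1 : cintegrable `[a n, b n] (fun t => p t * E x t).
  by apply: cintegrable_cc; apply: CkM => //; exact: Ck_sub (cE x).
have I2 := cintegrable_sub mD mI sub (hEi x).
(* The integrand is the derivative of q E, since q theta' = h. Thus s x times the wanted integral
   equals boundary terms minus an integral of p E, all bounded by [C] uniformly in x. *)
have : cintegral `[a n, b n] (fun t => p t * E x t + cI * (s * x)%:C * (h t * E x t)) =
    q (b n) * E x (b n) - q (a n) * E x (a n).
  apply: (@cftc_cc _ (fun t => q t * E x t)) => //.
    move=> t tn; have Dt : D t by apply: sub; rewrite /= in_itv.
    apply: isd_eq (isdM (dq t Dt) (dE x t Dt)) _; rewrite -(qth t Dt); ring.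
  apply: CkD; last apply: CkZ; apply: CkM => //; try exact: Ck_sub (cE x).
  exact: Ck_sub ch.
rewrite cintD //; last exact: cintegrableZ.
rewrite cintZ // => /(canRL (addKr _)) eq1.
have : normc (cI * (s * x)%:C * cintegral `[a n, b n] (fun t => h t * E x t)) <= C.
  rewrite eq1 addrC; apply: le_trans (normcB _ _) _; rewrite lerD //.
    by apply: le_trans (normcB _ _) _; rewrite normcM nE mulr1 normcM nE mulr1.
  apply: normc_cint_le => // t _; by rewrite normcM nE mulr1.
rewrite !normcM normc_real normc_cI mul1r normrM (gtr0_norm x0).
have sx0 : 0 < `|s| * x by rewrite mulr_gt0 // normr_gt0.
rewrite mulrC -ler_pdivlMr // => /le_trans -> //.
have : C / (eps / 2) / `|s| <= x by near: x; apply: nbhs_pinfty_ge; exact: num_real.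
rewrite !ler_pdivrMr ?normr_gt0 ?divr_gt0 // => /le_trans; apply.
by rewrite mulrC [x * _]mulrC.
Unshelve. all: end_near. Qed.

Lemma rsub_cc D (F F' h : R -> R) (a b : R) : open D -> a < b -> `[a, b] `<=` D ->
  (forall t, D t -> is_derive t 1 F (F' t)) -> (forall t, D t -> {for t, continuous F'}) ->
  (forall t, D t -> 0 < F' t) -> (forall t, F a <= t <= F b -> {for t, continuous h}) ->
  \int[mu]_(t in `[F a, F b]) h t = \int[mu]_(s in `[a, b]) (F' s * h (F s)).
Proof.
move=> oD ab sD dF cF' F'0 ch.
have Dt t : a <= t <= b -> D t by move=> tab; apply: sD; rewrite /= in_itv.
have eF t : D t -> (derive1 F) t = F' t by move=> /dF[_ <-]; rewrite derive1E.
have cF t : D t -> {for t, continuous F}.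
  by move=> /dF[d _]; apply: differentiable_continuous; exact/derivable1_diffP.
have cdF t : D t -> {for t, continuous (derive1 F)}.
  move=> Dt'; rewrite /prop_for /continuous_at eF //.
  apply: cvg_trans (cF' t Dt'); apply: near_eq_cvg.
  by apply: filterS (open_nbhs_nbhs (conj oD Dt')) => u Du; rewrite eF.
have Da : D a by apply: Dt; rewrite lexx ltW.
have Db : D b by apply: Dt; rewrite lexx ltW.
have oo t : t \in `]a, b[ -> D t.
  by rewrite in_itv /= => /andP[/ltW ? /ltW ?]; apply: Dt; apply/andP.
rewrite /Rintegral (@integration_by_substitution_increasing _ F h) //.
- congr fine; apply: eq_integral => t; rewrite inE => /= tab.
  by rewrite -(eF t (sD t tab)) [in RHS]mulrC.
- exact: ltW.
- apply: gtr0_derive1_lt_cc.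
  + by move=> t /oo/dF[].
  + by move=> t /oo Dt'; rewrite eF //; exact: F'0.
  + by apply: continuous_in_subspaceT => t; rewrite inE => /sD; exact: cF.
- by move=> t /oo; exact: cdF.
- by apply/cvg_ex; exists ((derive1 F) a); apply: cvg_at_right_filter; exact: cdF.
- by apply/cvg_ex; exists ((derive1 F) b); apply: cvg_at_left_filter; exact: cdF.
- split.
  + by move=> t /oo/dF[].
  + by apply: cvg_at_right_filter; exact: cF.
  + by apply: cvg_at_left_filter; exact: cF.
- by apply: continuous_in_subspaceT => t; rewrite inE /= in_itv /=; exact: ch.
Qed.

(** Integrability of the pulled back function is part of the conclusion: the truncated integrals of
    F' |f o F| are, by substitution on compact intervals, bounded by the integral of |f|. The
    identity then follows by exhausting both sides along corresponding intervals. *)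
Lemma cint_subst D E (a b : nat -> R) (F F' : R -> R) f :
  open D -> open E -> exh D a b ->
  exh E (fun n => F (a n)) (fun n => F (b n)) ->
  (forall t, D t -> is_derive t 1 F (F' t)) -> (forall t, D t -> {for t, continuous F'}) ->
  (forall t, D t -> 0 < F' t) -> (forall t, D t -> E (F t)) ->
  Ck 0 E f -> cintegrable E f ->
  cintegrable D (fun s => (F' s)%:C * f (F s)) /\
  cintegral D (fun s => (F' s)%:C * f (F s)) = cintegral E f.
Proof.
move=> oD oE eD eE dF cF' F'0 DE cf fi.
have mD := exh_meas eD; have mE := exh_meas eE.
have cF t : D t -> {for t, continuous F}.
  by move=> /dF[d _]; apply: differentiable_continuous; exact/derivable1_diffP.
have cg : Ck 0 D (fun s => (F' s)%:C * f (F s)).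
  move=> t Dt; apply: ctoM; first by apply: cto_real; exact: cF'.
  exact: cto_comp (cF t Dt) (cf _ (DE t Dt)).
have cnf t : E t -> {for t, continuous (fun u => normc (f u))}.
  by move=> Et; exact: cto_normc (cf t Et).
have rs n (h : R -> R) : (forall t, E t -> {for t, continuous h}) ->
    \int[mu]_(t in `[F (a n), F (b n)]) h t = \int[mu]_(s in `[a n, b n]) (F' s * h (F s)).
  move=> ch; apply: (@rsub_cc D) => //; first by case: eD.
    exact: exh_sub eD.
  by move=> t tn; apply: ch; apply: (exh_sub eE (n := n)); rewrite /= in_itv.
have gi : cintegrable D (fun s => (F' s)%:C * f (F s)).
  apply: (@cintegrable_le _ _ _ (fun s => F' s * normc (f (F s)))) => //.
  - exact: cmeas_Ck.
  - by move=> t Dt; rewrite normcM normc_real gtr0_norm // F'0.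
  - apply: (@rint_exh _ _ _ _ _ (\int[mu]_(t in E) normc (f t)) eD) => //.
    + move=> t Dt; apply: cvgM; first exact: cF'.
      exact: cvg_comp (cF t Dt) (cnf _ (DE t Dt)).
    + by move=> t Dt; rewrite mulr_ge0 ?normc_ge0 // ltW // F'0.
    + move=> n; rewrite -(rs n (fun t => normc (f t)) cnf).
      apply: Rintegral_subset => //; first exact: (exh_sub (n := n) eE).
        exact: rint_normc.
      by move=> t _; exact: normc_ge0.
split => //; apply: cto_uniq (cint_exh eD gi) _.
apply: cto_ext (cint_exh eE fi) => n; apply: complex_eqP; rewrite ?cint_re ?cint_im rs.
- by apply: eq_Rintegral => t _; rewrite ReM /= mul0r subr0.
- by move=> t Et; case: (cf t Et).
- by apply: eq_Rintegral => t _; rewrite ImM /= mul0r addr0.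
- by move=> t Et; case: (cf t Et).
Qed.

End Substitution.

(** * The Gamma and Beta functions *)

Section RealPowers.
Context {R : realType}.
Local Notation mu := (@lebesgue_measure R).
Local Notation mbl D := (@measurable _ (measurableTypeR R) D).
Implicit Types (t u x y p : R) (D E : set R).

(** An increasing bijection carries one exhaustion to another; the last hypothesis is convexity of
    [E], which keeps the image intervals inside it. *)
Lemma exh_image D E (a b : nat -> R) (F G : R -> R) : exh D a b ->
  (forall s u, D s -> D u -> s < u -> F s < F u) -> (forall s, D s -> E (F s)) ->
  (forall t, E t -> D (G t) /\ F (G t) = t) ->
  (forall u v t, E u -> E v -> u <= t <= v -> E t) ->
  exh E (fun n => F (a n)) (fun n => F (b n)).
Proof.
move=> [ab am bm Dab] Fm DE EG Ec.
have Da n : D (a n) by apply/Dab; exists n; rewrite lexx ltW.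
have Db n : D (b n) by apply/Dab; exists n; rewrite lexx ltW.
have Fle s u : D s -> D u -> s <= u -> F s <= F u.
  by move=> Ds Du; rewrite le_eqVlt => /predU1P[->//|/(Fm _ _ Ds Du)/ltW].
split.
- by move=> n; exact: Fm.
- by move=> n m /am; exact: Fle.
- by move=> n m /bm; exact: Fle.
- move=> t; split.
  + move=> /EG[DG <-]; have /Dab[n /andP[l r]] := DG.
    by exists n; apply/andP; split; exact: Fle.
  + by move=> [n tn]; apply: Ec tn; exact: DE.
Qed.

Lemma powRE x p : 0 < x -> x `^ p = expR (p * ln x).
Proof. by move=> x0; rewrite /powR gt_eqF. Qed.

Lemma is_derive_cont (f : R -> R) t a : is_derive t 1 f a -> {for t, continuous f}.
Proof. by move=> [d _]; apply: differentiable_continuous; exact/derivable1_diffP. Qed.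

Lemma cont_powR p t : 0 < t -> {for t, continuous (fun u : R => u `^ p)}.
Proof.
move=> /(is_derive1_powR p)[d _].
by apply: differentiable_continuous; exact/derivable1_diffP.
Qed.

Lemma inv_pinfty : x^-1 @[x --> +oo] --> (0 : R).
Proof. by apply/gtr0_cvgV0; [near=> x|exact: cvg_id]. Unshelve. all: end_near. Qed.

(* The primitive of t^(x-1) (1+t)^(-x-1) is the bounded function (t/(1+t))^x / x. *)
Definition gmaj x t : R := t `^ (x - 1) * (1 + t) `^ (- x - 1).

Lemma gmaj_ge0 x t : 0 <= gmaj x t. Proof. by rewrite mulr_ge0 ?powR_ge0. Qed.

Lemma is_derive_addl (c t : R) : is_derive t 1 (fun u : R => c + u) 1.
Proof.
suff: is_derive t 1 (cst c + id : R -> R) 1 by [].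
by apply: is_derive_eq (is_deriveD (is_derive_cst c t 1) (is_derive_id t 1)) _; rewrite add0r.
Qed.

Lemma is_derive_subl (c t : R) : is_derive t 1 (fun u : R => c - u) (-1).
Proof.
suff: is_derive t 1 (cst c - id : R -> R) (-1) by [].
by apply: is_derive_eq (is_deriveB (is_derive_cst c t 1) (is_derive_id t 1)) _; rewrite sub0r.
Qed.

Lemma is_derive_ln1D t : 0 < t -> is_derive t 1 (fun u : R => ln (1 + u)) (1 + t)^-1.
Proof.
move=> t0; have t1 : 0 < 1 + t by rewrite addr_gt0.
have d := is_derive_addl 1 t.
apply: is_derive_eq (is_derive1_comp (g := fun u : R => 1 + u) (is_derive1_ln t1) d) _.
by rewrite ?mulr1.
Qed.

Lemma rint_gmaj x : 0 < x -> rint `]0, +oo[ (gmaj x).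
Proof.
move=> x0; apply: (@rint_prim _ _ _ _ (fun t => x^-1 * expR (x * (ln t - ln (1 + t)))) _ x^-1
  exh_0y) => t /=; rewrite in_itv /= andbT => t0.
- have d := is_deriveB (is_derive1_ln t0) (is_derive_ln1D t0).
  have d1 := is_deriveZ x d.
  have d2 := is_derive1_comp (g := fun t => x * (ln t - ln (1 + t))) (is_derive_expR _) d1.
  apply: is_derive_eq (is_deriveZ x^-1 d2) _.
  have t1 : 0 < 1 + t by rewrite addr_gt0.
  rewrite /GRing.scale /= /gmaj !powRE //.
  rewrite (_ : (x - 1) * ln t = x * ln t - ln t); last ring.
  rewrite (_ : (- x - 1) * ln (1 + t) = - (x * ln (1 + t)) - ln (1 + t)); last ring.
  rewrite !expRD !expRN !lnK ?posrE // mulrBr expRD expRN.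
  by field; rewrite ?gt_eqF ?expR_gt0.
- apply: cvgM; first exact: cont_powR.
  have t1 : 0 < 1 + t by rewrite addr_gt0.
  exact: is_derive_cont (is_derive1_comp (g := fun u : R => 1 + u)
    (is_derive1_powR (- x - 1) t1) (is_derive_addl 1 t)).
- exact: gmaj_ge0.
- have xV : 0 <= x^-1 by rewrite invr_ge0 ltW.
  rewrite normrM (ger0_norm xV) ler_piMr //.
  rewrite ger0_norm ?expR_ge0 // -expR0 ler_expR pmulr_rle0 // subr_le0.
  by rewrite ler_ln ?posrE ?addr_gt0 // lerDr.
Qed.

(** This is ln y <= y - 1 at y = (1 + t) d / p, multiplied by p; the constant collects the terms
    free of t. *)
Lemma exp_maj (d p : R) : 0 < d -> 0 < p ->
  exists2 C : R, 0 < C & forall t, 0 < t -> expR (- (d * t)) <= C * (1 + t) `^ (- p).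
Proof.
move=> d0 p0; exists (expR (d - p - p * ln (d / p))); first exact: expR_gt0.
move=> t t0; have t1 : 0 < 1 + t by rewrite addr_gt0.
rewrite powRE // -expRD ler_expR.
have dp : 0 < d / p by rewrite divr_gt0.
have : ln (1 + ((1 + t) * (d / p) - 1)) <= (1 + t) * (d / p) - 1.
  by apply: le_ln1Dx; rewrite ltrBrDr addNr mulr_gt0.
rewrite addrC subrK lnM ?posrE // -(ler_pM2l p0).
rewrite (_ : p * ((1 + t) * (d / p) - 1) = (1 + t) * d - p); last by field; rewrite gt_eqF.
by rewrite mulrDr; lra.
Qed.

(** The same majorant [gmaj] dominates the Gamma integrands here and the rescaled Beta integrands in
    [beta_limit]. *)
Lemma egmaj (d x : R) : 0 < d -> 0 < x ->
  exists2 C : R, 0 < C & forall t, 0 < t -> t `^ (x - 1) * expR (- (d * t)) <= C * gmaj x t.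
Proof.
move=> d0 x0; have [|C C0 hC] := @exp_maj d (x + 1) d0; first by rewrite addr_gt0.
exists C => // t t0; rewrite /gmaj mulrCA ler_wpM2l ?powR_ge0 //.
by apply: le_trans (hC t t0) _; rewrite opprD.
Qed.

Lemma powR_exp_to0 (d x : R) : 0 < d -> 0 < x ->
  t `^ x * expR (- (d * t)) @[t --> +oo] --> 0.
Proof.
move=> d0 x0; have [|C C0 hC] := @exp_maj d (x + 1) d0; first by rewrite addr_gt0.
apply: (@squeeze_cvgr _ _ _ _ (fun=> 0) (fun t => C * t^-1)); last 2 first.
- exact: cvg_cst.
- by rewrite -(mulr0 C); apply: cvgM; [exact: cvg_cst|exact: inv_pinfty].
near=> t; have t0 : 0 < t by near: t; exact: nbhs_pinfty_gt.
have t1 : 0 < 1 + t by rewrite addr_gt0.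
rewrite mulr_ge0 ?powR_ge0 ?expR_ge0 //=.
apply: le_trans (ler_wpM2l (powR_ge0 _ _) (hC t t0)) _.
rewrite mulrCA ler_wpM2l ?(ltW C0) // opprD powRD ?(gt_eqF t1) ?implybT //.
rewrite powR_inv1 ?(ltW t1) // powRN mulrA -[t^-1]mul1r; apply: ler_pM.
- by rewrite divr_ge0 ?powR_ge0.
- by rewrite invr_ge0 ltW.
- rewrite ler_pdivrMr ?powR_gt0 // mul1r.
  by apply: ge0_ler_powR; rewrite ?nnegrE; lra.
- by rewrite lef_pV2 ?posrE // lerDr.
Unshelve. all: end_near. Qed.

Lemma powR_bnd (L u p : R) : 0 < u -> `|ln u| <= L ->
  expR (- (`|p| * L)) <= u `^ p <= expR (`|p| * L).
Proof.
move=> u0 uL; rewrite powRE // !ler_expR -ler_norml normrM.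
by rewrite ler_wpM2l.
Qed.

Lemma ln_half_bnd u : 1 / 2 <= u <= 1 -> `|ln u| <= ln 2.
Proof.
move=> /andP[u1 u2]; have u0 : 0 < u by apply: lt_le_trans u1; rewrite divr_gt0.
rewrite ler0_norm; last by rewrite ln_le0 // u2 ltW.
rewrite -lnV ?posrE // ler_ln ?posrE ?invr_gt0 //.
by rewrite -[leRHS]invrK lef_pV2 ?posrE ?invr_gt0 //; lra.
Qed.

Lemma rint_powR01 x : 0 < x -> rint `]0, 1[ (fun t => t `^ (x - 1)).
Proof.
move=> x0; have mD : mbl `]0, 1[ by [].
apply: (@rint_le _ _ _ (fun t => 2 `^ (x + 1) * gmaj x t)) => //.
- by apply: meas_cont => // t /=; rewrite in_itv /= => /andP[t0 _]; exact: cont_powR.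
- move=> t /=; rewrite in_itv /= => /andP[t0 t1].
  rewrite ger0_norm ?powR_ge0 // /gmaj mulrCA -[leLHS]mulr1 ler_wpM2l ?powR_ge0 //.
  have t2 : 0 < 1 + t by rewrite addr_gt0.
  rewrite -opprD powRN ler_pdivlMr ?powR_gt0 // mul1r.
  rewrite ge0_ler_powR ?nnegrE ?ltW ?addr_gt0 //; lra.
- apply: rintZ => //; apply: rint_sub (rint_gmaj x0) => //.
  by move=> t /=; rewrite !in_itv /= andbT => /andP[].
Qed.

Lemma cont_powR1B p t : t < 1 -> {for t, continuous (fun u : R => (1 - u) `^ p)}.
Proof.
move=> t1; have t2 : 0 < 1 - t by rewrite subr_gt0.
exact: is_derive_cont (is_derive1_comp (g := fun u : R => 1 - u)
  (is_derive1_powR p t2) (is_derive_subl 1 t)).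
Qed.

Lemma rint_powR1B y : 0 < y -> rint `]0, 1[ (fun t => (1 - t) `^ (y - 1)).
Proof.
move=> y0.
apply: (@rint_prim _ _ _ _ (fun t => - y^-1 * (1 - t) `^ y) _ y^-1 (exh_oo ltr01)) => t /=;
  rewrite in_itv /= => /andP[t0 t1].
- have t2 : 0 < 1 - t by rewrite subr_gt0.
  have d := is_derive1_comp (g := fun u => 1 - u) (is_derive1_powR y t2) (is_derive_subl 1 t).
  apply: is_derive_eq (is_deriveZ (- y^-1) d) _.
  by rewrite /GRing.scale /=; field; rewrite gt_eqF.
- exact: cont_powR1B.
- exact: powR_ge0.
- have yV : 0 <= y^-1 by rewrite invr_ge0 ltW.
  rewrite normrM normrN (ger0_norm yV) ger0_norm ?powR_ge0 // ler_piMr //.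
  rewrite -[X in _ <= X](_ : (1 : R) `^ y = 1); last by rewrite powRE ?ln1 ?mulr0 ?expR0.
  by apply: ge0_ler_powR; rewrite ?nnegrE; lra.
Qed.

Lemma rint_beta x y : 0 < x -> 0 < y ->
  rint `]0, 1[ (fun t => t `^ (x - 1) * (1 - t) `^ (y - 1)).
Proof.
move=> x0 y0; have mD : mbl `]0, 1[ by [].
(* On each half of (0, 1) one of the two bases lies in [1/2, 1]; [C1] and [C2] bound the
   corresponding power there, whatever the sign of its exponent. *)
pose C1 := expR (`|y - 1| * ln 2); pose C2 := expR (`|x - 1| * ln 2).
apply: (@rint_le _ _ _ (fun t => C1 * t `^ (x - 1) + C2 * (1 - t) `^ (y - 1))) => //.
- apply: meas_cont => // t /=; rewrite in_itv /= => /andP[t0 t1].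
  by apply: cvgM; [exact: cont_powR|exact: cont_powR1B].
- move=> t /=; rewrite in_itv /= => /andP[t0 t1]; have t2 : 0 < 1 - t by rewrite subr_gt0.
  rewrite ger0_norm ?mulr_ge0 ?powR_ge0 //.
  have c1 : 0 <= C1 * t `^ (x - 1) by rewrite mulr_ge0 ?powR_ge0 ?expR_ge0.
  have c2 : 0 <= C2 * (1 - t) `^ (y - 1) by rewrite mulr_ge0 ?powR_ge0 ?expR_ge0.
  have [th|th] := leP t (1 / 2).
  + apply: ler_wpDr => //; rewrite mulrC ler_wpM2r ?powR_ge0 //.
    have b1 : 1 / 2 <= 1 - t <= 1 by lra.
    by case/andP: (powR_bnd (y - 1) t2 (ln_half_bnd b1)).
  + apply: ler_wpDl => //; rewrite ler_wpM2r ?powR_ge0 //.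
    have b1 : 1 / 2 <= t <= 1 by lra.
    by case/andP: (powR_bnd (x - 1) t0 (ln_half_bnd b1)).
- by apply: rintD => //; apply: rintZ => //; [exact: rint_powR01|exact: rint_powR1B].
Qed.

(** Concavity of ln: the tangent at 1 + rx bounds ln(1 + x) and ln 1 from above, and the linear
    parts cancel under the weights r and 1 - r. It yields the monotonicity of N ln(1 + u/N) in N. *)
Lemma bernoulli_powR (r x : R) : 0 <= r <= 1 -> 0 <= x -> r * ln (1 + x) <= ln (1 + r * x).
Proof.
move=> /andP[r0 r1] x0; have rx : 0 <= r * x by rewrite mulr_ge0.
have p1 : 0 < 1 + x by rewrite ltr_wpDr.
have p2 : 0 < 1 + r * x by rewrite ltr_wpDr.
have h1 : ln (1 + x) - ln (1 + r * x) <= (1 - r) * x / (1 + r * x).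
  rewrite -ln_div ?posrE //.
  rewrite (_ : (1 + x) / (1 + r * x) = 1 + (1 - r) * x / (1 + r * x)); last first.
    by field; rewrite gt_eqF.
  apply: le_ln1Dx; apply: (@lt_le_trans _ _ 0); first by rewrite oppr_lt0.
  by apply: divr_ge0; [apply: mulr_ge0; rewrite ?subr_ge0|exact: ltW].
have h2 : - ln (1 + r * x) <= - (r * x) / (1 + r * x).
  rewrite -lnV ?posrE //.
  have e : (1 + r * x)^-1 = 1 + - (r * x) / (1 + r * x) by field; rewrite gt_eqF.
  rewrite [X in ln X]e; apply: le_ln1Dx; rewrite ltr_pdivlMr //; lra.
have := ler_wpM2l r0 h1; have := @ler_wpM2l _ (1 - r) _ _ _ h2; rewrite subr_ge0 => /(_ r1).
have -> : (1 - r) * (- (r * x) / (1 + r * x)) = - (r * ((1 - r) * x / (1 + r * x))).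
  by field; rewrite gt_eqF.
set k := r * (_ / _); nra.
Qed.

End RealPowers.

(** * Euler's Gamma and Beta integrals and their recurrences *)

Section GammaFunction.
Context {R : realType}.
Local Notation mu := (@lebesgue_measure R).
Local Notation mbl D := (@measurable _ (measurableTypeR R) D).
Implicit Types (t u x y : R) (z w a b : R[i]) (D : set R).

Lemma cdct D (f_ : nat -> R -> R[i]) (f : R -> R[i]) (g : R -> R) : mbl D ->
  (forall n, cmeas D (f_ n)) -> cmeas D f ->
  (forall t, D t -> cto \oo (fun n => f_ n t) (f t)) -> rint D g ->
  (forall n t, D t -> normc (f_ n t) <= g t) ->
  cto \oo (fun n => cintegral D (f_ n)) (cintegral D f).
Proof.
move=> mD mf_ mf ff gi fg.
have key (h_ : nat -> R -> R) (h : R -> R) : (forall n, measurable_fun D (h_ n)) ->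
    measurable_fun D h -> (forall t, D t -> h_ n t @[n --> \oo] --> h t) ->
    (forall n t, D t -> `|h_ n t| <= g t) ->
    \int[mu]_(t in D) h_ n t @[n --> \oo] --> \int[mu]_(t in D) h t.
  move=> mh_ mh hh hg.
  have [|||||ih _ H] := @dominated_convergence _ (measurableTypeR R) R mu D mD
    (fun n => EFin \o h_ n) (EFin \o h) (EFin \o g).
  - by move=> n; apply/measurable_EFinP; exact: mh_.
  - by apply/measurable_EFinP; exact: mh.
  - by apply: aeW => t Dt /=; apply: cvg_EFin; [near=> n|exact: hh].
  - exact: gi.
  - by apply: aeW => t n Dt /=; rewrite lee_fin; exact: hg.
  - by apply: fine_cvg; rewrite fineK ?integrable_fin_num.
split; rewrite ?cint_re ?cint_im.
- apply: key => [n||t /ff[]//|n t Dt]; [by case: (mf_ n)|by case: mf|].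
  exact: le_trans (Re_le_normc _) (fg n t Dt).
- apply: key => [n||t /ff[]//|n t Dt]; [by case: (mf_ n)|by case: mf|].
  exact: le_trans (Im_le_normc _) (fg n t Dt).
Unshelve. all: end_near. Qed.

Lemma cto_shift m (f : nat -> R[i]) l : cto \oo (fun n => f (n + m)%N) l -> cto \oo f l.
Proof.
by move=> [h1 h2]; split; [move: h1|move: h2];
  rewrite -(cvg_shiftn m (fun n => _ (f n))).
Qed.

Lemma cto_shiftV m (f : nat -> R[i]) l : cto \oo f l -> cto \oo (fun n => f (n + m)%N) l.
Proof.
by move=> [h1 h2]; split; [move: h1|move: h2];
  rewrite -(cvg_shiftn m (fun n => _ (f n))).
Qed.

Lemma cto_at_right t (f : R -> R[i]) l : cto (nbhs t) f l -> cto t^'+ f l.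
Proof. by move=> [? ?]; split; exact: cvg_at_right_filter. Qed.

Lemma cto_at_left t (f : R -> R[i]) l : cto (nbhs t) f l -> cto t^'- f l.
Proof. by move=> [? ?]; split; exact: cvg_at_left_filter. Qed.

Lemma onem_at_left : 1 - t @[t --> (1 : R)^'-] --> (0 : R)^'+.
Proof.
move=> P [e e0 he]; exists e => // t /= te t1.
by apply: he => /=; rewrite ?sub0r ?normrN ?subr_gt0.
Qed.

Lemma in0y t : `]0, +oo[%classic t -> 0 < t.
Proof. by rewrite /= in_itv /= andbT. Qed.

Lemma mbl_0y : mbl `]0, +oo[. Proof. by []. Qed.
Lemma mbl_01 : mbl `]0, 1[. Proof. by []. Qed.
Hint Resolve mbl_0y mbl_01 : core.

(** The parameter [w] serves two purposes: w = 1 gives Euler's integral for Gamma, and w = 1 + ir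
    the model oscillatory integral. *)
Definition egam z w t : R[i] := cpow t (z - 1) * cexp (- (w * t%:C)).
Definition laplace z w : R[i] := cintegral `]0, +oo[ (egam z w).

Lemma normc_egam z w t : 0 < t ->
  normc (egam z w t) = t `^ (Re z - 1) * expR (- (Re w * t)).
Proof.
move=> t0; rewrite /egam normcM normc_cpow // normc_cexp !ReImE /=.
by rewrite mulr0 subr0.
Qed.

Lemma isd_cexpN w t : isd (fun u => cexp (- (w * u%:C))) t (- w * cexp (- (w * t%:C))).
Proof. by apply: isd_cexp; apply: isdN; exact: isd_lin. Qed.

Lemma Ck_cexpN n D w : Ck n D (fun u => cexp (- (w * u%:C))).
Proof.
rewrite (_ : (fun u => _) = fun u => cexp (- w * u%:C + 0)); first exact: Ck_cexp_lin.
by apply/funext => u; rewrite addr0 mulNr.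
Qed.

Lemma Ck_egam n z w : Ck n `]0, +oo[ (egam z w).
Proof.
apply: CkM; last exact: Ck_cexpN.
by apply: Ck_cpow => t /=; rewrite in_itv /= andbT.
Qed.

Lemma egam_int z w : 0 < Re z -> 0 < Re w -> cintegrable `]0, +oo[ (egam z w).
Proof.
move=> z0 w0; have [C C0 hC] := egmaj w0 z0.
apply: (@cintegrable_le _ _ _ (fun t => C * gmaj (Re z) t)) => //.
- by apply: cmeas_Ck => //; exact: Ck_egam 0%N z w.
- by move=> t /in0y t0; rewrite normc_egam // hC.
- by apply: rintZ => //; exact: rint_gmaj.
Qed.

(** The difference of the two sides integrates the derivative of t^z e^(-wt), which vanishes at 0
    and at infinity. *)
Lemma laplace_rec z w : 0 < Re z -> 0 < Re w ->
  w * laplace (z + 1) w = z * laplace z w.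
Proof.
move=> z0 w0; have z1 : 0 < Re (z + 1) by rewrite ReD addr_gt0.
have i1 := cintegrableZ z mbl_0y (egam_int z0 w0).
have i2 := cintegrableZ w mbl_0y (egam_int z1 w0).
apply/eqP; rewrite eq_sym -subr_eq0 /laplace -!cintZ //; try exact: egam_int.
rewrite -cintB //; apply/eqP; rewrite -[RHS](subrr 0).
have nF t : 0 < t -> normc (cpow t z * cexp (- (w * t%:C))) = t `^ Re z * expR (- (Re w * t)).
  move=> t0; have := @normc_egam (z + 1) w t t0.
  by rewrite /egam addrK ReD /= addrK.
apply: (@cftc_0y _ (fun t => cpow t z * cexp (- (w * t%:C)))).
- move=> t t0; apply: isd_eq (isdM (isd_cpow z t0) (isd_cexpN w t)) _.
  by rewrite /egam addrK; ring.
- by apply: CkB; apply: CkZ; exact: Ck_egam.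
- exact: cintegrableB.
- apply: (@cto0_le _ _ _ _ _ (fun t => t `^ Re z)); last exact: powR_cvg0.
  near=> t; have t0 : 0 < t by near: t; exact: nbhs_right_gt.
  rewrite nF // ler_piMr ?powR_ge0 // -expR0 ler_expR oppr_le0 mulr_ge0 ?ltW //.
- apply: (@cto0_le _ _ _ _ _ (fun t => t `^ Re z * expR (- (Re w * t)))).
    by near=> t; rewrite nF //; near: t; exact: nbhs_pinfty_gt.
  exact: powR_exp_to0.
Unshelve. all: end_near. Qed.

Lemma GammaE z : 0 < Re z -> Gamma z = laplace z 1.
Proof.
move=> z0; rewrite /Gamma /Gamma_shift z0 big_ord0 divr1 addr0.
by apply: cint_ext => t _; rewrite /egam mul1r -(cexp_real (- t)) realCN.
Qed.

Lemma Gamma_rec z : 0 < Re z -> Gamma (z + 1) = z * Gamma z.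
Proof.
move=> z0; rewrite !GammaE ?ReD ?addr_gt0 // -laplace_rec ?mul1r //.
Qed.

Lemma Gamma1 : Gamma (1 : R[i]) = 1.
Proof.
rewrite GammaE //; transitivity (0 - (- 1) : R[i]); last by rewrite opprK add0r.
have dF t : isd (fun u => - cexp (- ((1 : R[i]) * u%:C))) t (cexp (- (1 * t%:C))).
  by apply: isd_eq (isdN (isd_cexpN 1 t)) _; rewrite mulN1r opprK.
rewrite /laplace; apply: (@cftc_0y _ (fun u => - cexp (- ((1 : R[i]) * u%:C)))).
- move=> t t0; apply: isd_eq (dF t) _.
  by rewrite /egam subrr cpow0 [RHS]mul1r.
- exact: Ck_egam.
- exact: egam_int.
- have := isd_cto (dF 0) => /cto_at_right.
  by rewrite mulr0 oppr0 cexp0.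
- rewrite -oppr0; apply: ctoN; apply: (@cto0_le _ _ _ _ _ (fun t => expR (- t))).
    by near=> t; rewrite mul1r -realCN (cexp_real (- t)) normc_real ger0_norm ?expR_ge0.
  exact: cvgr_expR.
Unshelve. all: end_near. Qed.

Definition betaf b a t : R[i] := cpow t (b - 1) * cpow (1 - t) (a - 1).
Definition betaC b a : R[i] := cintegral `]0, 1[ (betaf b a).

Lemma in01 t : `]0, 1[%classic t -> 0 < t /\ 0 < 1 - t.
Proof. by rewrite /= in_itv /= subr_gt0 => /andP[]. Qed.

Lemma Ck_betaf n b a : Ck n `]0, 1[ (betaf b a).
Proof.
apply: CkM; first by apply: Ck_cpow => t /in01[].
by apply: Ck_cpowr => t /in01[]; rewrite subr_gt0.
Qed.

Lemma normc_betaf b a t : 0 < t -> 0 < 1 - t ->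
  normc (betaf b a t) = t `^ (Re b - 1) * (1 - t) `^ (Re a - 1).
Proof. by move=> t0 t1; rewrite /betaf normcM !normc_cpow // !ReImE. Qed.

Lemma betaf_int b a : 0 < Re b -> 0 < Re a -> cintegrable `]0, 1[ (betaf b a).
Proof.
move=> b0 a0.
apply: (@cintegrable_le _ _ _ (fun t => t `^ (Re b - 1) * (1 - t) `^ (Re a - 1))) => //.
- by apply: cmeas_Ck => //; exact: Ck_betaf 0%N b a.
- by move=> t /in01[t0 t1]; rewrite normc_betaf.
- exact: rint_beta.
Qed.

Lemma powR_le1 x p : 0 < x <= 1 -> 0 <= p -> x `^ p <= 1.
Proof.
move=> /andP[x0 x1] p0; rewrite powRE // -expR0 ler_expR.
by rewrite mulr_ge0_le0 // ln_le0 // x1 ltW.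
Qed.

(** The difference of the two sides integrates, up to sign, the derivative of t^b (1-t)^a, which
    vanishes at 0 and at 1. *)
Lemma beta_rec b a : 0 < Re b -> 0 < Re a ->
  (a + b) * betaC b (a + 1) = a * betaC b a.
Proof.
move=> b0 a0; have a1 : 0 < Re (a + 1) by rewrite ReD addr_gt0.
have i1 := cintegrableZ (a + b) mbl_01 (betaf_int b0 a1).
have i2 := cintegrableZ a mbl_01 (betaf_int b0 a0).
apply/eqP; rewrite -subr_eq0 /betaC -!cintZ //; try exact: betaf_int.
rewrite -cintB //; apply/eqP; rewrite -[RHS](subrr 0).
have nF t : 0 < t -> 0 < 1 - t ->
    normc (cpow t b * cpow (1 - t) a) = t `^ Re b * (1 - t) `^ Re a.
  by move=> t0 t1; rewrite normcM !normc_cpow.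
apply: (@cftc_oo _ 0 1 (fun t => cpow t b * cpow (1 - t) a)) => //.
- move=> t /andP[t0 t1]; apply: isd_eq (isdM (isd_cpow b t0) (isd_cpowr a t1)) _.
  have t2 : 0 < 1 - t by rewrite subr_gt0.
  rewrite /betaf addrK.
  have -> : cpow t b = t%:C * cpow t (b - 1) by rewrite -cpowS // subrK.
  have -> : cpow (1 - t) a = (1 - t)%:C * cpow (1 - t) (a - 1) by rewrite -cpowS // subrK.
  by rewrite realCB; ring.
- by apply: CkB; apply: CkZ; exact: Ck_betaf.
- exact: cintegrableB.
- apply: (@cto0_le _ _ _ _ _ (fun t => t `^ Re b)); last exact: powR_cvg0.
  near=> t; have t0 : 0 < t by near: t; exact: nbhs_right_gt.
  have t1 : t < 1 by near: t; exact: nbhs_right_lt.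
  have t2 : 0 < 1 - t by rewrite subr_gt0.
  by rewrite nF // ler_piMr ?powR_ge0 // powR_le1 ?ltW //; lra.
- apply: (@cto0_le _ _ _ _ _ (fun t => (1 - t) `^ Re a)); last first.
    exact: cvg_comp onem_at_left (powR_cvg0 a0).
  near=> t; have t0 : 0 < t by near: t; exact: nbhs_left_gt.
  have t1 : t < 1 by near: t; exact: nbhs_left_lt.
  have t2 : 0 < 1 - t by rewrite subr_gt0.
  by rewrite nF // ler_piMl ?powR_ge0 // powR_le1 ?ltW //; lra.
Unshelve. all: end_near. Qed.

Lemma beta_b1 b : 0 < Re b -> betaC b 1 = b^-1.
Proof.
move=> b0; have bn0 : b != 0 by apply: contraTneq b0 => ->; rewrite ltxx.
have dF t : 0 < t -> isd (fun u => b^-1 * cpow u b) t (cpow t (b - 1)).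
  by move=> t0; apply: isd_eq (isdZ b^-1 (isd_cpow b t0)) _; rewrite mulKf.
rewrite -[RHS]subr0 /betaC; apply: (@cftc_oo _ 0 1 (fun u => b^-1 * cpow u b)) => //.
- by move=> t /andP[t0 _]; apply: isd_eq (dF t t0) _; rewrite /betaf subrr cpow0 mulr1.
- exact: Ck_betaf.
- exact: betaf_int.
- apply: (@cto0_bnd _ _ _ _ _ _ (normc b^-1)); first by near=> t.
  apply: (@cto0_le _ _ _ _ _ (fun t => t `^ Re b)); last exact: powR_cvg0.
  near=> t; rewrite normc_cpow //; near: t; exact: nbhs_right_gt.
- by have := isd_cto (dF 1 ltr01) => /cto_at_left; rewrite cpow1l mulr1.
Unshelve. all: end_near. Qed.

(** Substitution t = u/(n + u), with inverse nt/(1 - t). In this form a Beta integral with [a]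
    shifted by n visibly approaches Euler's integral, as (1 + u/n)^(-n) tends to e^(-u). *)
Lemma beta_scaled b a (n : R) : 0 < n -> 0 < Re b -> 0 < Re a ->
  cpow n b * betaC b a =
  cintegral `]0, +oo[ (fun u => cpow u (b - 1) * cpow (1 + u / n) (- (a + b))).
Proof.
move=> n0 b0 a0.
have sub : forall t, `]0 : R, +oo[%classic t -> 0 < t by move=> t /=; rewrite in_itv /= andbT.
pose F u := u / (n + u); pose F' u := n / (n + u) ^+ 2.
have dF u : 0 < u -> is_derive u 1 F (F' u).
  move=> u0; have nu : 0 < n + u by rewrite addr_gt0.
  have d1 := is_deriveV (f := fun u : R => n + u) (lt0r_neq0 nu) (is_derive_addl n u).
  apply: is_derive_eq (is_deriveM (is_derive_id u 1) d1) _.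
  by rewrite /GRing.scale /= /F'; field; rewrite gt_eqF.
have eE : exh `]0, 1[ (fun k => F k.+2%:R^-1) (fun k => F k.+2%:R).
  apply: (@exh_image _ _ _ _ _ F (fun t => n * t / (1 - t)) (@exh_0y R)).
  - move=> s u /sub s0 /sub u0 su; rewrite /F ltr_pdivrMr ?addr_gt0 //.
    rewrite mulrAC ltr_pdivlMr ?addr_gt0 // !mulrDr [u * s]mulrC ltrD2r.
    by rewrite ltr_pM2r.
  - move=> s /sub s0; rewrite /= in_itv /= /F divr_gt0 ?addr_gt0 //=.
    by rewrite ltr_pdivrMr ?addr_gt0 // mul1r ltrDr.
  - move=> t /in01[t0 t1]; split.
      by rewrite /= in_itv /= andbT divr_gt0 ?mulr_gt0.
    by rewrite /F; field; rewrite !gt_eqF //= (_ : _ + _ = n) //; ring.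
  - move=> u v t; rewrite /= !in_itv /= => /andP[u0 _] /andP[_ v1] /andP[ut tv].
    by rewrite (lt_le_trans u0 ut) (le_lt_trans tv v1).
have [||||||gi e] := @cint_subst _ _ _ _ _ F F' (betaf b a) _ _ (@exh_0y R) eE
  _ _ _ _ (Ck_betaf 0 b a) (betaf_int b0 a0).
- exact: interval_open.
- exact: interval_open.
- by move=> t /sub; exact: dF.
- move=> t /sub t0; have nu : 0 < n + t by rewrite addr_gt0.
  apply: cvgM; first exact: cvg_cst.
  apply: cvgV; first by rewrite expf_neq0 // gt_eqF.
  by apply: (@cvgM _ _ _ _ (fun u => n + u) (fun u => n + u)); apply: cvgD;
    [exact: cvg_cst|exact: cvg_id|exact: cvg_cst|exact: cvg_id].
- by move=> t /sub t0; rewrite /F' divr_gt0 // exprn_gt0 // addr_gt0.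
- move=> s /sub s0; rewrite /= in_itv /= /F divr_gt0 ?addr_gt0 //=.
  by rewrite ltr_pdivrMr ?addr_gt0 // mul1r ltrDr.
rewrite /betaC -e -cintZ //.
apply: cint_ext => u /sub u0; have nu : 0 < n + u by rewrite addr_gt0.
rewrite /betaf /F /F' (_ : 1 - u / (n + u) = n / (n + u)); last by field; rewrite gt_eqF.
rewrite (_ : 1 + u / n = (n + u) / n); last by field; rewrite gt_eqF.
rewrite !cpow_div // !cpowD !cpowN !cpowD !cpow1 //.
rewrite realCM realCV realCX.
have c1 := cpow_neq0 n b; have c2 := cpow_neq0 n a.
have c3 := cpow_neq0 (n + u) b; have c4 := cpow_neq0 (n + u) a.
have c5 : n%:C != 0 :> R[i] by rewrite realC_eq0 gt_eqF.
have c6 : (n + u)%:C != 0 :> R[i] by rewrite realC_eq0 gt_eqF.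
have c7 : u%:C != 0 :> R[i] by rewrite realC_eq0 gt_eqF.
rewrite realCD in c6 *; field; rewrite ?c1 ?c2 ?c3 ?c4 ?c5 ?c6 ?c7 //.
Qed.

End GammaFunction.

(** * Gauss's product, nonvanishing of Gamma, the Beta formula and Gamma(1/2) *)

Section GaussProduct.
Context {R : realType}.
Local Notation mu := (@lebesgue_measure R).
Local Notation mbl D := (@measurable _ (measurableTypeR R) D).
Implicit Types (t u x y : R) (z w a b : R[i]) (D : set R).

Lemma inv_natD (c : R) m : c / (n + m.+1)%:R @[n --> \oo] --> 0.
Proof.
rewrite -(mulr0 c); apply: cvgM; first exact: cvg_cst.
under eq_fun do rewrite addnS.
by have := @cvg_harmonic R; rewrite -(cvg_shiftn m).
Qed.

Lemma ln1D_lower y : 0 <= y -> y / (1 + y) <= ln (1 + y).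
Proof.
move=> y0; have y1 : 0 < 1 + y by rewrite ltr_wpDr.
rewrite -lerN2 -lnV ?posrE //.
have e : (1 + y)^-1 = 1 + - (y / (1 + y)) by field; rewrite gt_eqF.
rewrite [X in ln X]e; apply: le_ln1Dx.
by rewrite ltrN2 ltr_pdivrMr // mul1r ltrDr.
Qed.

(** Squeeze by y/(1+y) <= ln(1+y) <= y at y = u/N. The offset m + 1 keeps N positive from the
    start. *)
Lemma cvg_nat_ln u m : 0 < u ->
  (n + m.+1)%:R * ln (1 + u / (n + m.+1)%:R) @[n --> \oo] --> u.
Proof.
move=> u0.
apply: (@squeeze_cvgr _ _ _ _ (fun n => u - u ^+ 2 / (n + m.+1)%:R) (fun=> u)); last 2 first.
- by rewrite -[X in _ --> X]subr0; apply: cvgB; [exact: cvg_cst|exact: inv_natD].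
- exact: cvg_cst.
near=> n; set N := _%:R; have N0 : 0 < N by rewrite ltr0n addnS.
have y0 : 0 < u / N by rewrite divr_gt0.
apply/andP; split.
  apply: le_trans (ler_wpM2l (ltW N0) (ln1D_lower (ltW y0))).
  rewrite (_ : N * (u / N / (1 + u / N)) = u - u ^+ 2 / (N + u)); last first.
    by clearbody N; field; rewrite ?(gt_eqF N0) ?(gt_eqF (addr_gt0 N0 u0)) ?(gt_eqF (addr_gt0 u0 N0)).
  rewrite lerD2l lerN2 ler_pM2l ?exprn_gt0 // lef_pV2 ?posrE ?addr_gt0 //.
  by rewrite lerDl ltW.
have : ln (1 + u / N) <= u / N by apply: le_ln1Dx; apply: lt_trans y0; rewrite ltrN10.
by move=> /(ler_wpM2l (ltW N0)); rewrite mulrCA divff ?gt_eqF // mulr1.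
Unshelve. all: end_near. Qed.

Lemma cvg_ln_nat u m : 0 < u -> ln (1 + u / (n + m.+1)%:R) @[n --> \oo] --> 0.
Proof.
move=> u0.
apply: (@squeeze_cvgr _ _ _ _ (fun=> 0) (fun n => u / (n + m.+1)%:R)); last 2 first.
- exact: cvg_cst.
- exact: inv_natD.
near=> n; set N := _%:R; have N0 : 0 < N by rewrite ltr0n addnS.
have y0 : 0 < u / N by rewrite divr_gt0.
apply/andP; split; first by rewrite ln_ge0 // lerDl ltW.
by apply: le_ln1Dx; apply: lt_trans y0; rewrite ltrN10.
Unshelve. all: end_near. Qed.

(** Dominated convergence in [beta_scaled]: (1 + u/n)^(-(a+n+b)) tends to e^(-u) pointwise. *)
Lemma beta_limit b a : 0 < Re b -> 0 < Re a ->
  cto \oo (fun n => cpow n%:R b * betaC b (a + n%:R)) (Gamma b).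
Proof.
(* The majorant needs the decay (1 + u)^(-(Re b + 1)), so the sequence is started at an index [M]
   beyond Re b + 1. *)
move=> b0 a0; pose m := Num.truncn (Re b + 1).
have m1 : Re b + 1 < m.+1%:R by exact: truncnS_gt.
pose N n : R := (n + m.+1)%:R.
have N0 n : 0 < N n by rewrite /N ltr0n addnS.
pose M : R := m.+1%:R; have M0 : 0 < M by rewrite ltr0n.
pose f_ n u := cpow u (b - 1) * cpow (1 + u / N n) (- (a + (n + m.+1)%:R + b)).
apply: (@cto_shift _ m.+1).
have aN n : 0 < Re (a + (n + m.+1)%:R) by rewrite ReD Re_nat addr_gt0.
have eq n : cintegral `]0, +oo[ (f_ n) =
    cpow (n + m.+1)%:R b * betaC b (a + (n + m.+1)%:R).
  by rewrite beta_scaled.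
apply: cto_ext eq _; rewrite GammaE //.
have mf n : cmeas `]0, +oo[ (f_ n).
  apply: cmeas_Ck => // t /in0y t0; apply: ctoM.
    exact: isd_cto (isd_cpow (b - 1) t0).
  have p : 0 < 1 + t / N n by rewrite addr_gt0 // divr_gt0.
  apply: (@cto_comp _ _ _ (nbhs t) (nbhs (1 + t / N n)) (fun u => 1 + u / N n)
    (fun v => cpow v _)); last exact: isd_cto (isd_cpow _ p).
  apply: cvgD; first exact: cvg_cst.
  by apply: cvgM; [exact: cvg_id|exact: cvg_cst].
apply: (@cdct _ _ _ _ (fun t => expR (M * ln M) * gmaj (Re b) t)) => //.
- by apply: cmeas_Ck => //; exact: Ck_egam.
- move=> u /in0y u0; apply: ctoM; first exact: cto_cst.
  rewrite /cpow; apply: cto_cexp.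
  have : cto \oo (fun n => - ((a + b) * (ln (1 + u / N n))%:C +
      (N n * ln (1 + u / N n))%:C)) (- ((a + b) * 0%:C + u%:C)).
    apply: ctoN; apply: ctoD; last by apply: cto_real; exact: cvg_nat_ln.
    by apply: ctoM; [exact: cto_cst|apply: cto_real; exact: cvg_ln_nat].
  rewrite mulr0 add0r mul1r; apply: cto_ext => n.
  by rewrite natC realCM -/(N n); ring.
- by apply: rintZ => //; exact: rint_gmaj.
- move=> n u /in0y u0; have u1 : 0 < 1 + u by rewrite addr_gt0.
  have p : 0 < 1 + u / N n by rewrite addr_gt0 // divr_gt0.
  have lp : 0 <= ln (1 + u / N n) by rewrite ln_ge0 // lerDl divr_ge0 // ltW.
  rewrite /f_ normcM !normc_cpow // !ReImE /gmaj mulrCA ler_wpM2l ?powR_ge0 //.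
  rewrite !powRE // -expRD ler_expR.
  (* Bernoulli's inequality with ratio M / N n and x = u / M: the exponential approximants increase
     with the index. *)
  have h1 : M * ln (1 + u / M) <= N n * ln (1 + u / N n).
    have r01 : 0 <= M / N n <= 1.
      by rewrite divr_ge0 ?(ltW M0) ?(ltW (N0 n)) //= ler_pdivrMr // mul1r ler_nat leq_addl.
    have := bernoulli_powR r01 (ltW (divr_gt0 u0 M0)).
    have -> : M / N n * (u / M) = u / N n by field; rewrite !gt_eqF.
    by rewrite mulrAC ler_pdivrMr // [_ * N n]mulrC.
  (* As M >= 1, 1 + u/M is at least (1 + u)/M; this produces the constant e^(M ln M) of the
     majorant. *)
  have h2 : ln (1 + u) - ln M <= ln (1 + u / M).
    rewrite -ln_div ?posrE // ler_ln ?posrE ?divr_gt0 ?addr_gt0 ?divr_gt0 //.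
    by rewrite mulrDl lerD2r mul1r invf_le1 // ler1n.
  have h3 : 0 <= ln (1 + u) by rewrite ln_ge0 // lerDl ltW.
  have h4 : (Re b + 1) * ln (1 + u) <= M * ln (1 + u) by rewrite ler_wpM2r // ltW.
  have h5 := ler_wpM2l (ltW M0) h2.
  have h6 : 0 <= (Re a + Re b) * ln (1 + u / N n) by rewrite mulr_ge0 // addr_ge0 // ltW.
  move: h1 h3 h4 h5 h6; rewrite -/(N n); set L := ln (1 + u / N n); nra.
Qed.

(** Pochhammer's rising factorial (b)_n. *)
Definition Gprod b n : R[i] := \prod_(k < n) (b + k%:R).

Lemma GprodS b n : Gprod b n.+1 = Gprod b n * (b + n%:R).
Proof. by rewrite /Gprod big_ord_recr. Qed.

Lemma Re_gt0_neq0 z : 0 < Re z -> z != 0.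
Proof. by apply: contraTneq => ->; rewrite ltxx. Qed.

Lemma Gprod_neq0 b n : 0 < Re b -> Gprod b n != 0.
Proof.
move=> b0; apply/prodf_neq0 => k _; apply: Re_gt0_neq0.
by rewrite ReD Re_nat ltr_wpDr.
Qed.

Lemma beta_nat b n : 0 < Re b -> betaC b (1 + n%:R) * Gprod b n.+1 = n`!%:R.
Proof.
move=> b0; elim: n => [|n IH].
  by rewrite addr0 beta_b1 // GprodS /Gprod big_ord0 mul1r addr0 mulVf ?Re_gt0_neq0.
have p : 0 < Re (1 + n%:R : R[i]) by rewrite ReD Re_nat ltr_wpDr.
have := beta_rec b0 p; rewrite GprodS factS natrM -IH.
rewrite (_ : (1 + n%:R + 1 : R[i]) = 1 + n.+1%:R); last by rewrite -natr1; ring.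
rewrite (_ : (n.+1%:R : R[i]) = 1 + n%:R); last by rewrite -natr1 addrC.
set B := betaC b (1 + (1 + _)) => h.
transitivity ((1 + n%:R + b) * B * Gprod b n.+1); first by ring.
by rewrite h; ring.
Qed.

(** The approximants of Gauss's limit formula. By [beta_nat] they equal n^b B(b, n + 1), so their
    limit is the case a = 1 of [beta_limit]. *)
Definition gauss b n : R[i] := n`!%:R * cpow n%:R b / Gprod b n.+1.

Lemma gauss_lim b : 0 < Re b -> cto \oo (gauss b) (Gamma b).
Proof.
move=> b0; apply: cto_ext (@beta_limit b 1 b0 ltr01) => n.
by rewrite /gauss -(beta_nat n b0); field; exact: Gprod_neq0.
Qed.

Lemma normc_gauss b n : (0 < n)%N ->
  normc (gauss b n) = n`!%:R * n%:R `^ Re b / normc (Gprod b n.+1).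
Proof. by move=> n0; rewrite /gauss normcM normcV normcM normc_nat normc_cpow ?ltr0n. Qed.

(** With s = Re b + k and y = Im b, |s + iy| <= s (1 + y^2/s^2) <= s e^(y^2/s^2); these exponents
    are summable over k. *)
Lemma normc_add_nat b k : 0 < Re b ->
  normc (b + k%:R) <= (Re b + k%:R) * expR (Im b ^+ 2 / (Re b + k%:R) ^+ 2).
Proof.
move=> b0; set s := Re b + k%:R; have s0 : 0 < s by rewrite /s ltr_wpDr.
set w := _ / _; have w0 : 0 <= w by rewrite divr_ge0 ?sqr_ge0.
apply: (@le_trans _ _ (s * (1 + w))); last by rewrite ler_pM2l // expR_ge1Dx.
rewrite normc_sqrtE ReD ImD Re_nat Im_nat addr0 -/s.
have sw : 0 <= s * (1 + w) by rewrite mulr_ge0 ?(ltW s0) // addr_ge0.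
rewrite -[leRHS]ger0_norm // -sqrtr_sqr ler_wsqrtr //.
have -> : Im b ^+ 2 = s ^+ 2 * w by rewrite /w; field; rewrite gt_eqF.
rewrite exprMn -[X in X + _]mulr1 -mulrDr ler_wpM2l ?sqr_ge0 //.
by rewrite expr2 -[leLHS]mulr1 ler_pM ?addr_ge0 // lerDl.
Qed.

(** The sum of the 1/(x + k)^2 is controlled by telescoping 1/(p+1)^2 <= 1/p - 1/(p+1). The exponent
    stays bounded in n, which makes the comparison of the Gauss products survive the limit. *)
Lemma normc_Gprod_le b n : 0 < Re b ->
  normc (Gprod b n.+1) <= normc (Gprod (Re b)%:C n.+1) *
    expR (Im b ^+ 2 * ((Re b) ^- 2 + (Re b)^-1 - (Re b + n%:R)^-1)).
Proof.
move=> b0; set x := Re b; set y := Im b.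
have nk k : normc (x%:C + k%:R) = x + k%:R.
  by rewrite natC -realCD normc_real ger0_norm // addr_ge0 // ltW.
elim: n => [|n IH].
  rewrite !GprodS /Gprod !big_ord0 !mul1r nk; have := normc_add_nat 0 b0.
  by rewrite -/x -/y !addr0 addrK.
rewrite GprodS [Gprod x%:C _]GprodS !normcM nk.
apply: le_trans (ler_pM (normc_ge0 _) (normc_ge0 _) IH (normc_add_nat n.+1 b0)) _.
rewrite -/x -/y mulrACA -expRD ler_wpM2l ?mulr_ge0 ?normc_ge0 ?addr_ge0 ?(ltW b0) //.
rewrite ler_expR -mulrDr ler_wpM2l ?sqr_ge0 //.
set p := x + n%:R; have p0 : 0 < p by rewrite /p ltr_wpDr.
rewrite (_ : x + n.+1%:R = p + 1); last by rewrite /p -natr1 addrA.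
suff : (p + 1) ^- 2 <= p^-1 - (p + 1)^-1 by lra.
rewrite (_ : p^-1 - (p + 1)^-1 = (p * (p + 1))^-1); last first.
  have p1 : 0 < p + 1 by rewrite addr_gt0.
  by clearbody p; field; rewrite ?(gt_eqF p0) ?(gt_eqF p1).
have p1 : 0 < p + 1 by rewrite addr_gt0.
by rewrite lef_pV2 ?posrE ?exprn_gt0 ?(mulr_gt0 p0) // expr2 ler_pM2r // lerDl.
Qed.

(** The integrand is nonnegative, and on [1, 2] it is at least the constant [c], obtained from |ln
    t| <= ln 2 and e^(-t) >= e^(-2). *)
Lemma Gamma_real_gt0 x : 0 < x -> 0 < Re (Gamma x%:C).
Proof.
move=> x0; rewrite GammaE // /laplace cint_re.
have hi : rint `]0, +oo[ (fun t => Re (egam x%:C 1 t)) by case: (@egam_int _ x%:C 1 x0 ltr01).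
have he t : 0 < t -> Re (egam x%:C 1 t) = t `^ (x - 1) * expR (- t).
  move=> t0; rewrite /egam mul1r -(realCN t) (cexp_real (- t)).
  have -> : (x%:C - 1 : R[i]) = (x - 1)%:C by rewrite realCB.
  by rewrite cpow_real // -realCM.
have h0 t : `]0, +oo[%classic t -> 0 <= Re (egam x%:C 1 t).
  by move=> /in0y /he ->; rewrite mulr_ge0 ?powR_ge0 ?expR_ge0.
have s12 : `[1, 2]%classic `<=` (`]0, +oo[%classic : set R).
  by move=> t /=; rewrite !in_itv /= andbT => /andP[/(lt_le_trans ltr01)].
apply: lt_le_trans (Rintegral_subset mbl_0y (measurable_itv _) s12 hi h0).
pose c := expR (- (`|x - 1| * ln 2)) * expR (- 2) : R.
have ci : \int[mu]_(t in `[1, 2]) c = c.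
  transitivity (c * 2 - c * 1); last by ring.
  apply: (@ftc_cc _ (fun t => c * t) (fun=> c)).
  - by rewrite ltr1n.
  - move=> t _; apply: is_derive_eq (is_deriveZ c (is_derive_id t 1)) _.
    by rewrite /GRing.scale /= mulr1.
  - by move=> t _; exact: cvg_cst.
apply: (@lt_le_trans _ _ c); first by rewrite mulr_gt0 ?expR_gt0.
rewrite -[leLHS]ci; apply: le_Rintegral => //.
- by apply: rint_cc => t _; exact: cvg_cst.
- exact: rint_sub hi.
- have in12 t : `[1, 2]%classic t -> 1 <= t <= 2 by rewrite /= in_itv.
  move=> t /in12 /andP[t1 t2]; have t0 : 0 < t by apply: lt_le_trans t1.
  rewrite he // ler_pM ?expR_ge0 // ?ler_expR ?lerN2 //.
  have lb : `|ln t| <= ln 2 by rewrite ger0_norm ?ln_ge0 // ler_ln ?posrE.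
  by case/andP: (powR_bnd (x - 1) t0 lb).
Qed.

(* Compare the Gauss products at b and at Re b. *)
Lemma Gamma_neq0 b : 0 < Re b -> Gamma b != 0.
Proof.
move=> b0; set x := Re b; set M := Im b ^+ 2 * (x ^- 2 + x^-1).
have xb : 0 < Re x%:C by [].
rewrite -normc_gt0; apply: (@lt_le_trans _ _ (normc (Gamma x%:C) * expR (- M))).
  rewrite mulr_gt0 ?expR_gt0 // normc_gt0; apply: Re_gt0_neq0; exact: Gamma_real_gt0.
have l1 : normc (gauss b n) @[n --> \oo] --> normc (Gamma b) by exact: cto_normc (gauss_lim b0).
have l2 : normc (gauss x%:C n) * expR (- M) @[n --> \oo] --> normc (Gamma x%:C) * expR (- M).
  by apply: cvgM; [exact: cto_normc (gauss_lim xb)|exact: cvg_cst].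
apply: (ler_cvg_to l2 l1); exists 1%N => // n /= n1.
have n0 : 0 < n%:R :> R by rewrite ltr0n.
rewrite !normc_gauss // -[X in X <= _]mulrA ler_wpM2l ?mulr_ge0 ?powR_ge0 // expRN -invfM.
have p1 : 0 < normc (Gprod b n.+1) by rewrite normc_gt0 Gprod_neq0.
have p2 : 0 < normc (Gprod x%:C n.+1) by rewrite normc_gt0 Gprod_neq0.
rewrite lef_pV2 ?posrE ?mulr_gt0 ?expR_gt0 //.
apply: le_trans (normc_Gprod_le n b0) _; rewrite ler_pM2l // ler_expR /M.
by rewrite ler_wpM2l ?sqr_ge0 // gerDl oppr_le0 invr_ge0 addr_ge0 // ltW.
Qed.

Lemma beta_shift b a n : 0 < Re b -> 0 < Re a ->
  betaC b (a + n%:R) * Gprod (a + b) n = Gprod a n * betaC b a.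
Proof.
move=> b0 a0; elim: n => [|n IH]; first by rewrite /Gprod !big_ord0 addr0 mulr1 mul1r.
have p : 0 < Re (a + n%:R) by rewrite ReD Re_nat ltr_wpDr.
have := beta_rec b0 p; rewrite !GprodS -natr1 addrA => h.
rewrite mulrAC -IH -[RHS]mulrA; set B := betaC b (a + n%:R + 1) in h *.
transitivity (Gprod (a + b) n * ((a + n%:R + b) * B)); first by ring.
by rewrite h; ring.
Qed.

(** Both sides are limits of one sequence: by [beta_shift], B(b, a) times the Gauss product at a + b
    equals the Gauss product at a times n^b B(b, a + 1 + n), and the latter factors tend to Gamma(a)
    and Gamma(b). *)
Lemma beta_Gamma b a : 0 < Re b -> 0 < Re a ->
  betaC b a * Gamma (a + b) = Gamma a * Gamma b.
Proof.
move=> b0 a0; have ab0 : 0 < Re (a + b) by rewrite ReD addr_gt0.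
have a1 : 0 < Re (a + 1) by rewrite ReD addr_gt0.
apply: (@cto_uniq _ _ \oo _ (fun n => betaC b a * gauss (a + b) n)).
  by apply: ctoM; [exact: cto_cst|exact: gauss_lim].
apply: cto_ext (ctoM (gauss_lim a0) (beta_limit b0 a1)) => n.
have h := beta_shift n.+1 b0 a0; have g1 := Gprod_neq0 n.+1 a0.
have g2 := Gprod_neq0 n.+1 ab0.
rewrite -addrA nat1r /gauss cpowD.
have -> : betaC b a = betaC b (a + n.+1%:R) * Gprod (a + b) n.+1 / Gprod a n.+1.
  by rewrite h mulrAC divff // mul1r.
by field; rewrite g1 g2.
Qed.

Lemma sqr_half x : 0 <= x -> (x `^ (1 / 2)) ^+ 2 = x.
Proof. by move=> x0; rewrite div1r powR12_sqrt // sqr_sqrtr. Qed.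

Lemma half_half : 1 / 2 + 1 / 2 = 1 :> R[i]. Proof. by field. Qed.

(** The integrand t^(-1/2) (1-t)^(-1/2) has the primitive 2 atan(sqrt(t/(1-t))), which runs from 0
    to pi. *)
Lemma beta_half : betaC (1 / 2) (1 / 2) = pi%:C :> R[i].
Proof.
pose w t := (t / (1 - t)) `^ (1 / 2) : R.
have dw t : 0 < t -> 0 < 1 - t -> is_derive t 1 w (w t / (2 * t * (1 - t))).
  move=> t0 t1.
  have d1 := is_deriveV (f := fun u : R => 1 - u) (lt0r_neq0 t1) (is_derive_subl 1 t).
  have d2 := is_deriveM (is_derive_id t 1) d1.
  have q0 : 0 < t / (1 - t) by rewrite divr_gt0.
  have d3 := is_derive1_comp (g := fun t => t / (1 - t)) (is_derive1_powR (1 / 2) q0) d2.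
  apply: is_derive_eq d3 _; rewrite /w /GRing.scale /=.
  rewrite powRD ?(gt_eqF q0) ?implybT // powR_inv1 ?(ltW q0) //.
  by field; rewrite !gt_eqF.
pose F t := 2 * atan (w t).
have wE t : 0 < t -> 0 < 1 - t -> w t ^+ 2 = t / (1 - t).
  move=> t0 t1; have q0 : 0 < t / (1 - t) by rewrite divr_gt0.
  by rewrite /w sqr_half // ltW.
have Re12 : Re (1 / 2 : R[i]) = 1 / 2.
  by rewrite (_ : 1 / 2 = (1 / 2)%:C :> R[i]) // realCM realCV -natC.
have p12 : 0 < Re (1 / 2 : R[i]) by rewrite Re12 divr_gt0.
rewrite /betaC (@cftc_oo _ 0 1 (fun t => (F t)%:C) _ 0 pi%:C) ?subr0 //.
- move=> t /andP[t0 t1]; have t2 : 0 < 1 - t by rewrite subr_gt0.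
  apply: isd_eq (isd_real (is_deriveZ 2 (is_derive1_comp (is_derive1_atan (w t))
    (dw t t0 t2)))) _.
  rewrite /GRing.scale /= wE //.
  rewrite /betaf (_ : 1 / 2 - 1 = (1 / 2 - 1)%:C :> R[i]); last first.
    by rewrite realCB realCM realCV -natC.
  rewrite !cpow_real // -realCM; congr (_%:C).
  rewrite !powRD ?(gt_eqF t0) ?(gt_eqF t2) ?implybT // !powR_inv1 ?ltW //.
  have -> : w t = t `^ (1 / 2) / (1 - t) `^ (1 / 2).
    by rewrite /w !powRE ?divr_gt0 // ln_div ?posrE // mulrBr expRD expRN.
  have sq : ((1 - t) `^ (1 / 2)) ^+ 2 = 1 - t by rewrite sqr_half // ltW.
  have s0 : 0 < (1 - t) `^ (1 / 2) by rewrite powR_gt0.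
  set s := (1 - t) `^ (1 / 2) in sq s0 *; rewrite -sq.
  have e1 : t = 1 - s ^+ 2 by rewrite sq; ring.
  have e2 : 1 + t / s ^+ 2 = (s ^+ 2)^-1 by rewrite {1}e1; field; rewrite gt_eqF.
  by rewrite e2; field; rewrite !gt_eqF.
- exact: Ck_betaf.
- exact: betaf_int.
- apply: (@cto_real _ _ _ _ (fun t => F t) 0).
  rewrite [X in _ --> X](_ : 0 = 2 * atan 0); last by rewrite atan0 mulr0.
  apply: cvgM; first exact: cvg_cst.
  apply: (continuous_cvg _ (@continuous_atan R _)).
  apply: (@squeeze_cvgr _ _ _ _ (fun=> 0) (fun t => 2 * t `^ (1 / 2))); last 2 first.
  + exact: cvg_cst.
  + by rewrite -[X in _ --> X](mulr0 2); apply: cvgM; [exact: cvg_cst|exact: powR_cvg0].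
  near=> t; have t0 : 0 < t by near: t; exact: nbhs_right_gt.
  have t1 : t < 1 / 2 by near: t; exact: nbhs_right_lt.
  have t2 : 0 < 1 - t by lra.
  rewrite powR_ge0 /= -[leLHS]ger0_norm ?powR_ge0 //.
  rewrite -[leRHS]ger0_norm ?mulr_ge0 ?powR_ge0 // -ler_sqr ?nnegrE ?normr_ge0 //.
  rewrite !real_normK ?num_real // wE // exprMn sqr_half ?(ltW t0) //.
  by rewrite ler_pdivrMr //; nra.
- apply: (@cto_real _ _ _ _ (fun t => F t) pi).
  have -> : pi = 2 * (pi / 2) :> R by rewrite mulrCA divff ?mulr1.
  apply: cvgM; first exact: cvg_cst.
  apply: (cvg_comp w _ _ (@cvgy_atan R)).
  apply/cvgryPge => A; near=> t.
  have t0 : 1 / 2 < t by near: t; apply: nbhs_left_gt; lra.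
  have t1 : t < 1 by near: t; exact: nbhs_left_lt.
  have t2 : 0 < 1 - t by lra.
  have t3 : 0 < t by lra.
  (* Together with t > 1/2 this gives t/(1-t) > 1 + A^2, hence [w t] exceeds |A|. *)
  have tA : 1 - (2 * (1 + A ^+ 2))^-1 < t.
    near: t; apply: nbhs_left_gt; rewrite ltrBlDr ltrDl invr_gt0 mulr_gt0 //.
    by rewrite ltr_wpDr ?sqr_ge0.
  apply: le_trans (ler_norm A) _; rewrite -[leRHS]ger0_norm ?powR_ge0 //.
  rewrite -ler_sqr ?nnegrE ?normr_ge0 // !real_normK ?num_real // wE //.
  rewrite ler_pdivlMr //.
  have A1 : 0 < 2 * (1 + A ^+ 2) by rewrite mulr_gt0 // ltr_wpDr ?sqr_ge0.
  have : (1 - t) * (2 * (1 + A ^+ 2)) < 1 by rewrite -ltr_pdivlMr // mul1r; lra.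
  by have := sqr_ge0 A; set B := A ^+ 2; nra.
Unshelve. all: end_near. Qed.

(** The Beta formula at (1/2, 1/2) only gives the square; positivity of Gamma on the positive reals
    selects the root. *)
Lemma Gamma_half : Gamma (1 / 2) = cpow pi (1 / 2) :> R[i].
Proof.
have h12 : 1 / 2 = (1 / 2)%:C :> R[i] by rewrite realCM realCV -natC.
have p12 : 0 < Re (1 / 2 : R[i]) by rewrite h12 /= divr_gt0.
have g0 := @Gamma_real_gt0 (1 / 2) (divr_gt0 ltr01 (ltr0n _ 2)).
have := beta_Gamma p12 p12; rewrite beta_half half_half.
rewrite Gamma1 mulr1 -[Gamma _ * _]expr2.
have sq : cpow pi (1 / 2) ^+ 2 = pi%:C :> R[i].
  by rewrite expr2 -cpowD half_half cpow1 ?pi_gt0.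
move=> /esym; rewrite -sq => /eqP; rewrite eqf_sqr => /orP[/eqP//|/eqP e].
move: g0; rewrite -h12 e h12 cpow_real ?pi_gt0 // ReN /= oppr_gt0.
by rewrite ltNge powR_ge0.
Qed.

End GaussProduct.

(** * Bessel functions and Sonine's integral *)

Section Bessel.
Context {R : realType}.
Local Notation mu := (@lebesgue_measure R).
Local Notation mbl D := (@measurable _ (measurableTypeR R) D).
Implicit Types (t u x y : R) (z w a b nu la : R[i]) (D : set R).

(* With this entire function, J_nu(x) = (x/2)^nu bj nu (x^2/4). *)
Definition jcoef nu k : R[i] := (-1) ^+ k / (k`!%:R * Gamma (nu + k%:R + 1)).
Definition bj nu y : R[i] :=
  limn (pseries (fun k => Re (jcoef nu k)) y) +i* limn (pseries (fun k => Im (jcoef nu k)) y).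

Lemma Re_nuS nu k : -1 < Re nu -> 0 < Re (nu + k%:R + 1).
Proof. by move=> h; rewrite !ReD Re_nat /= -addrA [k%:R + 1]addrC addrA ltr_wpDr // -ltrBlDr sub0r. Qed.

Lemma Re_nu1 nu : -1 < Re nu -> -1 < Re (nu + 1).
Proof. by rewrite ReD /=; lra. Qed.

Lemma jcoefS nu k : -1 < Re nu -> k.+1%:R * jcoef nu k.+1 = - jcoef (nu + 1) k.
Proof.
move=> h; rewrite /jcoef exprS factS natrM mulN1r.
have -> : nu + k.+1%:R + 1 = nu + 1 + k%:R + 1 by rewrite -natr1; ring.
have g : Gamma (nu + 1 + k%:R + 1) != 0 by apply: Gamma_neq0; apply: Re_nuS; exact: Re_nu1.
have f1 : (k`!%:R : R[i]) != 0 by rewrite pnatr_eq0 -lt0n fact_gt0.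
have f2 : (k.+1%:R : R[i]) != 0 by rewrite pnatr_eq0.
set K := k.+1%:R in f2 *; clearbody K; set q := k`!%:R in f1 *; clearbody q.
by field; rewrite g f1 f2.
Qed.

Lemma jcoef_rec0 nu : -1 < Re nu -> jcoef nu 0 = (nu + 1) * jcoef (nu + 1) 0.
Proof.
move=> h; have p := @Re_nuS nu 0%N h; rewrite addr0 in p.
rewrite /jcoef !addr0 (Gamma_rec p) expr0 fact0 !mul1r.
by field; rewrite Gamma_neq0 // Re_gt0_neq0.
Qed.

Lemma jcoef_recS nu k : -1 < Re nu ->
  jcoef nu k.+1 = (nu + 1) * jcoef (nu + 1) k.+1 - jcoef (nu + 2%:R) k.
Proof.
move=> h; have h1 := Re_nu1 h.
have p := @Re_nuS nu k.+1 h.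
rewrite /jcoef exprS factS natrM mulN1r.
have -> : nu + 1 + k.+1%:R + 1 = (nu + k.+1%:R + 1) + 1 by ring.
have -> : nu + 2%:R + k%:R + 1 = (nu + k.+1%:R + 1) + 1 by rewrite -(natr1 k); ring.
rewrite (Gamma_rec p); have g := Gamma_neq0 p; have q := Re_gt0_neq0 p.
have f1 : (k`!%:R : R[i]) != 0 by rewrite pnatr_eq0 -lt0n fact_gt0.
have f2 : (k.+1%:R : R[i]) != 0 by rewrite pnatr_eq0.
set G := Gamma _ in g *; clearbody G.
set K := k.+1%:R in f2 p q *; clearbody K; set F := k`!%:R in f1 *; clearbody F.
by field; rewrite g f1 f2 q.
Qed.

(** Here Gamma(nu+k+1) = (nu+1)_k Gamma(nu+1). The first factor of (nu+1)_k has modulus at least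
    Re(nu+1) and all later ones at least 1, so (nu+1)_k stays above [c]. *)
Lemma jcoef_bound nu : -1 < Re nu ->
  exists2 C : R, 0 < C & forall k, normc (jcoef nu k) <= C / k`!%:R.
Proof.
move=> h; have p : 0 < Re (nu + 1) by rewrite ReD /= -ltrBlDr sub0r.
pose c := Num.min 1 (Re (nu + 1)); have c0 : 0 < c by rewrite lt_min ltr01.
have GG k : Gamma (nu + k%:R + 1) = Gprod (nu + 1) k * Gamma (nu + 1).
  elim: k => [|k IH]; first by rewrite addr0 /Gprod big_ord0 mul1r.
  have -> : nu + k.+1%:R + 1 = (nu + k%:R + 1) + 1 by rewrite -natr1; ring.
  by rewrite Gamma_rec ?Re_nuS // IH GprodS; ring.
have Gge k : c <= normc (Gprod (nu + 1) k).
  case: k => [|k]; first by rewrite /Gprod big_ord0 normc1 ge_min lexx.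
  elim: k => [|k IH].
    rewrite GprodS /Gprod big_ord0 mul1r addr0.
    by apply: le_trans (le_trans (ler_norm _) (Re_le_normc _)); rewrite ge_min lexx orbT.
  rewrite GprodS normcM -[X in X <= _]mulr1 ler_pM ?(ltW c0) //.
  apply: le_trans (le_trans (ler_norm _) (Re_le_normc _)).
  by rewrite [Re (_ + k.+1%:R)]ReD Re_nat -natr1 addrA lerDr addr_ge0 // ltW.
have G0 : 0 < normc (Gamma (nu + 1)) by rewrite normc_gt0 Gamma_neq0.
exists (c * normc (Gamma (nu + 1)))^-1; first by rewrite invr_gt0 mulr_gt0.
move=> k; rewrite /jcoef GG normcM normcV normcX.
have -> : normc (-1 : R[i]) = 1 by rewrite normcNE normc1.
rewrite expr1n mul1r normcM normc_nat -invfM.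
have f0 : 0 < k`!%:R :> R by rewrite ltr0n fact_gt0.
have g0 : 0 < normc (Gprod (nu + 1) k) by apply: lt_le_trans (Gge k).
have c1 : 0 < c * normc (Gamma (nu + 1)) * k`!%:R by rewrite !mulr_gt0.
have hle : c * normc (Gamma (nu + 1)) * k`!%:R <= k`!%:R * normc (Gprod (nu + 1) k * Gamma (nu + 1)).
  by rewrite (normcM (Gprod (nu + 1) k)) [X in _ <= X]mulrC ler_wpM2r ?(ltW f0) // ler_wpM2r ?(ltW G0).
by rewrite lef_pV2 // posrE // (lt_le_trans c1 hle).
Qed.

Lemma cvg_pseries_bound (f : nat -> R) C y : (forall k, `|f k| <= C / k`!%:R) ->
  cvgn (pseries f y).
Proof.
move=> fC; apply: normed_cvg.
apply: (@series_le_cvg _ _ (fun k => C * exp_coeff `|y| k)).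
- by move=> n; exact: normr_ge0.
- move=> n; rewrite mulr_ge0 ?exp_coeff_ge0 //.
  by have := le_trans (normr_ge0 _) (fC 0%N); rewrite fact0 divr1.
- by move=> n; rewrite /= normrM normrX /exp_coeff /= mulrCA [X in X <= _]mulrC ler_wpM2l ?exprn_ge0.
- rewrite (_ : series _ = (fun n => C * series (exp_coeff `|y|) n)); last first.
    by apply/funext => n; rewrite /series /= mulr_sumr.
  by apply: is_cvgM; [exact: is_cvg_cst|exact: is_cvg_series_exp_coeff].
Qed.

Lemma jRe_bound nu : -1 < Re nu ->
  exists C : R, forall k, `|Re (jcoef nu k)| <= C / k`!%:R.
Proof.
move=> /jcoef_bound[C _ hC]; exists C => k; exact: le_trans (Re_le_normc _) (hC k).
Qed.

Lemma jIm_bound nu : -1 < Re nu ->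
  exists C : R, forall k, `|Im (jcoef nu k)| <= C / k`!%:R.
Proof.
move=> /jcoef_bound[C _ hC]; exists C => k; exact: le_trans (Im_le_normc _) (hC k).
Qed.

Lemma pser_Re nu y : -1 < Re nu -> cvgn (pseries (fun k => Re (jcoef nu k)) y).
Proof. by move=> /jRe_bound[C hC]; exact: cvg_pseries_bound hC. Qed.

Lemma pser_Im nu y : -1 < Re nu -> cvgn (pseries (fun k => Im (jcoef nu k)) y).
Proof. by move=> /jIm_bound[C hC]; exact: cvg_pseries_bound hC. Qed.

Definition bjn nu n y : R[i] := \sum_(0 <= k < n) jcoef nu k * y%:C ^+ k.

Lemma bjn_cto nu y : -1 < Re nu -> cto \oo (fun n => bjn nu n y) (bj nu y).
Proof.
move=> h; split.
- rewrite (_ : (fun n => _) = pseries (fun k => Re (jcoef nu k)) y); first exact: pser_Re.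
  apply/funext => n; rewrite /bjn /pseries /series /=.
  elim: n => [|n IH]; first by rewrite !big_nil.
  by rewrite !big_nat_recr //= ReD IH -realCX ReM /= mulr0 subr0.
- rewrite (_ : (fun n => _) = pseries (fun k => Im (jcoef nu k)) y); first exact: pser_Im.
  apply/funext => n; rewrite /bjn /pseries /series /=.
  elim: n => [|n IH]; first by rewrite !big_nil.
  by rewrite !big_nat_recr //= ImD IH -realCX ImM /= mulr0 add0r.
Qed.

Lemma bjn_bound nu : -1 < Re nu ->
  exists2 C : R, 0 < C & forall n y, normc (bjn nu n y) <= C * expR `|y|.
Proof.
move=> /jcoef_bound[C C0 hC]; exists C => // n y; rewrite /bjn.
apply: le_trans (normc_sum _ _ _) _.
apply: (@le_trans _ _ (C * series (exp_coeff `|y|) n)).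
  rewrite /series /= mulr_sumr; apply: ler_sum => k _.
  by rewrite normcM normcX normc_real /exp_coeff /= mulrCA [X in X <= _]mulrC ler_wpM2l ?exprn_ge0.
rewrite ler_pM2l //; apply: nondecreasing_cvgn_le.
- by apply: nondecreasing_series => k _ _; exact: exp_coeff_ge0.
- exact: is_cvg_series_exp_coeff.
Qed.

(** Termwise differentiation: by [jcoefS] the derived series is minus the series of order nu + 1,
    and the second derived one is that of order nu + 2, so all convergence conditions are instances
    of the coefficient bound. *)
Lemma isd_bj nu y : -1 < Re nu -> isd (bj nu) y (- bj (nu + 1) y).
Proof.
move=> h; have h1 := Re_nu1 h; have h2 := Re_nu1 h1.
pose K := `|y| + 1; have yK : `|y| < `|K|.
  by rewrite [ltRHS]ger0_norm ?addr_ge0 // ltrDl.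
have dRe mu' : -1 < Re mu' -> pseries_diffs (fun k => Re (jcoef mu' k)) =
    - (fun k => Re (jcoef (mu' + 1) k)).
  move=> hm; apply/funext => k; rewrite /pseries_diffs.
  have := congr1 (@complex.Re R) (jcoefS k hm).
  by rewrite ReM Re_nat Im_nat mul0r subr0 ReN.
have dIm mu' : -1 < Re mu' -> pseries_diffs (fun k => Im (jcoef mu' k)) =
    - (fun k => Im (jcoef (mu' + 1) k)).
  move=> hm; apply/funext => k; rewrite /pseries_diffs.
  have := congr1 (@complex.Im R) (jcoefS k hm).
  by rewrite ImM Re_nat Im_nat mul0r addr0 ImN.
have pN (f : nat -> R) x : pseries (- f) x = - pseries f x.
  apply/funext => n; rewrite /pseries /series /= -[RHS]sumrN.
  by apply: eq_bigr => k _; rewrite mulNr.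
split.
- have := @pseries_snd_diffs _ (fun k => Re (jcoef nu k)) K y; rewrite dRe // pseries_diffsN dRe //.
  rewrite !pN opprK ReN => H.
  have -> : - Re (bj (nu + 1) y) = limn (- pseries (fun k => Re (jcoef (nu + 1) k)) y).
    by rewrite limN //; exact: pser_Re.
  apply: H => //; rewrite ?is_cvgNE; exact: pser_Re.
- have := @pseries_snd_diffs _ (fun k => Im (jcoef nu k)) K y; rewrite dIm // pseries_diffsN dIm //.
  rewrite !pN opprK ImN => H.
  have -> : - Im (bj (nu + 1) y) = limn (- pseries (fun k => Im (jcoef (nu + 1) k)) y).
    by rewrite limN //; exact: pser_Im.
  apply: H => //; rewrite ?is_cvgNE; exact: pser_Im.
Qed.

(** The recurrence J_nu + J_(nu+2) = (2(nu+1)/x) J_(nu+1) freed of powers of x. It holds already for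
    partial sums, the last series being cut one term earlier because of the factor y. *)
Lemma bj_rec nu y : -1 < Re nu ->
  bj nu y = (nu + 1) * bj (nu + 1) y - y%:C * bj (nu + 2%:R) y.
Proof.
move=> h; have h1 := Re_nu1 h; have h2 : -1 < Re (nu + 2%:R) by rewrite ReD Re_nat; lra.
have e n : bjn nu n.+1 y = (nu + 1) * bjn (nu + 1) n.+1 y - y%:C * bjn (nu + 2%:R) n y.
  elim: n => [|n IH].
    by rewrite /bjn !big_nat1 big_nil jcoef_rec0 //; ring.
  have bS nu' m : bjn nu' m.+1 y = bjn nu' m y + jcoef nu' m * y%:C ^+ m.
    by rewrite /bjn big_nat_recr.
  rewrite (bS nu) IH jcoef_recS // (bS (nu + 1) n.+1) (bS (nu + 2%:R) n) exprS.
  move: (bjn (nu + 1) n.+1 y) (bjn (nu + 2%:R) n y) (jcoef (nu + 1) n.+1)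
    (jcoef (nu + 2%:R) n) (y%:C ^+ n) => A B C0 C1 Y.
  by ring.
apply: (@cto_uniq _ _ \oo _ (fun n => bjn nu (n + 1) y)).
  exact: cto_shiftV (bjn_cto y h).
apply: cto_ext (ctoB (ctoM (@cto_cst _ _ \oo _ (nu + 1)) (cto_shiftV 1 (bjn_cto y h1)))
  (ctoM (@cto_cst _ _ \oo _ y%:C) (bjn_cto y h2))) => n.
by rewrite addn1 e.
Qed.

(** Links componentwise limits to the norm topology in which [besselJ] takes its limit. A positive
    epsilon of [R[i]] is real, so the estimate is made on its real part. *)
Lemma cto_cvg {T : Type} (F : set_system T) {FF : Filter F} (f : T -> R[i]) (l : R[i]) :
  cto F f l -> (f x : R[i]^o) @[x --> F] --> (l : R[i]^o).
Proof.
move=> fl; have /cto0_normc : cto F (fun i => l - f i) 0.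
  by rewrite -(subrr l); apply: ctoB => //; exact: cto_cst.
move=> n0; apply/cvgrPdist_lt => e e0.
have eR : e = (Re e)%:C by rewrite RRe_real // gtr0_real.
have re0 : 0 < Re e by move: e0; rewrite {1}eR ltcR.
move/cvgr0Pnorm_lt : n0 => /(_ _ re0); apply: filterS => i.
rewrite ger0_norm ?normc_ge0 // => hx.
by rewrite eR (normc_norm (l - f i)) ltcR.
Qed.

Lemma besselJE nu x : -1 < Re nu -> 0 < x ->
  besselJ nu x = cpow (x / 2) nu * bj nu (x ^+ 2 / 4).
Proof.
move=> h x0; rewrite /besselJ; apply: (cvg_lim (@norm_hausdorff _ R[i]^o)).
apply: cto_cvg.
apply: cto_ext (ctoM (@cto_cst _ _ \oo _ (cpow (x / 2) nu)) (bjn_cto (x ^+ 2 / 4) h)) => n.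
rewrite /bjn mulr_sumr; apply: eq_bigr => k _.
have x2 : 0 < x / 2 by rewrite divr_gt0.
rewrite /besselJ_term -/(jcoef nu k) cpowD cpow_nat // -muln2 mulnC exprM -(realCX (x / 2) 2).
rewrite (_ : (x / 2) ^+ 2 = x ^+ 2 / 4); last by field.
by rewrite mulrCA mulrA.
Qed.

(** The series of [bj] is integrated termwise: the k-th term is a Beta integral, whose Gamma(nu+k+1)
    cancels the one in the coefficient and leaves Gamma(la+1) over the Gamma factor of order nu + la
    + 1. The partial sums are dominated by C e^|y| times the Beta integrand. *)
Lemma sonine nu la y : -1 < Re nu -> -1 < Re la ->
  cintegrable `]0, 1[ (fun t => betaf (nu + 1) (la + 1) t * bj nu (y * t)) /\
  cintegral `]0, 1[ (fun t => betaf (nu + 1) (la + 1) t * bj nu (y * t)) =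
  Gamma (la + 1) * bj (nu + la + 1) y.
Proof.
move=> hn hl; have hnl : -1 < Re (nu + la + 1) by rewrite !ReD /=; lra.
have pn : 0 < Re (nu + 1) by rewrite ReD /= -ltrBlDr sub0r.
have pl : 0 < Re (la + 1) by rewrite ReD /= -ltrBlDr sub0r.
have [C C0 hC] := bjn_bound hn.
pose g t := C * expR `|y| * normc (betaf (nu + 1) (la + 1) t).
have gi : rint `]0, 1[ g by apply: rintZ => //; apply: rint_normc => //; exact: betaf_int.
pose S n t := betaf (nu + 1) (la + 1) t * bjn nu n (y * t).
have Sg n t : `]0, 1[%classic t -> normc (S n t) <= g t.
  move=> /in01[t0 t1]; rewrite /S /g normcM mulrC ler_wpM2r ?normc_ge0 //.
  apply: le_trans (hC _ _) _; rewrite ler_pM2l // ler_expR normrM.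
  by rewrite ler_piMr // ger0_norm ?(ltW t0) // -subr_ge0 ltW.
have Slim t : cto \oo (fun n => S n t) (betaf (nu + 1) (la + 1) t * bj nu (y * t)).
  by apply: ctoM; [exact: cto_cst|exact: bjn_cto].
have cf : Ck 0 `]0, 1[ (fun t => betaf (nu + 1) (la + 1) t * bj nu (y * t)).
  apply: CkM; first exact: Ck_betaf.
  move=> t _; apply: (@cto_comp _ _ _ (nbhs t) (nbhs (y * t)) (fun t => y * t)).
    by apply: cvgM; [exact: cvg_cst|exact: cvg_id].
  exact: isd_cto (isd_bj (y * t) hn).
have fi : cintegrable `]0, 1[ (fun t => betaf (nu + 1) (la + 1) t * bj nu (y * t)).
  apply: cintegrable_le gi => //; first exact: cmeas_Ck.
  move=> t Dt; have l : normc (S n t) @[n --> \oo] -->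
    normc (betaf (nu + 1) (la + 1) t * bj nu (y * t)) by exact: cto_normc (Slim t).
  by apply: (ler_cvg_to l (cvg_cst (g t))); near=> n; exact: Sg.
split => //.
pose T n t := \sum_(0 <= k < n) (jcoef nu k * y%:C ^+ k * betaf (nu + 1 + k%:R) (la + 1) t).
have pk k : 0 < Re (nu + 1 + k%:R) by rewrite ReD Re_nat ltr_wpDr.
have Ti k : cintegrable `]0, 1[ (fun t => jcoef nu k * y%:C ^+ k * betaf (nu + 1 + k%:R) (la + 1) t).
  by apply: cintegrableZ => //; exact: betaf_int.
have ST n t : `]0, 1[%classic t -> S n t = T n t.
  move=> /in01[t0 t1]; rewrite /S /T /bjn mulr_sumr; apply: eq_bigr => k _.
  rewrite /betaf (_ : nu + 1 + k%:R - 1 = nu + 1 - 1 + k%:R); last by ring.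
  by rewrite (cpowD t (nu + 1 - 1) k%:R) cpow_nat // realCM exprMn; ring.
have Sint n : cintegral `]0, 1[ (S n) = Gamma (la + 1) * bjn (nu + la + 1) n y.
  rewrite (cint_ext (ST n)) cint_sum // /bjn mulr_sumr; apply: eq_bigr => k _.
  rewrite cintZ //; last exact: betaf_int.
  rewrite -/(betaC _ _) /jcoef; have := beta_Gamma (pk k) pl.
  have -> : nu + la + 1 + k%:R + 1 = la + 1 + (nu + 1 + k%:R) by ring.
  have -> : nu + k%:R + 1 = nu + 1 + k%:R by ring.
  have g1 := Gamma_neq0 (pk k).
  have g2 : Gamma (la + 1 + (nu + 1 + k%:R)) != 0 by apply: Gamma_neq0; rewrite ReD addr_gt0.
  move=> /(canRL (mulfK g2)) ->.
  have f1 : (k`!%:R : R[i]) != 0 by rewrite pnatr_eq0 -lt0n fact_gt0.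
  set q := k`!%:R in f1 *; clearbody q; set G1 := Gamma _ in g1 *; set G2 := Gamma _ in g2 *.
  set s := (-1) ^+ k; set yk := _ ^+ k; set Gl := Gamma (la + 1).
  by field; rewrite g1 g2 f1.
apply: (@cto_uniq _ _ \oo _ (fun n => cintegral `]0, 1[ (S n))).
  apply: (@cdct _ _ S _ g) => //.
  - move=> n; apply: cmeas_Ck => //; apply: (@Ck_near _ 0 _ (T n)).
    + exact: interval_open.
    + by move=> t Dt; rewrite ST.
    + apply: Ck_sum => k; apply: CkZ; exact: Ck_betaf.
  - exact: cmeas_Ck.
by apply: cto_ext (ctoM (@cto_cst _ _ \oo _ (Gamma (la + 1))) (bjn_cto y hnl)) => n; rewrite Sint.
Unshelve. all: end_near. Qed.

(** Duplication formula at half-integers, by induction from Gamma(1/2). It turns the series of order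
    -1/2 into the cosine series. *)
Lemma fact_Gamma_half k :
  (k`!%:R * Gamma (- (1 / 2) + k%:R + 1) * 4%:R ^+ k : R[i]) = k.*2`!%:R * cpow pi (1 / 2).
Proof.
have hh : - (1 / 2) + 1 = 1 / 2 :> R[i] by field.
elim: k => [|k IH]; first by rewrite addr0 hh Gamma_half expr0 mulr1.
have R12 : Re (- (1 / 2) : R[i]) = - (1 / 2).
  by rewrite (_ : 1 / 2 = (1 / 2)%:C :> R[i]) // realCM realCV -natC.
have p : 0 < Re (- (1 / 2) + k%:R + 1 : R[i]).
  by apply: Re_nuS; rewrite R12; lra.
have -> : - (1 / 2) + k.+1%:R + 1 = (- (1 / 2) + k%:R + 1) + 1 :> R[i] by rewrite -natr1; ring.
rewrite Gamma_rec // exprS doubleS !factS !natrM.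
transitivity ((k`!%:R * Gamma (- (1 / 2) + k%:R + 1) * 4%:R ^+ k) *
  (k.+1%:R * (- (1 / 2) + k%:R + 1) * 4%:R) : R[i]); first by ring.
rewrite IH -[k.*2.+2%:R]natr1 -[k.*2.+1%:R]natr1 -muln2 natrM -(natr1 k).
by field.
Qed.

Lemma bj_Nhalf x : bj (- (1 / 2)) (x ^+ 2 / 4) = (cos x)%:C / cpow pi (1 / 2).
Proof.
have R12 : -1 < Re (- (1 / 2) : R[i]).
  by rewrite (_ : - (1 / 2) = (- (1 / 2))%:C :> R[i]) /= ?realCN ?realCM ?realCV -?natC //; lra.
apply: cto_uniq (bjn_cto _ R12) _.
apply: cto_ext (ctoM (cto_real (@cvg_cos_coeff' R x)) (@cto_cst _ _ \oo _ (cpow pi (1 / 2))^-1)) => n.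
rewrite /series /= /bjn rmorph_sum mulr_suml; apply: eq_bigr => k _.
rewrite /cos_coeff' -exprnP /jcoef; have := fact_Gamma_half k.
have f1 : (k.*2`!%:R : R[i]) != 0 by rewrite pnatr_eq0 -lt0n fact_gt0.
have f2 := cpow_neq0 (pi : R) (1 / 2).
have f3 : (4%:R ^+ k : R[i]) != 0 by rewrite expf_neq0 // pnatr_eq0.
move=> /(canRL (mulfK f3)) ->.
rewrite -[X in X / _ = _]/(((-1) ^+ k * x ^+ k.*2 / (k.*2)`!%:R)%:C).
have s1 : ((-1) ^+ k)%:C = (-1) ^+ k :> R[i] by rewrite realCX realCN.
have s2 : (x ^+ k.*2)%:C = (x%:C ^+ 2) ^+ k :> R[i] by rewrite realCX -muln2 mulnC exprM.
have s3 : (x ^+ 2 / 4)%:C ^+ k = (x%:C ^+ 2) ^+ k / 4%:R ^+ k :> R[i].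
  by rewrite realCM realCV -natC realCX exprMn exprVn.
rewrite s3 !realCM realCV s1 s2 -natC; move: f1 f2 f3.
set P := cpow _ _; set F := k.*2`!%:R; set Q := 4%:R ^+ k; set S := (-1) ^+ k.
set X := (x%:C ^+ 2) ^+ k; move=> f1 f2 f3; clearbody P F Q S X.
by field; rewrite f1 f2 f3.
Qed.

End Bessel.

(** * Asymptotics of Bessel functions *)

Section LaplaceTransform.
Context {R : realType}.
Local Notation mu := (@lebesgue_measure R).
Local Notation mbl D := (@measurable _ (measurableTypeR R) D).
Implicit Types (t u x y r : R) (z w a b nu la : R[i]) (D : set R).

Lemma isd_under D (f df : R -> R -> R[i]) (G : R -> R) r : mbl D ->
  (forall x, cintegrable D (f x)) ->
  (forall x t, D t -> isd (fun u => f u t) x (df x t)) ->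
  rint D G -> (forall t, 0 <= G t) -> (forall x t, D t -> normc (df x t) <= G t) ->
  isd (fun x => cintegral D (f x)) r (cintegral D (df r)).
Proof.
move=> mD fi dfP Gi G0 dG.
have rI : (r - 1 < r < r + 1) by lra.
have rI' : (`](r - 1), (r + 1)[%classic : set R) r by rewrite /= in_itv.
have key (h dh : R -> R -> R) : (forall x, rint D (h x)) ->
    (forall x t, D t -> is_derive x 1 (fun u => h u t) (dh x t)) ->
    (forall x t, D t -> `|dh x t| <= G t) ->
    is_derive r 1 (fun x => \int[mu]_(t in D) h x t) (\int[mu]_(t in D) dh r t).
  move=> hi hd hG.
  have E x t : D t -> partial1of2 h x t = dh x t.
    by move=> Dt; rewrite partial1of2E; case: (hd x t Dt).
  have c1 : forall x t, (`](r - 1), (r + 1)[%classic : set R) x -> D t -> derivable (h ^~ t) x 1.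
    by move=> x t _ Dt; case: (hd x t Dt).
  have c2 : forall x t, (`](r - 1), (r + 1)[%classic : set R) x -> D t -> `|partial1of2 h x t| <= G t.
    by move=> x t _ Dt; rewrite E // hG.
  apply: DeriveDef.
    exact: (@derivable_under_integral R _ (measurableTypeR R) mu h D mD r (r - 1) (r + 1) rI'
      (fun x _ => hi x) c1 G G0 Gi c2).
  rewrite -derive1E.
  rewrite (@differentiation_under_integral R _ (measurableTypeR R) mu h D mD r (r - 1) (r + 1) rI'
      (fun x _ => hi x) c1 G G0 Gi c2).
  by apply: eq_Rintegral => t; rewrite inE => Dt; rewrite -(E r t Dt).
split; rewrite ?cint_re ?cint_im.
- apply: (key (fun x t => Re (f x t)) (fun x t => Re (df x t))).
  + by move=> x; case: (fi x).
  + by move=> x t Dt; case: (dfP x t Dt).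
  + by move=> x t Dt; exact: le_trans (Re_le_normc _) (dG x t Dt).
- apply: (key (fun x t => Im (f x t)) (fun x t => Im (df x t))).
  + by move=> x; case: (fi x).
  + by move=> x t Dt; case: (dfP x t Dt).
  + by move=> x t Dt; exact: le_trans (Im_le_normc _) (dG x t Dt).
Qed.

(** The real part 1 keeps the Laplace integral absolutely convergent, with a majorant independent of
    r. *)
Definition wr r : R[i] := 1 + cI * r%:C.

Lemma Re_wr r : Re (wr r) = 1. Proof. by rewrite /wr !ReImE /= mul0r mulr0 subrr addr0. Qed.

Lemma wr_neq0 r : wr r != 0. Proof. by apply: Re_gt0_neq0; rewrite Re_wr. Qed.

Lemma isd_laplace z r : 0 < Re z ->
  isd (fun x => laplace z (wr x)) r (- cI * laplace (z + 1) (wr r)).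
Proof.
move=> z0; have z1 : 0 < Re (z + 1) by rewrite ReD addr_gt0.
have w0 x : 0 < Re (wr x) by rewrite Re_wr.
rewrite /laplace -cintZ //; last exact: egam_int.
apply: (@isd_under _ (fun x => egam z (wr x)) (fun x t => - cI * egam (z + 1) (wr x) t)
  (fun t => normc (egam (z + 1) 1 t))) => //.
- by move=> x; exact: egam_int.
- move=> x t /in0y t0; have dw : isd (fun u => - (wr u * t%:C)) x (- (cI * t%:C)).
    apply: isdN; have := isd_lin (cI * t%:C) x => /(isdD (isd_cst t%:C x)).
    rewrite add0r; apply: isd_ext => u; rewrite /wr; ring.
  apply: isd_eq (isdZ (cpow t (z - 1)) (isd_cexp dw)) _.
  rewrite /egam addrK (_ : cpow t z = t%:C * cpow t (z - 1)); last by rewrite -cpowS // subrK.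
  by ring.
- by apply: rint_normc => //; exact: egam_int.
- by move=> t; exact: normc_ge0.
- move=> x t /in0y t0; rewrite normcM normcNE normc_cI mul1r.
  by rewrite !normc_egam // Re_wr.
Qed.

(* The logarithm of 1 + ir. *)
Definition Lr r : R[i] := (ln (1 + r ^+ 2) / 2)%:C + cI * (atan r)%:C.

Lemma isd_Lr r : isd Lr r (cI / wr r).
Proof.
have p : 0 < 1 + r ^+ 2 by rewrite ltr_wpDr ?sqr_ge0.
have d0 : is_derive r 1 (fun u : R => 1 + u * u) (r + r).
  have d1 : is_derive r 1 (fun u : R => u * u) (r + r).
    apply: is_derive_eq (is_deriveM (is_derive_id r 1) (is_derive_id r 1)) _.
    by rewrite /GRing.scale /= !mulr1.
  by apply: is_derive_eq (is_derive1_comp (g := fun u : R => u * u) (is_derive_addl 1 _) d1) _;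
    rewrite mul1r.
have p' : 0 < 1 + r * r by rewrite -expr2.
have d1 := is_derive1_comp (g := fun u : R => 1 + u * u) (is_derive1_ln p') d0.
have d2 := isd_real (is_deriveZ 2^-1 d1).
have d3 := isdZ cI (isd_real (is_derive1_atan r)).
have := isdD d2 d3 => /isd_ext H.
apply: isd_eq (H _ _) _.
  by move=> u; rewrite /Lr expr2 [X in _ = X%:C + _]mulrC.
rewrite /GRing.scale /=.
apply: (mulIf (wr_neq0 r)); rewrite divfK ?wr_neq0 // /wr.
have e : ((1 + r ^+ 2)^-1)%:C * (1 + r%:C ^+ 2) = 1 :> R[i].
  by rewrite realCV realCD realCX mulVf // -realCX -realCD realC_eq0 gt_eqF.
rewrite -expr2 (_ : 2^-1 * ((1 + r ^+ 2)^-1 * (r + r)) = (1 + r ^+ 2)^-1 * r); last first.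
  by field; rewrite gt_eqF.
rewrite realCM; set k := ((1 + r ^+ 2)^-1)%:C in e *.
transitivity (cI * (k * (1 + r%:C ^+ 2)) + k * r%:C * (1 + cI * cI) : R[i]); first by ring.
by rewrite e sqr_cI subrr mulr0 addr0 mulr1.
Qed.

(* Both sides satisfy the same first order differential equation in r. *)
Lemma laplace_val z r : 0 < Re z -> laplace z (wr r) = Gamma z * cexp (- z * Lr r).
Proof.
move=> z0; pose H x := laplace z (wr x) * cexp (z * Lr x).
have dH x : isd H x 0.
  apply: isd_eq (isdM (isd_laplace x z0) (isd_cexp (isdZ z (isd_Lr x)))) _.
  have w0 : 0 < Re (wr x) by rewrite Re_wr.
  have -> : laplace (z + 1) (wr x) = z * laplace z (wr x) / wr x.
    by rewrite -laplace_rec // mulrAC divff ?mul1r // wr_neq0.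
  by ring.
have HE : H r = H 0.
  apply: complex_eqP.
  - by apply: (@is_derive_0_is_cst _ (fun x => Re (H x))) => x; case: (dH x).
  - by apply: (@is_derive_0_is_cst _ (fun x => Im (H x))) => x; case: (dH x).
have H0 : H 0 = Gamma z.
  rewrite /H /wr /Lr expr0n addr0 ln1 mul0r atan0 !mulr0 !addr0 mulr0 cexp0 mulr1.
  by rewrite GammaE.
by rewrite -H0 -HE /H -mulrA -cexpD mulNr addrN cexp0 mulr1.
Qed.

(** The modulus contributes ln x - ln(1 + x^2)/2, which tends to 0, and the argument atan(sx) tends
    to s pi/2. So (1 + isx)^(-z) behaves as x^(-z) e^(-isz pi/2), the origin of the phase shift in
    the Bessel asymptotics. *)
Lemma Lr_lim (s : R) z : s = 1 \/ s = -1 ->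
  cto +oo (fun x => cpow x z * cexp (- z * Lr (s * x))) (cexp (- z * (cI * (s * (pi / 2))%:C))).
Proof.
move=> hs; have s2 : s ^+ 2 = 1 by case: hs => ->; rewrite ?sqrrN expr1n.
have at1 : atan (s * x) @[x --> +oo] --> s * (pi / 2).
  case: hs => ->.
    by rewrite mul1r; under eq_fun do rewrite mul1r; exact: cvgy_atan.
  by rewrite mulN1r; under eq_fun do rewrite mulN1r atanN; apply: cvgN; exact: cvgy_atan.
have l1 : ln x - ln (1 + x ^+ 2) / 2 @[x --> +oo] --> (0 : R).
  have : - (ln (1 + x^-1 * x^-1) / 2) @[x --> +oo] --> - (ln (1 + 0 * 0) / 2 : R).
    apply: cvgN; apply: cvgM; last exact: cvg_cst.
    apply: continuous_cvg; first by apply: continuous_ln; rewrite mulr0 addr0.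
    apply: cvgD; first exact: cvg_cst.
    by apply: cvgM; exact: inv_pinfty.
  rewrite mulr0 addr0 ln1 mul0r oppr0; apply: cvg_trans; apply: near_eq_cvg; near=> x.
  have x0 : 0 < x by near: x; exact: nbhs_pinfty_gt.
  have x2 : 0 < x ^+ 2 by rewrite exprn_gt0.
  rewrite (_ : 1 + x ^+ 2 = x ^+ 2 * (1 + x^-1 * x^-1)); last by field; rewrite gt_eqF.
  rewrite lnM ?posrE // ?lnXn // ?ltr_wpDr // ?mulr_ge0 ?invr_ge0 ?(ltW x0) //.
  by rewrite -mulr_natl; field.
rewrite /cpow; under eq_fun do rewrite -cexpD; apply: cto_cexp.
have : cto +oo (fun x => z * (ln x - ln (1 + x ^+ 2) / 2)%:C - z * (cI * (atan (s * x))%:C))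
    (z * 0%:C - z * (cI * (s * (pi / 2))%:C)).
  apply: ctoB; apply: ctoM; try exact: cto_cst; first exact: cto_real.
  by apply: ctoM; [exact: cto_cst|exact: cto_real].
rewrite mulr0 sub0r -mulNr; apply: cto_ext => x.
by rewrite /Lr exprMn s2 mul1r realCB; ring.
Unshelve. all: end_near. Qed.

Lemma exh_1y : exh `]1 : R, +oo[ (fun n => 1 + n.+2%:R^-1) (fun n => 1 + n.+2%:R).
Proof.
have [h1 h2 h3 h4] := @exh_0y R; split.
- by move=> n; rewrite ltrD2l.
- by move=> n m nm; rewrite lerD2l h2.
- by move=> n m nm; rewrite lerD2l h3.
- move=> t; have := h4 (t - 1); rewrite /= !in_itv /= !andbT subr_gt0 => ->.
  by split => -[n hn]; exists n; move: hn; rewrite lerBrDl lerBlDl.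
Qed.

Lemma cint_0y_split (f : R -> R[i]) : cintegrable `]0, +oo[ f ->
  cintegral `]0, +oo[ f = cintegral `]0, 1[ f + cintegral `]1, +oo[ f.
Proof.
move=> fi; rewrite (cint_split mbl_0y mbl_01 _ fi); last first.
  by move=> t /=; rewrite !in_itv /= andbT => /andP[].
have -> : `]0, +oo[ `\` `]0, 1[ = `[1, +oo[%classic :> set R.
  apply/seteqP; split => t /=; rewrite !in_itv /= ?andbT.
    by move=> [t0 h]; rewrite leNgt; apply/negP => t1; apply: h; rewrite t0.
  move=> t1; split; first exact: lt_le_trans t1.
  by move=> /andP[_]; rewrite ltNge t1.
congr (_ + _).
have sub : (`]1, +oo[%classic : set R) `<=` `]0, +oo[%classic.
  by move=> t /=; rewrite !in_itv /= !andbT; exact: lt_trans.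
have [f1 f2] := cintegrable_sub mbl_0y (measurable_itv _) sub fi.
by apply: complex_eqP; rewrite ?cint_re ?cint_im Rintegral_itv_obnd_cbnd.
Qed.

Lemma bounded_cc (f : R -> R[i]) (p q : R) : p <= q -> Ck 0 `[p, q] f ->
  exists2 M : R, 0 <= M & forall t, p <= t <= q -> normc (f t) <= M.
Proof.
move=> pq cf; have [|c _ hc] := @EVT_max R (fun t => normc (f t)) p q pq.
  apply: continuous_in_subspaceT => t; rewrite inE => tpq; exact: cto_normc (cf t tpq).
exists (normc (f c)); first exact: normc_ge0.
by move=> t tpq; apply: hc; rewrite in_itv.
Qed.

(** Integrates the derivative from 0. The interval (-1/2, 3/2) is just an open neighbourhood of
    [0, 1] on which the weights (2 - u)^la are smooth. *)
Lemma normc_vanish_le (v : R -> R[i]) : Ck 1 `](- (1 / 2)), (3 / 2)[ v -> v 0 = 0 ->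
  exists2 M : R, 0 <= M & forall u, 0 < u < 1 -> normc (v u) <= M * u.
Proof.
move=> [g [vg cg]] v0; have cg' : Ck 0 `](- (1 / 2)), (3 / 2)[ g := cg.
have s01 p q : 0 <= p -> q <= 1 -> `[p, q]%classic `<=` (`](- (1 / 2)), (3 / 2)[%classic : set R).
  by move=> p0 q1 t /=; rewrite !in_itv /=; lra.
have [M M0 hM] := bounded_cc ler01 (Ck_sub (s01 0 1 (lexx _) (lexx _)) cg').
exists (2 * M); first by rewrite mulr_ge0.
move=> u /andP[u0 u1].
have cg0 : Ck 0 `[0, u] g by apply: Ck_sub cg'; apply: s01 => //; exact: ltW.
have e : cintegral `[0, u] g = v u.
  rewrite (@cftc_cc _ v g) ?v0 ?subr0 // => t tu; apply: vg.
  by apply: (s01 0 u (lexx _) (ltW u1)); rewrite /= in_itv.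
have Mi : rint `[0, u] (fun=> M) by apply: rint_cc => t _; exact: cvg_cst.
rewrite -e; apply: le_trans (normc_cint_le _ (cintegrable_cc cg0) Mi _) _ => //.
  have in0u t : `[0, u]%classic t -> 0 <= t <= u by rewrite /= in_itv.
  by move=> t /in0u tu; apply: hM; lra.
have -> : \int[mu]_(t in `[0, u]) M = M * u - M * 0.
  apply: (@ftc_cc _ (fun t => M * t) (fun=> M)) => //.
  - move=> t _; apply: is_derive_eq (is_deriveZ M (is_derive_id t 1)) _.
    by rewrite /GRing.scale /= mulr1.
  - by move=> t _; exact: cvg_cst.
by rewrite mulr0 subr0 mulrA.
Qed.

(** The phase is measured from u = 1, where the factor equals 1, so that boundary terms at that
    point do not oscillate. *)
Definition osc (s x u : R) : R[i] := cexp (cI * (s * x * (1 - u))%:C).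

Lemma RL_lin D p q h (s : R) : exh D p q -> Ck 1 D h -> cintegrable D h -> s != 0 ->
  cto +oo (fun x => cintegral D (fun u => h u * osc s x u)) 0.
Proof.
move=> e ch hi s0; have [g [hg cg]] := ch.
apply: (@riemann_lebesgue _ D p q h (fun u => -1 * g u) (fun u => -1 * h u) (fun u => 1 - u)
  (fun=> -1) s) => //.
- exact: Ck_pred.
- by move=> t Dt; apply: isdZ; exact: hg.
- exact: CkZ.
- by move=> t _; exact: is_derive_subl.
- by move=> t _; rewrite realCN; ring.
Qed.

Lemma normc_osc s x u : normc (osc s x u) = 1.
Proof. by rewrite /osc normc_cexp !ReImE /= mul0r mulr0 subrr expR0. Qed.

Lemma isd_osc s x u : isd (osc s x) u (- cI * (s * x)%:C * osc s x u).
Proof.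
have d := isd_real (is_deriveZ (s * x) (is_derive_subl 1 u)).
apply: isd_eq (isd_cexp (isdZ cI d)) _.
by rewrite /osc /GRing.scale /= mulrN1 realCN; ring.
Qed.

(* Integration by parts against the oscillating factor, then Riemann-Lebesgue. *)
Lemma osc_ibp D p q (h : R -> R[i]) (s : R) A B : exh D p q -> Ck 2 D h -> cintegrable D h ->
  (forall g, (forall u, D u -> isd h u (g u)) -> Ck 1 D g -> cintegrable D g) -> s != 0 ->
  (forall x, cto \oo (fun n => h (p n) * osc s x (p n)) (A x)) ->
  (forall x, cto \oo (fun n => h (q n) * osc s x (q n)) (B x)) ->
  cto +oo (fun x => (s * x)%:C * cintegral D (fun u => h u * osc s x u) -
    cI * (B x - A x)) 0.
Proof.
move=> e ch hi gi s0 hA hB; have mD := exh_meas e; have [g [hg cg]] := ch.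
have gI := gi g hg cg.
have oi (f : R -> R[i]) x : Ck 0 D f -> cintegrable D f -> cintegrable D (fun u => f u * osc s x u).
  move=> cf fi; apply: cintegrable_le (rint_normc mD fi) => //.
    by apply: cmeas_Ck => //; apply: CkM => // t _; exact: isd_cto (isd_osc s x t).
  by move=> t _; rewrite normcM normc_osc mulr1.
have ch0 : Ck 0 D h by apply: Ck_le ch.
have cg0 : Ck 0 D g by apply: Ck_pred.
have key x : (s * x)%:C * cintegral D (fun u => h u * osc s x u) - cI * (B x - A x) =
    - cI * cintegral D (fun u => g u * osc s x u).
  have i1 := oi g x cg0 gI; have i2 := oi h x ch0 hi.
  have i3 := cintegrableZ (- cI * (s * x)%:C) mD i2.
  have : cintegral D (fun u => g u * osc s x u + - cI * (s * x)%:C * (h u * osc s x u)) = B x - A x.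
    apply: (@cftc _ D p q (fun u => h u * osc s x u)) => //.
    - move=> t Dt; apply: isd_eq (isdM (hg t Dt) (isd_osc s x t)) _; ring.
    - by apply: CkD; [|apply: CkZ]; apply: CkM => // t _; exact: isd_cto (isd_osc s x t).
    - exact: cintegrableD.
  rewrite cintD // cintZ // => <-.
  set X := cintegral _ _; set Y := cintegral _ _; clearbody X Y.
  transitivity (- cI * Y + (s * x)%:C * X * (1 + cI * cI)); first by ring.
  by rewrite sqr_cI subrr mulr0 addr0.
have := ctoM (@cto_cst _ _ +oo _ (- cI)) (RL_lin e cg gI s0); rewrite mulr0 => H.
by apply: cto_ext (H _ _) => x; rewrite key.
Qed.

End LaplaceTransform.

(** * Oscillatory integrals with an algebraic singularity at one endpoint *)

Section Endpoint.
Context {R : realType}.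
Local Notation mu := (@lebesgue_measure R).
Local Notation mbl D := (@measurable _ (measurableTypeR R) D).
Implicit Types (t u x y r s : R) (z a b nu la : R[i]) (D : set R) (w : R -> R[i]).

(** Half of a Poisson integral in the variable u = 1 - v: since 1 - v^2 = u(2 - u), the singularity
    sits at u = 0 and the centre of the original interval at u = 1. *)
Definition edge la w s x : R[i] := cintegral `]0, 1[ (fun u => cpow u la * w u * osc s x u).

Lemma osc1 s x : osc s x 1 = 1 :> R[i].
Proof. by rewrite /osc subrr mulr0 mulr0 cexp0. Qed.

Lemma Ck_osc n D s x : Ck n D (osc s x).
Proof.
elim: n D => [|n IH] D; first by move=> t _; exact: isd_cto (isd_osc s x t).
exists (fun t => - cI * (s * x)%:C * osc s x t); split; first by move=> t _; exact: isd_osc.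
by apply: CkZ.
Qed.

Lemma seq01_oo : exh `]0 : R, 1[ (fun n => n.+3%:R^-1) (fun n => 1 - n.+3%:R^-1).
Proof.
have E n : (1 - 0) / n.+3%:R = n.+3%:R^-1 :> R by rewrite subr0 div1r.
have := exh_oo (@ltr01 R); under [X in exh _ X _]eq_fun do rewrite E add0r.
by under [X in exh _ _ X]eq_fun do rewrite E.
Qed.

Lemma inv_natS3_right : n.+3%:R^-1 @[n --> \oo] --> (0 : R)^'+.
Proof.
apply: seq_at_right => [n|]; first by rewrite invr_gt0.
by have := @inv_natS3 R 1; under eq_fun do rewrite div1r.
Qed.

Lemma inv_natS3_left : 1 - n.+3%:R^-1 @[n --> \oo] --> (1 : R)^'-.
Proof.
apply: seq_at_left => [n|]; first by rewrite gtrBl invr_gt0.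
rewrite -[X in _ --> X]subr0; apply: cvgB; first exact: cvg_cst.
by have := @inv_natS3 R 1; under eq_fun do rewrite div1r.
Qed.

Lemma osc_at0 la v s x : -1 < Re la -> Ck 3 `](- (1 / 2)), (3 / 2)[ v -> v 0 = 0 ->
  cto (0 : R)^'+ (fun u => cpow u la * v u * osc s x u) 0.
Proof.
move=> hl cv v0; have [M M0 hM] := normc_vanish_le (Ck_le (isT : (1 <= 3)%N) cv) v0.
have p1 : 0 < Re la + 1 by lra.
apply: (@cto0_le _ _ _ _ _ (fun u => M * u `^ (Re la + 1))); last first.
  rewrite -[X in _ --> X](mulr0 M); apply: cvgM; [exact: cvg_cst|exact: powR_cvg0].
near=> u; have u0 : 0 < u by near: u; exact: nbhs_right_gt.
have u1 : u < 1 by near: u; exact: nbhs_right_lt.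
rewrite normcM normc_osc mulr1 normcM normc_cpow // powRD ?(gt_eqF u0) ?implybT // powRr1 ?(ltW u0) //.
rewrite mulrCA ler_wpM2l ?powR_ge0 //; apply: hM; rewrite u0; exact: u1.
Unshelve. all: end_near. Qed.

Lemma rint_powR_Re01 la : -1 < Re la -> rint `]0, 1[ (fun t => t `^ Re la).
Proof.
move=> hl; have := @rint_powR01 R (Re la + 1); rewrite addrK; apply; lra.
Qed.

(* A boundary factor vanishing at 0 makes both u^la v and its derivative integrable. *)
Lemma edge_vanish la v s : -1 < Re la -> Ck 3 `](- (1 / 2)), (3 / 2)[ v -> v 0 = 0 ->
  s != 0 ->
  cto +oo (fun x => (s * x)%:C * edge la v s x - cI * v 1) 0.
Proof.
move=> hl cv v0 s0.
have sub : `]0, 1[%classic `<=` (`](- (1 / 2)), (3 / 2)[%classic : set R).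
  by move=> t /=; rewrite !in_itv /=; lra.
have [M M0 hM] := normc_vanish_le (Ck_le (isT : (1 <= 3)%N) cv) v0.
have [v' [dv cv']] := cv.
have cv1 : Ck 0 `[0, 1] v'.
  apply: (@Ck_sub _ _ `](- (1 / 2)), (3 / 2)[); last by apply: (@Ck_le _ 0 2).
  by move=> t /=; rewrite !in_itv /=; lra.
have [M' M'0 hM'] := bounded_cc ler01 cv1.
have pI := rint_powR_Re01 hl.
have pos t : `]0, 1[%classic t -> 0 < t by move=> /in01[].
have ch : Ck 3 `]0, 1[ (fun u => cpow u la * v u).
  by apply: CkM; [exact: Ck_cpow|exact: Ck_sub cv].
have hi : cintegrable `]0, 1[ (fun u => cpow u la * v u).
  apply: (cintegrable_le mbl_01 (cmeas_Ck mbl_01 (Ck_le (isT : (0 <= 3)%N) ch)) _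
    (rintZ M mbl_01 pI)) => t /in01[t0 t1].
  rewrite normcM normc_cpow // mulrC ler_wpM2r ?powR_ge0 //.
  apply: le_trans (hM t _) _; first by rewrite t0 -subr_gt0.
  by rewrite ler_piMr // -subr_ge0 ltW.
(* The derivative is la u^(la-1) v + u^la v'; as |v| <= M u, its first term is at most |la| M u^(Re
   la). *)
have gi g : (forall u, `]0, 1[%classic u -> isd (fun u => cpow u la * v u) u (g u)) ->
    Ck 1 `]0, 1[ g -> cintegrable `]0, 1[ g.
  move=> dg cg.
  apply: (cintegrable_le mbl_01 (cmeas_Ck mbl_01 (Ck_le (isT : (0 <= 1)%N) cg)) _
    (rintZ (normc la * M + M') mbl_01 pI)) => t Dt; have [t0 t1] := in01 Dt.
  have -> := isd_uniq (dg t Dt) (isdM (isd_cpow la t0) (dv t (sub t Dt))).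
  apply: le_trans (normcD _ _) _; rewrite mulrDl lerD //.
    rewrite cpowP // [X in normc X](_ : _ = la * cpow t la * (v t / t%:C)); last by ring.
    rewrite normcM [normc (la * _)]normcM normc_cpow // -!mulrA ler_wpM2l ?normc_ge0 //.
    rewrite mulrC ler_wpM2r ?powR_ge0 // -realCV normcM normc_real ger0_norm ?invr_ge0 ?(ltW t0) //.
    by rewrite ler_pdivrMr //; apply: hM; rewrite t0 -subr_gt0.
  rewrite normcM normc_cpow // mulrC ler_wpM2r ?powR_ge0 //; apply: hM'.
  by rewrite (ltW t0) -subr_ge0 ltW.
have c1 : cto (nbhs (1 : R)) (fun u => cpow u la * v u) (v 1).
  have e1 : v 1 = cpow 1 la * v 1 by rewrite cpow1l mul1r.
  rewrite [X in cto _ _ X]e1; apply: ctoM.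
    exact: isd_cto (isd_cpow la ltr01).
  apply: (Ck_cont cv); rewrite /= in_itv /=; lra.
have := osc_ibp (s := s) (A := fun=> 0) (B := fun=> v 1) seq01_oo (Ck_le (isT : (2 <= 3)%N) ch) hi gi s0.
rewrite subr0; apply.
- move=> x; apply: (@cto_comp _ _ _ _ _ _ _ _ inv_natS3_right (osc_at0 s x hl cv v0)).
- move=> x; apply: (@cto_comp _ _ _ _ _ _ (fun u => cpow u la * v u * osc s x u) _ inv_natS3_left).
  apply: cto_at_left; rewrite -[v 1]mulr1; have <- := osc1 s x; apply: ctoM => //.
  exact: isd_cto (isd_osc s x 1).
Qed.

(** Beyond u = 1 the model integrand has no singularity and decays exponentially, so integration by
    parts leaves only the boundary value e^(-1) at u = 1. *)
Lemma osc_tail la s : -1 < Re la -> s != 0 ->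
  cto +oo (fun x => (s * x)%:C * cintegral `]1, +oo[ (fun u => egam (la + 1) 1 u * osc s x u)
    + cI * cexp (- 1)) 0.
Proof.
move=> hl s0; have p1 : 0 < Re (la + 1) by rewrite ReD /=; lra.
have R1 : 0 < Re (1 : R[i]) by [].
have sub : (`]1, +oo[%classic : set R) `<=` `]0, +oo[%classic.
  by move=> t /=; rewrite !in_itv /= !andbT; exact: lt_trans.
have in1 t : (`]1, +oo[%classic : set R) t -> 1 < t by rewrite /= in_itv /= andbT.
have m1 : mbl `]1, +oo[ by exact: measurable_itv.
have hi := cintegrable_sub mbl_0y m1 sub (egam_int p1 R1).
have ch n : Ck n `]1, +oo[ (egam (la + 1) (1 : R[i])) by apply: Ck_sub sub _; exact: Ck_egam.
have gi g : (forall u, (`]1, +oo[%classic : set R) u -> isd (egam (la + 1) 1) u (g u)) ->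
    Ck 1 `]1, +oo[ g -> cintegrable `]1, +oo[ g.
  move=> dg cg.
  apply: (cintegrable_le m1 (cmeas_Ck m1 (Ck_le (isT : (0 <= 1)%N) cg)) _
    (rintZ (normc la + 1) m1 (rint_normc m1 hi))) => t Dt; have t1 := in1 t Dt.
  have t0 : 0 < t by apply: lt_trans t1.
  have -> := isd_uniq (dg t Dt) (isdM (isd_cpow (la + 1 - 1) t0) (isd_cexpN 1 t)).
  rewrite /egam addrK cpowP // [X in normc X](_ : _ =
    (la / t%:C - 1) * (cpow t la * cexp (- (1 * t%:C)))); last by ring.
  rewrite normcM ler_wpM2r ?normc_ge0 //; apply: le_trans (normcB _ _) _.
  rewrite normc_real normr1 lerD2r -realCV normcM normc_real ger0_norm ?invr_ge0 ?(ltW t0) //.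
  by rewrite ler_piMr ?normc_ge0 // invf_le1 // ltW.
have := osc_ibp (s := s) (A := fun=> cexp (- 1)) (B := fun=> 0) exh_1y (ch 2) hi gi s0.
under eq_fun do rewrite sub0r mulrN opprK; apply.
- move=> x; apply: (@cto_comp _ _ _ _ (nbhs (1 : R)) (fun n => 1 + n.+2%:R^-1)
    (fun u => egam (la + 1) 1 u * osc s x u)).
    have h : 1 + n.+2%:R^-1 @[n --> \oo] --> (1 + 0 : R).
      apply: cvgD; first exact: cvg_cst.
      by apply: cvg_trans (@inv_natS2 R) _; exact: cvg_within.
    by rewrite addr0 in h.
  have e : egam (la + 1) 1 1 * osc s x 1 = cexp (- 1) :> R[i].
    by rewrite osc1 /egam cpow1l mul1r !mulr1.
  rewrite -e; apply: ctoM; last exact: isd_cto (isd_osc s x 1).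
  by apply: (Ck_cont (Ck_egam 0 _ _)); rewrite /= in_itv /= ltr01.
- move=> x; apply: (@cto_comp _ _ _ _ +oo (fun n => 1 + n.+2%:R)
    (fun u => egam (la + 1) 1 u * osc s x u)).
    apply/cvgryPge => B; have /cvgryPge/(_ B) H := @natS2_infty R; near=> n.
    by rewrite ler_wpDl //; near: n.
  apply: (@cto0_le _ _ _ _ _ (fun t => t `^ Re (la + 1) * expR (- (Re 1 * t)))); last exact: powR_exp_to0.
  near=> t; have t1 : 1 <= t by near: t; exact: nbhs_pinfty_ge.
  have t0 : 0 < t by apply: lt_le_trans t1.
  rewrite normcM normc_osc mulr1 normc_egam // ler_wpM2r ?expR_ge0 //.
  by rewrite ler_powR // gerBl.
Unshelve. all: end_near. Qed.

(* Replacing w by w(0) e^(-u) on (0, +oo) only costs a boundary term at u = 1. *)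
Lemma endpoint la w s : -1 < Re la -> Ck 3 `](- (1 / 2)), (3 / 2)[ w -> s != 0 ->
  cto +oo (fun x => (s * x)%:C *
    (edge la w s x - w 0 * (cexp (cI * (s * x)%:C) * laplace (la + 1) (wr (s * x))))) (cI * w 1).
Proof.
move=> hl cw s0; set c := w 0; have p1 : 0 < Re (la + 1) by rewrite ReD /=; lra.
have R1 : 0 < Re (1 : R[i]) by [].
(* As e^(-u) is 1 at u = 0, [v] vanishes there and [edge_vanish] applies. *)
pose v u := w u - c * cexp (- (1 * u%:C)).
have cv : Ck 3 `](- (1 / 2)), (3 / 2)[ v.
  by apply: CkB => //; apply: CkZ; exact: Ck_cexpN.
have v0 : v 0 = 0 by rewrite /v mulr0 oppr0 cexp0 mulr1 subrr.
have h1 := edge_vanish hl cv v0 s0; have h2 := osc_tail hl s0.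
have oi D (f : R -> R[i]) x : mbl D -> Ck 0 D f -> cintegrable D f ->
    cintegrable D (fun u => f u * osc s x u).
  move=> mD cf fi; apply: cintegrable_le (rint_normc mD fi) => //.
    by apply: cmeas_Ck => //; apply: CkM => //; exact: Ck_osc.
  by move=> t _; rewrite normcM normc_osc mulr1.
have key x : edge la w s x - c * (cexp (cI * (s * x)%:C) * laplace (la + 1) (wr (s * x))) =
    edge la v s x - c * cintegral `]1, +oo[ (fun u => egam (la + 1) 1 u * osc s x u).
  have eg := oi (`]0, +oo[%classic : set R) (egam (la + 1) 1) x mbl_0y (Ck_egam 0 _ _) (egam_int p1 R1).
  (* The phase isx(1 - u) and e^(-u) combine into e^(isx) e^(-(1+isx)u), so the model integral is a
     Laplace integral. *)
  have -> : cexp (cI * (s * x)%:C) * laplace (la + 1) (wr (s * x)) =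
      cintegral `]0, +oo[ (fun u => egam (la + 1) 1 u * osc s x u).
    rewrite /laplace -cintZ //; last by apply: egam_int => //; rewrite Re_wr.
    apply: cint_ext => t _; rewrite /egam /osc /wr mulrCA -mulrA; congr (_ * _).
    rewrite -!cexpD; congr cexp.
    by rewrite !realCM realCB; ring.
  rewrite cint_0y_split // mulrDr opprD addrA; congr (_ - _).
  have sub : (`]0, 1[%classic : set R) `<=` `]0, +oo[%classic.
    by move=> t /=; rewrite !in_itv /= andbT => /andP[].
  have eg1 := cintegrable_sub mbl_0y mbl_01 sub eg.
  have vi : cintegrable `]0, 1[ (fun u => cpow u la * w u * osc s x u).
    have cw1 : Ck 0 `[0, 1] w.
      apply: (@Ck_sub _ _ `](- (1 / 2)), (3 / 2)[); last by apply: (@Ck_le _ 0 3).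
      by move=> t /=; rewrite !in_itv /=; lra.
    have [M M0 hM] := bounded_cc ler01 cw1.
    apply: (cintegrable_le mbl_01 _ _ (rintZ M mbl_01 (rint_powR_Re01 hl))).
      apply: cmeas_Ck => //; apply: CkM; last exact: Ck_osc.
      apply: CkM; first by apply: Ck_cpow => t /in01[].
      by apply: Ck_sub cw1 => t /=; rewrite !in_itv /=; lra.
    move=> t /in01[t0 t1]; rewrite normcM normc_osc mulr1 normcM normc_cpow // mulrC ler_wpM2r ?powR_ge0 //.
    by apply: hM; lra.
  rewrite -cintZ // /edge -cintB //; last exact: cintegrableZ.
  by apply: cint_ext => t _; rewrite /v /egam addrK; ring.
(* The boundary terms i v(1) and i c e^(-1) add up to i w(1): the model function drops out. *)
have := ctoD (ctoB h1 (ctoM (@cto_cst _ _ +oo _ c) h2)) (@cto_cst _ _ +oo _ (cI * w 1)).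
rewrite mulr0 subr0 add0r => H; apply: cto_ext (H _ _ _ _ _) => x; rewrite key /v mul1r.
by set I1 := edge _ _ _ _; set I2 := cintegral _ _; ring.
Qed.

End Endpoint.

(** * Reflection and quadratic substitution on the unit interval *)

Section Reflection.
Context {R : realType}.
Local Notation mu := (@lebesgue_measure R).
Implicit Types (t u x y r s : R) (f : R -> R[i]).

Lemma Ck0_onem f : Ck 0 `]0, 1[ f -> Ck 0 `]0, 1[ (fun t => f (1 - t)).
Proof.
move=> cf t Dt; apply: (@cto_comp _ _ _ (nbhs t) (nbhs (1 - t)) (fun t => 1 - t)).
  by apply: cvgB; [exact: cvg_cst|exact: cvg_id].
by apply: cf; move: Dt; rewrite /= !in_itv /=; lra.
Qed.

Lemma rint_onem (h : R -> R) (c : R) : 0 < c < 1 / 2 ->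
  (forall t, 0 < t < 1 -> {for t, continuous h}) ->
  \int[mu]_(t in `[c, 1 - c]) h (1 - t) = \int[mu]_(t in `[c, 1 - c]) h t.
Proof.
move=> hc ch; transitivity (\int[mu]_(t in `[- (1 - c), - c]) h (1 + t)).
  rewrite /Rintegral (@integration_by_substitution_oppr R (fun t => h (1 + t)) c (1 - c)) //; first lra.
  apply: continuous_in_subspaceT => t; rewrite inE /= in_itv /= => tc.
  apply: (continuous_comp (f := fun t => 1 + t)); last by apply: ch; lra.
  exact: is_derive_cont (is_derive_addl 1 t).
have := @rsub_cc R setT (fun t => 1 + t) (fun=> 1) h (- (1 - c)) (- c) openT.
rewrite (_ : 1 + - (1 - c) = c); last by ring.
move=> H; apply/esym; apply: etrans.
  apply: H => //.
  - lra.
  - by move=> t _; exact: is_derive_addl.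
  - by move=> t _; exact: cvg_cst.
  - by move=> t tc; apply: ch; lra.
by apply: eq_Rintegral => t _; rewrite mul1r.
Qed.

Lemma cint_onem f : Ck 0 `]0, 1[ f -> cintegrable `]0, 1[ f ->
  cintegrable `]0, 1[ (fun t => f (1 - t)) /\
  cintegral `]0, 1[ (fun t => f (1 - t)) = cintegral `]0, 1[ f.
Proof.
move=> cf fi; have e := @seq01_oo R; have cg := Ck0_onem cf.
have c0 n : 0 < (n.+3%:R^-1 : R) < 1 / 2.
  by rewrite invr_gt0 ltr0n /= div1r ltf_pV2 ?posrE ?ltr0n // ltr_nat.
have in' t : 0 < t < 1 -> `]0, 1[%classic t by rewrite /= in_itv.
have ni := rint_normc mbl_01 fi.
have gi : cintegrable `]0, 1[ (fun t => f (1 - t)).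
  apply: (@cintegrable_le _ _ _ (fun t => normc (f (1 - t)))) => //; first exact: cmeas_Ck.
  apply: (@rint_exh _ _ _ _ _ (\int[mu]_(t in `]0, 1[) normc (f t)) e).
  - by move=> t Dt; exact: cto_normc (cg t Dt).
  - by move=> t _; exact: normc_ge0.
  - move=> n; rewrite (@rint_onem (fun t => normc (f t))) //.
      apply: Rintegral_subset => //; first exact: exh_sub e.
      by move=> t _; exact: normc_ge0.
    by move=> t /in' Dt; exact: cto_normc (cf t Dt).
split => //; apply: (@cto_uniq _ _ \oo _ _ _ _ (cint_exh e gi)).
apply: cto_ext (cint_exh e fi) => n; apply: complex_eqP; rewrite ?cint_re ?cint_im.
- by rewrite -(@rint_onem (fun t => Re (f t))) // => t /in' Dt; case: (cf t Dt).
- by rewrite -(@rint_onem (fun t => Im (f t))) // => t /in' Dt; case: (cf t Dt).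
Qed.

Lemma cint_sqr f : Ck 0 `]0, 1[ f -> cintegrable `]0, 1[ f ->
  cintegrable `]0, 1[ (fun s => (2 * s)%:C * f (s ^+ 2)) /\
  cintegral `]0, 1[ (fun s => (2 * s)%:C * f (s ^+ 2)) = cintegral `]0, 1[ f.
Proof.
move=> cf fi.
have sq01 s : `]0, 1[%classic s -> `]0, 1[%classic (s ^+ 2).
  rewrite /= !in_itv /= => /andP[s0 s1]; rewrite exprn_gt0 //= expr_lt1 ?(ltW s0) //.
apply: (@cint_subst _ _ _ _ _ (fun s => s ^+ 2) (fun s => 2 * s) f _ _ (@seq01_oo R)) => //.
- apply: (exh_image (F := fun s => s ^+ 2) (G := Num.sqrt) (@seq01_oo R)) => //.
  + by move=> s u /in01[s0 _] /in01[u0 _] su; rewrite ltr_pXn2r ?nnegrE ?(ltW s0) ?(ltW u0).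
  + move=> t Dt; have [t0 t1] := in01 Dt; rewrite sqr_sqrtr ?(ltW t0) //; split => //.
    by rewrite /= in_itv /= sqrtr_gt0 t0 -sqrtr1 ltr_sqrt // -subr_gt0.
  + by move=> u v t; rewrite /= !in_itv /=; lra.
- move=> t _; change (is_derive t 1 (fun s => s * s) (2 * t)).
  apply: is_derive_eq (is_deriveM (is_derive_id t 1) (is_derive_id t 1)) _.
  by rewrite /GRing.scale /= !mulr1; ring.
- by move=> t _; apply: cvgM; [exact: cvg_cst|exact: cvg_id].
- by move=> t /in01[t0 _]; rewrite mulr_gt0.
Qed.

End Reflection.

(** * Poisson's integrals and the leading term of the Bessel functions *)

Section BesselAsymptotics.
Context {R : realType}.
Local Notation mu := (@lebesgue_measure R).
Implicit Types (t u x y r s : R) (z a b nu la k m : R[i]) (w : R -> R[i]).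

(** Weights of the cosine and the sine form: (2 - u)^la comes from 1 - (1-u)^2 = u(2-u), and the
    extra factor 1 - u in [w2] is what remains of the powers of 1 - u when Sonine's integral is
    taken at order 1/2. *)
Definition w1 la u : R[i] := cpow (2 - u) la.
Definition w2 la u : R[i] := (1 - u)%:C * cpow (2 - u) la.

Lemma Ck_w1 n la : Ck n `](- (1 / 2)), (3 / 2)[ (w1 la).
Proof. by apply: Ck_cpowr => t; rewrite /= in_itv /=; lra. Qed.

Lemma Ck_w2 n la : Ck n `](- (1 / 2)), (3 / 2)[ (w2 la).
Proof.
apply: CkM; last exact: Ck_w1.
apply: (@Ck_near _ _ _ (fun u => 1 - u%:C)); first exact: interval_open.
  by move=> t _; rewrite realCB.
by apply: CkB; [exact: Ck_cst|exact: Ck_real_id].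
Qed.

Definition ep la x : R[i] := cexp (cI * (x%:C - (la + 1) * (pi / 2)%:C)).
Definition em la x : R[i] := cexp (- (cI * (x%:C - (la + 1) * (pi / 2)%:C))).

Lemma cto_cpow_inv z : Re z < 0 -> cto +oo (fun x => cpow x z) 0.
Proof.
move=> hz; apply: (@cto0_le _ _ _ _ _ (fun x => x^-1 `^ (- Re z))).
  near=> x; have x0 : 0 < x by near: x; exact: nbhs_pinfty_gt.
  by rewrite normc_cpow // !powRE ?invr_gt0 // lnV ?posrE // mulrNN.
apply: (@cvg_comp _ _ _ (fun x => x^-1) (fun y => y `^ (- Re z)) +oo (0 : R)^'+); last first.
  by apply: powR_cvg0; rewrite oppr_gt0.
have h := @inv_pinfty R; move=> P [e e0 He].
have /cvgrPdist_lt/(_ e e0) hh := h.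
suff H : \forall x \near +oo, P x^-1 by [].
near=> x; apply: He => /=.
  by near: x; exact: hh.
by rewrite invr_gt0; near: x; exact: nbhs_pinfty_gt.
Unshelve. all: end_near. Qed.

(** By [laplace_val] the difference is Gamma(la+1) e^(isx), of constant modulus, times an expression
    that tends to 0 by [Lr_lim]. *)
Lemma edge_main la w s : s = 1 \/ s = -1 -> -1 < Re la -> Re la <= 0 ->
  Ck 3 `](- (1 / 2)), (3 / 2)[ w ->
  cto +oo (fun x => cpow x (la + 1) * (cexp (cI * (s * x)%:C) * laplace (la + 1) (wr (s * x)))
    - Gamma (la + 1) * cexp (s%:C * (cI * (x%:C - (la + 1) * (pi / 2)%:C)))) 0.
Proof.
move=> hs hl hl0 cw; have p1 : 0 < Re (la + 1) by rewrite ReD /=; lra.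
have h := Lr_lim (la + 1) hs.
have h' := ctoB h (@cto_cst _ _ +oo _ (cexp (- (la + 1) * (cI * (s * (pi / 2))%:C)))).
rewrite subrr in h'.
have h2 : cto +oo (fun x => Gamma (la + 1) * cexp (cI * (s * x)%:C) *
   (cpow x (la + 1) * cexp (- (la + 1) * Lr (s * x)) - cexp (- (la + 1) * (cI * (s * (pi / 2))%:C)))) 0.
  apply: (@cto0_bnd _ _ _ _ _ _ (normc (Gamma (la + 1)))); last exact: h'.
  near=> x; rewrite normcM [normc (cexp _)]normc_cexp !ReImE /= mul0r mulr0 subrr expR0 mulr1 //.
apply: cto_ext h2 => x; rewrite laplace_val // mulrBr; congr (_ - _).
  set G := Gamma _; set c1 := cexp _; set c2 := cpow _ _; set c3 := cexp _.
  by clearbody G c1 c2 c3; ring.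
by rewrite -mulrA -cexpD; congr (_ * cexp _); rewrite !realCM; ring.
Unshelve. all: end_near. Qed.

(** The artificial endpoint u = 1 contributes i w(1)/x for s = 1 and -i w(1)/x for s = -1; the
    hypothesis on [k] makes the combination cancel. The rest is o(1/x), and x^(la+1) times it is
    x^la o(1), with x^la bounded because Re la <= 0. *)
Lemma edge_asym la w k : -1 < Re la -> Re la <= 0 -> Ck 3 `](- (1 / 2)), (3 / 2)[ w ->
  w 1 * (1 - k) = 0 ->
  cto +oo (fun x => cpow x (la + 1) * (edge la w 1 x + k * edge la w (-1) x)
    - w 0 * Gamma (la + 1) * (ep la x + k * em la x)) 0.
Proof.
move=> hl hl0 cw w10; set c := w 0.
pose T s x := cexp (cI * (s * x)%:C) * laplace (la + 1) (wr (s * x)).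
have e1 := endpoint hl cw (oner_neq0 R).
have e2 : cto +oo (fun x => (-1 * x)%:C * (edge la w (-1) x - c * T (-1) x)) (cI * w 1).
  by apply: endpoint => //; rewrite oppr_eq0 oner_neq0.
have e3 : cto +oo (fun x => x%:C * ((edge la w 1 x - c * T 1 x) + k * (edge la w (-1) x - c * T (-1) x))) 0.
  have := ctoB e1 (ctoM (@cto_cst _ _ +oo _ k) e2).
  rewrite (_ : cI * w 1 - k * (cI * w 1) = cI * (w 1 * (1 - k))); last by ring.
  rewrite w10 mulr0 => H; apply: cto_ext (H _ _ _) => x.
  by rewrite -/c -/(T 1 x) mul1r mulN1r realCN; ring.
have e4 : cto +oo (fun x => cpow x la *
   (x%:C * ((edge la w 1 x - c * T 1 x) + k * (edge la w (-1) x - c * T (-1) x)))) 0.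
  apply: (@cto0_bnd _ _ _ _ _ _ 1) => //.
  near=> x; have x1 : 1 <= x by near: x; exact: nbhs_pinfty_ge.
  rewrite normc_cpow ?(lt_le_trans ltr01 x1) // -(powRr0 x) ler_powR //.
have m1 := edge_main (or_introl (erefl (1 : R))) hl hl0 cw.
have m2 := edge_main (or_intror (erefl (-1 : R))) hl hl0 cw.
have := ctoD e4 (ctoM (@cto_cst _ _ +oo _ c) (ctoD m1 (ctoM (@cto_cst _ _ +oo _ k) m2))).
rewrite !mulr0 !addr0 mulr0 addr0 => H; apply: cto_near (H _ _ _ _ _ _); near=> x.
have x0 : 0 < x by near: x; exact: nbhs_pinfty_gt.
rewrite -/(T 1 x) -/(T (-1) x) cpowS // /ep /em (realCN 1) mulN1r mul1r.
by ring.
Unshelve. all: end_near. Qed.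

Lemma Re_half : Re (1 / 2 : R[i]) = 1 / 2.
Proof.
have -> : 1 / 2 = (1 / 2 : R)%:C; last by [].
by rewrite !div1r realCV -(natC 2).
Qed.

Lemma Re_Nhalf : Re (- (1 / 2) : R[i]) = - (1 / 2).
Proof. by rewrite ReN Re_half. Qed.

(** Differentiates the cosine formula [bj_Nhalf], as the derivative of [bj] lowers to minus the
    function of next order. *)
Lemma bj_half x : 0 < x -> bj (1 / 2) (x ^+ 2 / 4) = 2 * (sin x)%:C / (x%:C * cpow pi (1 / 2)).
Proof.
move=> x0; have hm : -1 < Re (- (1 / 2) : R[i]).
  by rewrite Re_Nhalf; lra.
have d0 : is_derive x 1 (fun u : R => u ^+ 2 / 4) (x / 2).
  have d : is_derive x 1 (fun u : R => 4^-1 * (u * u)) (x / 2).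
    apply: is_derive_eq (is_deriveZ 4^-1 (is_deriveM (is_derive_id x 1) (is_derive_id x 1))) _.
    by rewrite /GRing.scale /= !mulr1; field.
  by have -> : (fun u : R => u ^+ 2 / 4) = (fun u => 4^-1 * (u * u));
    first by apply/funext => u; rewrite mulrC.
have d1 := isd_comp d0 (isd_bj (x ^+ 2 / 4) hm).
have d2 := isdZ (cpow pi (1 / 2))^-1 (isd_real (is_derive_cos x)).
have d3 : isd (fun u => bj (- (1 / 2)) (u ^+ 2 / 4)) x ((cpow pi (1 / 2))^-1 * (- sin x)%:C).
  by apply: isd_ext d2 => u; rewrite bj_Nhalf mulrC.
have e := isd_uniq d1 d3.
have h : - (1 / 2) + 1 = 1 / 2 :> R[i].
  by field.
rewrite h in e.
have xn : x%:C != 0 by rewrite realC_eq0 gt_eqF.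
have pn : cpow pi (1 / 2) != 0 :> R[i] by exact: cpow_neq0.
have e' : x%:C * bj (1 / 2) (x ^+ 2 / 4) = 2 * ((cpow pi (1 / 2))^-1 * (sin x)%:C).
  have -> : x%:C = 2 * (x / 2)%:C :> R[i].
    by rewrite (natC 2) -realCM; congr (_ %:C); field.
  rewrite -mulrA; congr (_ * _); apply: oppr_inj; rewrite -mulrN e realCN mulrN //.
apply: (mulfI xn); rewrite e'; move: (cpow _ _) pn => P pn; move: (sin x)%:C x%:C xn => S X xn.
by field; rewrite xn pn.
Qed.

Lemma ccosE z : ccos z = (cexp (cI * z) + cexp (- (cI * z))) / 2.
Proof. by []. Qed.

Lemma cexp_cI y : cexp (cI * y%:C) = (cos y)%:C + cI * (sin y)%:C.
Proof.
have r0 : Re (cI * y%:C) = 0 by rewrite !ReImE /= mul0r mulr0 subrr.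
have i0 : Im (cI * y%:C) = y by rewrite !ReImE /= mul0r mul1r add0r.
by rewrite /cexp r0 i0 expR0 mul1r; apply: complex_eqP;
  rewrite !ReImE /= ?(mul0r, mul1r, mulr0, subr0, addr0, add0r).
Qed.

Lemma ReB z a : Re (z - a) = Re z - Re a.
Proof. by rewrite ReD ReN. Qed.

Lemma realC_half x : (x / 2)%:C = x%:C / 2 :> R[i].
Proof. by rewrite realCM realCV -natC. Qed.

Lemma realC_qsqr x : (x ^+ 2 / 4)%:C = x%:C ^+ 2 / 4 :> R[i].
Proof. by rewrite (realCM (x ^+ 2)) realCX realCV -natC. Qed.

Lemma realC_quart x : (x / 4)%:C = (x / 2)%:C / 2 :> R[i].
Proof. by rewrite -realC_half; congr (_ %:C); field. Qed.

Lemma edge_int la w s x : -1 < Re la -> Ck 0 `[0, 1] w ->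
  cintegrable `]0, 1[ (fun u => cpow u la * w u * osc s x u).
Proof.
move=> hl cw; have [M M0 hM] := bounded_cc ler01 cw.
apply: (cintegrable_le mbl_01 _ _ (rintZ M mbl_01 (rint_powR_Re01 hl))).
  apply: cmeas_Ck => //; apply: CkM; last exact: Ck_osc.
  apply: CkM; first by apply: Ck_cpow => t /in01[].
  by apply: Ck_sub cw => t /=; rewrite !in_itv /=; lra.
move=> t /in01[t0 t1]; rewrite normcM normc_osc mulr1 normcM normc_cpow // mulrC ler_wpM2r ?powR_ge0 //.
by apply: hM; lra.
Qed.

Lemma Ck_sonine n nu la y : -1 < Re nu ->
  Ck n `]0, 1[ (fun t => betaf (nu + 1) (la + 1) t * bj nu (y * t)).
Proof.
move=> hn; apply: CkM; first exact: Ck_betaf.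
elim: n nu hn => [|n IH] nu hn.
  by move=> t _; apply: isd_cto (isd_comp (is_deriveZ y (is_derive_id t 1)) (isd_bj _ hn)).
exists (fun t => - y%:C * bj (nu + 1) (y * t)); split; last by apply/CkZ/IH/Re_nu1.
move=> t _; apply: isd_eq (isd_comp (is_deriveZ y (is_derive_id t 1)) (isd_bj _ hn)) _.
by rewrite /GRing.scale /= mulr1 mulrN mulNr.
Qed.

(** Sonine's integral after t = (1 - u)^2, which turns sqrt t into the linear phase of [osc]. *)
Lemma sonine_unit nu la x : -1 < Re nu -> -1 < Re la ->
  cintegral `]0, 1[ (fun u => (2 * (1 - u))%:C *
    (cpow ((1 - u) ^+ 2) nu * cpow (1 - (1 - u) ^+ 2) la * bj nu (x ^+ 2 / 4 * (1 - u) ^+ 2))) =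
  Gamma (la + 1) * bj (nu + la + 1) (x ^+ 2 / 4).
Proof.
move=> hn hl; have [fi <-] := sonine (x ^+ 2 / 4) hn hl.
have cf := Ck_sonine 0 la (x ^+ 2 / 4) hn.
have [gi <-] := cint_sqr cf fi.
have cg : Ck 0 `]0, 1[ (fun s => (2 * s)%:C *
    (betaf (nu + 1) (la + 1) (s ^+ 2) * bj nu (x ^+ 2 / 4 * s ^+ 2))).
  apply: CkM.
    by move=> t _; apply: cto_real; apply: cvgM; [exact: cvg_cst|exact: cvg_id].
  move=> t Dt; apply: (@cto_comp _ _ _ (nbhs t) (nbhs (t ^+ 2)) (fun t => t ^+ 2)
    (fun t => betaf (nu + 1) (la + 1) t * bj nu (x ^+ 2 / 4 * t))).
    exact: exprn_continuous.
  apply: cf; have [t0 t1] := in01 Dt; rewrite /= in_itv /= exprn_gt0 //= expr_lt1 ?(ltW t0) //.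
  by rewrite -subr_gt0.
have [_ <-] := cint_onem cg gi.
by apply: cint_ext => t _; rewrite /betaf !addrK.
Qed.

Lemma osc_cos x u : osc 1 x u + osc (-1) x u = 2 * (cos (x * (1 - u)))%:C.
Proof.
rewrite /osc mul1r ?mulN1r mulNr; move: (x * (1 - u)) => y.
by rewrite !cexp_cI sinN cosN realCN; ring.
Qed.

Lemma osc_sin x u : osc 1 x u + -1 * osc (-1) x u = 2 * cI * (sin (x * (1 - u)))%:C.
Proof.
rewrite /osc mul1r ?mulN1r mulNr; move: (x * (1 - u)) => y.
by rewrite !cexp_cI sinN cosN realCN; ring.
Qed.

Lemma cc01 (f : R -> R[i]) : Ck 3 `](- (1 / 2)), (3 / 2)[ f -> Ck 0 `[0, 1] f.
Proof.
move=> cf; apply: (@Ck_sub _ _ `](- (1 / 2)), (3 / 2)[); last exact: (@Ck_le _ 0 3) cf.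
by move=> t /=; rewrite !in_itv /=; lra.
Qed.

Lemma onemsq u : 1 - (1 - u) ^+ 2 = u * (2 - u).
Proof. by ring. Qed.

(* Poisson's integral: Sonine's integral with nu = -1/2, where bj is a cosine. *)
Lemma poisson1 la x : -1 < Re la ->
  Gamma (la + 1) * bj (la + 1 / 2) (x ^+ 2 / 4) =
  (cpow pi (1 / 2))^-1 * (edge la (w1 la) 1 x + 1 * edge la (w1 la) (-1) x).
Proof.
move=> hl; have hn : -1 < Re (- (1 / 2) : R[i]) by rewrite Re_Nhalf; lra.
have e : - (1 / 2) + la + 1 = la + 1 / 2 by field.
have := sonine_unit x hn hl; rewrite e => <-.
have i1 := edge_int 1 x hl (cc01 (@Ck_w1 3 la)).
have i2 := edge_int (-1) x hl (cc01 (@Ck_w1 3 la)).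
rewrite [1 * edge _ _ _ _]mul1r /edge -cintD // -cintZ //; last exact: cintegrableD.
apply: cint_ext => u /in01[u0 u1].
have u2 : 0 < 2 - u by lra.
rewrite onemsq cpowM // -[in RHS]mulrDr osc_cos.
have -> : x ^+ 2 / 4 * (1 - u) ^+ 2 = (x * (1 - u)) ^+ 2 / 4 by field.
rewrite bj_Nhalf cpow_sqr // (_ : 2%:R * - (1 / 2) = - 1); last by field.
rewrite cpowN cpow1 // /w1 realCM -(natC 2).
have vn : (1 - u)%:C != 0 by rewrite realC_eq0 gt_eqF.
move: (cpow u la) (cpow (2 - u) la) (cos _)%:C (1 - u)%:C vn (@cpow_neq0 R pi (1 / 2)) => A B C V vn.
move: (cpow pi _) => P pn.
by field; rewrite vn pn.
Qed.

(** Sonine's integral with nu = 1/2, where [bj] is a sine over its argument. It raises the order by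
    1 over [poisson1] for the same [la]. *)
Lemma poisson2 la x : -1 < Re la -> 0 < x ->
  x%:C * (Gamma (la + 1) * bj (la + 3%:R / 2) (x ^+ 2 / 4)) =
  2 / (cpow pi (1 / 2) * cI) * (edge la (w2 la) 1 x + -1 * edge la (w2 la) (-1) x).
Proof.
move=> hl x0; have hn : -1 < Re (1 / 2 : R[i]) by rewrite Re_half; lra.
have e : 1 / 2 + la + 1 = la + 3%:R / 2 by field.
have := sonine_unit x hn hl; rewrite e => <-.
have i1 := edge_int 1 x hl (cc01 (@Ck_w2 3 la)).
have i2 := edge_int (-1) x hl (cc01 (@Ck_w2 3 la)).
have i3 := cintegrableZ (-1) mbl_01 i2.
have xn : x%:C != 0 by rewrite realC_eq0 gt_eqF.
have cn : cI != 0 :> R[i] by rewrite -normc_eq0 normc_cI oner_eq0.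
rewrite /edge -(cintZ (-1)) // -cintD //.
rewrite -[RHS](mulVKf xn); congr (_ * _); rewrite mulrA -cintZ //; last exact: cintegrableD.
apply: cint_ext => u /in01[u0 u1].
have u2 : 0 < 2 - u by lra.
rewrite onemsq cpowM //.
have -> : x ^+ 2 / 4 * (1 - u) ^+ 2 = (x * (1 - u)) ^+ 2 / 4 by field.
rewrite bj_half ?mulr_gt0 // cpow_sqr // (_ : 2%:R * (1 / 2) = 1); last by field.
have := osc_sin x u; move: (osc 1 x u) (osc (-1) x u) => o1 o2 ho.
rewrite cpow1 // /w2 !realCM -(natC 2).
have vn : (1 - u)%:C != 0 by rewrite realC_eq0 gt_eqF.
transitivity (x%:C^-1 * (2 / (cpow pi (1 / 2) * cI)) * (cpow u la * ((1 - u)%:C * cpow (2 - u) la) * (o1 + -1 * o2)));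
  last by ring.
rewrite ho.
move: (cpow u la) (cpow (2 - u) la) (sin _)%:C (1 - u)%:C x%:C xn vn (@cpow_neq0 R pi (1 / 2)) => A B C V X xn vn.
move: (cpow pi _) => P pn; move: cI cn => I cn.
by field; rewrite vn pn xn cn.
Qed.

(** The factor x^(1/2) makes the leading term bounded, so the asymptotics is a plain limit 0 that
    passes through the recurrence. *)
Definition Bn nu x : R[i] := cpow x (1 / 2) * besselJ nu x.
Definition Ln nu x : R[i] :=
  cpow 2 (1 / 2) / cpow pi (1 / 2) * ccos (x%:C - (pi / 2)%:C * nu - (pi / 4)%:C).
Definition bessel_asym nu : Prop := cto +oo (fun x => Bn nu x - Ln nu x) 0.

Lemma cpow2half : cpow 2 (1 / 2) / 2 = (cpow 2 (1 / 2))^-1 :> R[i].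
Proof.
have c0 : cpow 2 (1 / 2) != 0 :> R[i] by exact: cpow_neq0.
apply: (mulfI c0); rewrite divff // mulrA -cpowD half_half cpow1 //.
by rewrite -(natC 2) divff // pnatr_eq0.
Qed.

(** The cosine form, with k = 1 so that the terms at u = 1 cancel; it covers -1/2 < Re nu <= 1/2. *)
Lemma bessel_asym1 la : -1 < Re la -> Re la <= 0 -> bessel_asym (la + 1 / 2).
Proof.
move=> hl hl0; have p1 : 0 < Re (la + 1) by rewrite ReD /=; lra.
have hm : -1 < Re (la + 1 / 2) by rewrite ReD Re_half; lra.
have h := edge_asym (k := 1) hl hl0 (@Ck_w1 3 la).
rewrite subrr mulr0 in h; have {}h := h erefl.
have Gn := Gamma_neq0 p1.
have := ctoM (@cto_cst _ _ +oo _ ((Gamma (la + 1) * cpow 2 (la + 1 / 2))^-1 / cpow pi (1 / 2))) h.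
rewrite mulr0 => H; apply: cto_near (H _ _); near=> x.
have x0 : 0 < x by near: x; exact: nbhs_pinfty_gt.
rewrite /Bn /Ln besselJE // !ccosE.
have := poisson1 x hl; move: (edge _ _ 1 x + _) => E.
have -> : x%:C - (pi / 2)%:C * (la + 1 / 2) - (pi / 4)%:C = x%:C - (la + 1) * (pi / 2)%:C.
  by rewrite realC_quart; field.
rewrite -/(ep la x) -/(em la x) [1 * em _ _]mul1r /w1 subr0.
move: (ep la x + em la x) => S hE.
rewrite cpow_div // (_ : cpow x (la + 1) = cpow x (1 / 2) * cpow x (la + 1 / 2)); last first.
  by rewrite -cpowD; congr cpow; field.
rewrite (_ : cpow 2 (1 / 2) / cpow pi (1 / 2) * (S / 2%:R) =
  (cpow 2 (1 / 2) / 2) / cpow pi (1 / 2) * S); last by ring.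
rewrite cpow2half (cpowD 2 la).
have := @cpow_neq0 R 2 la; have := @cpow_neq0 R 2 (1 / 2).
have pn := @cpow_neq0 R pi (1 / 2).
have -> : bj (la + 1 / 2) (x ^+ 2 / 4) = E / (cpow pi (1 / 2) * Gamma (la + 1)).
  apply: (mulfI Gn); rewrite hE; move: (Gamma _) Gn (cpow pi _) pn => G Gn P pn.
  by field; rewrite Gn pn.
move: (Gamma _) Gn (cpow pi _) pn => G Gn P pn.
move: (cpow 2 la) (cpow 2 _) => A C cn an; move: (cpow x _) (cpow x _) => X1 X2.
by field; rewrite Gn pn cn an.
Unshelve. all: end_near. Qed.

Lemma cexp_pi2 : cexp (cI * (pi / 2)%:C) = cI :> R[i].
Proof.
by rewrite cexp_cI cos_pihalf sin_pihalf add0r mulr1.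
Qed.

Lemma cI_neq0 : cI != 0 :> R[i].
Proof. by rewrite -normc_eq0 normc_cI oner_eq0. Qed.

Lemma cI_inv : cI^-1 = - cI :> R[i].
Proof. by apply: (mulfI cI_neq0); rewrite divff ?cI_neq0 // mulrN sqr_cI opprK. Qed.

(** The sine form, with k = -1 and a weight vanishing at u = 1; it covers 1/2 < Re nu <= 3/2. The
    1/i of the sine matches the extra quarter turn pi/2 in the phase. *)
Lemma bessel_asym2 la : -1 < Re la -> Re la <= 0 -> bessel_asym (la + 3%:R / 2).
Proof.
move=> hl hl0; have p1 : 0 < Re (la + 1) by rewrite ReD /=; lra.
have e32 : la + 3%:R / 2 = la + 1 + 1 / 2 by field.
have hm : -1 < Re (la + 3%:R / 2) by rewrite e32 !ReD Re_half /=; lra.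
have h := edge_asym (k := -1) hl hl0 (@Ck_w2 3 la).
have w21 : w2 la 1 = 0 by rewrite /w2 subrr mul0r.
have w20 : w2 la 0 = cpow 2 la by rewrite /w2 !subr0 mul1r.
rewrite w21 mul0r in h; have {}h := h erefl.
have Gn := Gamma_neq0 p1.
have := ctoM (@cto_cst _ _ +oo _
  (2 / (Gamma (la + 1) * cpow 2 (la + 3%:R / 2) * cpow pi (1 / 2) * cI))) h.
rewrite mulr0 => H; apply: cto_near (H _ _); near=> x.
have x0 : 0 < x by near: x; exact: nbhs_pinfty_gt.
rewrite /Bn /Ln besselJE // !ccosE.
have := poisson2 hl x0; move: (edge _ _ 1 x + _) => E.
have -> : cI * (x%:C - (pi / 2)%:C * (la + 3%:R / 2) - (pi / 4)%:C) =
    cI * (x%:C - (la + 1) * (pi / 2)%:C) - cI * (pi / 2)%:C.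
  by rewrite realC_quart; field.
have -> : cexp (cI * (x%:C - (la + 1) * (pi / 2)%:C) - cI * (pi / 2)%:C) = ep la x * - cI.
  by rewrite cexpD cexpN cexp_pi2 cI_inv.
have -> : cexp (- (cI * (x%:C - (la + 1) * (pi / 2)%:C) - cI * (pi / 2)%:C)) = em la x * cI.
  by rewrite opprB addrC cexpD cexp_pi2.
move: (ep la x) (em la x) => p q hE.
have xn : x%:C != 0 by rewrite realC_eq0 gt_eqF.
have pn := @cpow_neq0 R pi (1 / 2).
have cn := cI_neq0.
have -> : bj (la + 3%:R / 2) (x ^+ 2 / 4) = 2 * E / (cpow pi (1 / 2) * cI * Gamma (la + 1) * x%:C).
  apply: (mulfI Gn); apply: (mulfI xn); rewrite hE.
  move: (Gamma _) Gn (cpow pi _) pn x%:C xn cI cn => G Gn P pn X xn I cn.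
  by field; rewrite Gn pn xn cn.
rewrite cpow_div // (_ : cpow x (la + 1) = cpow x (1 / 2) * cpow x (la + 3%:R / 2) / x%:C); last first.
  by apply: (mulIf xn); rewrite divfK // mulrC -cpowS // -cpowD; congr cpow; field.
rewrite (_ : cpow 2 (1 / 2) / cpow pi (1 / 2) * ((p * - cI + q * cI) / 2%:R) =
  (cpow 2 (1 / 2) / 2) / cpow pi (1 / 2) * ((p - q) * - cI)); last by ring.
rewrite cpow2half -cI_inv w20 [in cpow 2 _]e32 (cpowD 2 (la + 1)) cpowS // -(natC 2).
have := @cpow_neq0 R 2 la; have := @cpow_neq0 R 2 (1 / 2).
move: (Gamma _) Gn (cpow pi _) pn x%:C xn cI cn => G Gn P pn X xn I cn.
move: (cpow 2 la) (cpow 2 _) => A C cn' an; move: (cpow x _) (cpow x _) => X1 X2.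
by field; rewrite Gn pn cn cn' an xn.
Unshelve. all: end_near. Qed.

Lemma Bn_rec nu x : -1 < Re nu -> 0 < x ->
  Bn nu x = 2 * (nu + 1) / x%:C * Bn (nu + 1) x - Bn (nu + 2%:R) x.
Proof.
move=> hn x0; have h1 := Re_nu1 hn.
have e2 : nu + 2%:R = nu + 1 + 1 by rewrite -addrA.
have h2 : -1 < Re (nu + 2%:R) by rewrite e2; exact: Re_nu1.
have x2 : 0 < x / 2 by rewrite divr_gt0.
rewrite /Bn !besselJE // (bj_rec _ hn) e2 !cpowS // -e2.
have xn : x%:C != 0 by rewrite realC_eq0 gt_eqF.
rewrite realC_half realC_qsqr.
move: (bj _ _) (bj _ _) (cpow _ _) (cpow _ _) x%:C xn => b1 b2 p q X xn.
by field; rewrite xn.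
Qed.

Lemma Ln_rec nu x : Ln (nu + 2%:R) x = - Ln nu x.
Proof.
suff e : ccos (x%:C - (pi / 2)%:C * (nu + 2%:R) - (pi / 4)%:C) =
    - ccos (x%:C - (pi / 2)%:C * nu - (pi / 4)%:C) by rewrite /Ln e mulrN.
rewrite !ccosE.
have -> : cI * (x%:C - (pi / 2)%:C * (nu + 2%:R) - (pi / 4)%:C) =
    cI * (x%:C - (pi / 2)%:C * nu - (pi / 4)%:C) - cI * (pi / 2)%:C - cI * (pi / 2)%:C by ring.
move: (cI * (x%:C - _ - _)) => z.
have -> : cexp (z - cI * (pi / 2)%:C - cI * (pi / 2)%:C) = cexp z * (cI * cI).
  by rewrite !cexpD cexpN cexp_pi2 cI_inv; ring.
have -> : cexp (- (z - cI * (pi / 2)%:C - cI * (pi / 2)%:C)) = cexp (- z) * (cI * cI).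
  by rewrite !opprB !cexpD cexp_pi2; ring.
by rewrite sqr_cI; ring.
Qed.

(** The argument of the cosine may be complex, but its imaginary part does not depend on x. *)
Lemma normc_Ln nu : exists M : R, forall x, normc (Ln nu x) <= M.
Proof.
pose y : R := Re (cI * (- (pi / 2)%:C * nu - (pi / 4)%:C)).
exists (normc (cpow 2 (1 / 2) / cpow pi (1 / 2) / 2) * (expR y + expR (- y))) => x.
rewrite /Ln !ccosE mulrA mulrAC normcM ler_wpM2l ?normc_ge0 //.
apply: le_trans (normcD _ _) _; rewrite !normc_cexp ReN.
have -> : Re (cI * (x%:C - (pi / 2)%:C * nu - (pi / 4)%:C)) = y.
  rewrite (_ : cI * _ = cI * x%:C + cI * (- (pi / 2)%:C * nu - (pi / 4)%:C)); last by ring.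
  by rewrite ReD [Re (cI * x%:C)]ReM /= mul0r mulr0 subrr add0r.
by [].
Qed.

Lemma cto_invx k : cto +oo (fun x => k / x%:C) 0.
Proof.
have := ctoM (@cto_cst _ _ +oo _ k) (cto_real (@inv_pinfty R)); rewrite mulr0 => H.
by apply: cto_ext (H _ _ _) => x; rewrite realCV.
Qed.

Lemma cto_Bn_div nu k : bessel_asym nu -> cto +oo (fun x => k / x%:C * Bn nu x) 0.
Proof.
move=> h; have [M hM] := normc_Ln nu.
have h1 : cto +oo (fun x => Ln nu x * (k / x%:C)) 0.
  by apply: (@cto0_bnd _ _ _ _ _ _ M); [near=> x; exact: hM|exact: cto_invx].
have := ctoD (ctoM (cto_invx k) h) h1; rewrite mulr0 addr0 => H.
by apply: cto_ext (H _ _) => x; ring.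
Unshelve. all: end_near. Qed.

(** In the recurrence the middle term carries 1/x against a bounded function and vanishes; the outer
    leading terms are opposite by [Ln_rec]. *)
Lemma bessel_asym_up nu : -1 < Re nu -> bessel_asym nu -> bessel_asym (nu + 1) ->
  bessel_asym (nu + 2%:R).
Proof.
move=> hn h0 h1; have := ctoB (cto_Bn_div (2 * (nu + 1)) h1) h0; rewrite subr0 => H.
apply: cto_near (H _); near=> x; rewrite (@Bn_rec nu x hn) ?Ln_rec; first by ring.
by near: x; exact: nbhs_pinfty_gt.
Unshelve. all: end_near. Qed.

Lemma bessel_asym_down nu : -1 < Re nu -> bessel_asym (nu + 1) -> bessel_asym (nu + 2%:R) ->
  bessel_asym nu.
Proof.
move=> hn h1 h2; have := ctoB (cto_Bn_div (2 * (nu + 1)) h1) h2; rewrite subr0 => H.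
apply: cto_near (H _); near=> x; rewrite (@Bn_rec nu x hn) ?Ln_rec; first by ring.
by near: x; exact: nbhs_pinfty_gt.
Unshelve. all: end_near. Qed.

(* Poisson's integrals cover -1/2 < Re nu <= 3/2; the three term recurrence does the rest. *)
Lemma bessel_asymP nu : -1 < Re nu -> bessel_asym nu.
Proof.
have s1 k : - (1 / 2) < Re k <= 1 / 2 -> bessel_asym k.
  move=> hk; rewrite -(subrK (1 / 2) k); apply: bessel_asym1; rewrite ReB Re_half; lra.
have e32 k : k - 3%:R / 2 = k - 1 - 1 / 2 by field.
have s2 k : 1 / 2 < Re k <= 3 / 2 -> bessel_asym k.
  by move=> hk; rewrite -(subrK (3%:R / 2) k); apply: bessel_asym2; rewrite e32 !ReB Re_half /=; lra.
have up n k : - (1 / 2) < Re k <= n%:R + 3 / 2 -> bessel_asym k.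
  elim: n k => [|n IH] k hk.
    by case: (leP (Re k) (1 / 2)) => hk1; [apply: s1|apply: s2]; lra.
  case: (leP (Re k) (3 / 2)) => hk1.
    by case: (leP (Re k) (1 / 2)) => hk2; [apply: s1|apply: s2]; lra.
  move: hk; rewrite -(natr1 n) => hk.
  have e1 : k - 2%:R + 1 = k - 1 by ring.
  have r2 : Re (k - 2%:R) = Re k - 2 by rewrite ReB Re_nat.
  have r1 : Re (k - 1) = Re k - 1 by rewrite ReB.
  rewrite -(subrK 2%:R k); apply: bessel_asym_up; rewrite ?e1.
  - by rewrite r2; move: (n%:R : R) hk => q; lra.
  - have [hk2|hk2] := leP (Re k) (5 / 2).
      have [hk3|hk3] := leP (Re k - 2) (1 / 2); [apply: s1|apply: s2]; rewrite r2; lra.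
    by apply: IH; rewrite r2; move: (n%:R : R) hk => q; lra.
  - by apply: IH; rewrite r1; move: (n%:R : R) hk => q; lra.
have big k : - (1 / 2) < Re k -> bessel_asym k.
  move=> hk; apply: (@up (Num.truncn (Re k + 1))); rewrite hk /=.
  have : 0 <= Re k + 1 by lra.
  by move=> /truncn_itv /andP[_]; rewrite -natr1; lra.
(* One downward step suffices, since nu + 1 and nu + 2 have positive real part; it reaches the
   orders with Re nu <= -1/2, outside Poisson's range. *)
move=> hn; apply: bessel_asym_down => //; apply: big; rewrite ReD ?Re_nat /=; lra.
Qed.

End BesselAsymptotics.

(** * The remainder term *)

Section RemainderKernel.
Context {R : realType}.
Local Notation mu := (@lebesgue_measure R).
Local Notation mbl D := (@measurable _ (measurableTypeR R) D).
Implicit Types (t u x y r s : R) (z a b nu la La k : R[i]) (f g psi : R -> R[i]).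

(* t^(nu/2) J_nu(r sqrt t) = (r/2)^nu kern nu r t. *)
Definition kern nu r t : R[i] := cpow t nu * bj nu (r ^+ 2 / 4 * t).

(** The product rule gives exactly the right-hand side of [bj_rec] times t^nu. With this
    normalisation no factor r appears in the integrations by parts; the gain in r is hidden in the
    order of the kernel. *)
Lemma isd_kern nu r t : -1 < Re nu -> 0 < t -> isd (kern (nu + 1) r) t (kern nu r t).
Proof.
move=> hn t0; have h1 := Re_nu1 hn.
have d0 : is_derive t 1 (fun u : R => r ^+ 2 / 4 * u) (r ^+ 2 / 4).
  apply: is_derive_eq (is_deriveZ (r ^+ 2 / 4) (is_derive_id t 1)) _.
  by rewrite /GRing.scale /= mulr1.
apply: isd_eq (isdM (isd_cpow (nu + 1) t0) (isd_comp d0 (isd_bj _ h1))) _.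
rewrite addrK /kern (bj_rec _ hn) (cpowS nu t0) (_ : nu + 2%:R = nu + 1 + 1); last by rewrite -addrA.
move: (r ^+ 2 / 4) => q; rewrite (realCM q); move: (bj _ _) (bj _ _) (cpow _ _) => b1 b2 P.
by ring.
Qed.

Lemma Ck_kern nu r D : -1 < Re nu -> (forall t, D t -> 0 < t) -> Ck 0 D (kern nu r).
Proof.
move=> hn D0; apply: CkM; first exact: Ck_cpow.
move=> t _; exact: isd_cto (isd_comp (is_deriveZ (r ^+ 2 / 4) (is_derive_id t 1)) (isd_bj _ hn)).
Qed.

(** In the theorem p = 1 - 2 eps and c = 1 - eps: the cut-off vanishes up to p and equals 1 from c
    on. *)
Context (p c : R).
Context (p0 : 0 < p) (pc : p < c) (c1 : c < 1).

Lemma mbl_p1 : mbl `]p, 1[. Proof. exact: measurable_itv. Qed.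
#[local] Hint Resolve mbl_p1 : core.

Lemma lt_p1 : p < 1. Proof. exact: lt_trans c1. Qed.

Lemma in_p1 t : `]p, 1[%classic t -> p < t /\ t < 1.
Proof. by rewrite /= in_itv /= => /andP. Qed.

Lemma sub_p1 : `]p, 1[%classic `<=` (`]0, 1[%classic : set R).
Proof. by move=> t /in_p1[h1 h2]; rewrite /= in_itv /= h2 (lt_trans p0). Qed.

Lemma cintegrableM_bnd f g : Ck 0 `[p, 1] g -> Ck 0 `]p, 1[ f -> cintegrable `]p, 1[ f ->
  cintegrable `]p, 1[ (fun t => f t * g t).
Proof.
move=> cg cf fi; have [M M0 hM] := bounded_cc (ltW lt_p1) cg.
apply: (cintegrable_le mbl_p1 _ _ (rintZ M mbl_p1 (rint_normc mbl_p1 fi))).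
  apply: cmeas_Ck => //; apply: CkM => //; apply: Ck_sub cg.
  by move=> t /in_p1[h1 h2]; rewrite /= in_itv /= !ltW.
move=> t /in_p1[h1 h2]; rewrite normcM mulrC ler_wpM2r ?normc_ge0 //.
by apply: hM; rewrite !ltW.
Qed.

Lemma Ck_kern_p1 nu r : -1 < Re nu -> Ck 0 `[p, 1] (kern nu r).
Proof.
by move=> hn; apply: Ck_kern => // t; rewrite /= in_itv /= => /andP[h _]; exact: lt_le_trans h.
Qed.

Lemma ibp_step f f' nu r : -1 < Re nu ->
  (forall t, `]0, 1[%classic t -> isd f t (f' t)) -> Ck 0 `]0, 1[ f' ->
  cintegrable `]p, 1[ f -> cintegrable `]p, 1[ f' -> f p = 0 -> cto 1^'- f 0 ->
  cintegral `]p, 1[ (fun t => f t * kern nu r t) =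
  - cintegral `]p, 1[ (fun t => f' t * kern (nu + 1) r t).
Proof.
move=> hn df cf' fi f'i fp f1; have h1 := Re_nu1 hn.
have cf : Ck 0 `]0, 1[ f by move=> t /df /isd_cto.
have cfp := Ck_sub sub_p1 cf; have cf'p := Ck_sub sub_p1 cf'.
have i1 := cintegrableM_bnd (Ck_kern_p1 r hn) cfp fi.
have i2 := cintegrableM_bnd (Ck_kern_p1 r h1) cf'p f'i.
have kpos t : `]p, 1[%classic t -> 0 < t by move=> /in_p1[h _]; exact: lt_trans h.
apply/eqP; rewrite -addr_eq0 addrC -cintD //; apply/eqP; rewrite -[RHS](subrr 0).
have p1 := lt_p1; have pin : `]0, 1[%classic p by rewrite /= in_itv /= p0.
apply: (@cftc_oo _ p 1 (fun t => f t * kern (nu + 1) r t)) => //.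
- move=> t /andP[h2 h3]; have t0 : 0 < t by exact: lt_trans h2.
  by apply: isdM; [apply: df; rewrite /= in_itv /= t0|exact: isd_kern].
- by apply: CkD; apply: CkM => //; exact: Ck_kern.
- exact: (cintegrableD mbl_p1 i2 i1).
- apply: cto_at_right.
  rewrite -[X in cto _ _ X](mul0r (kern (nu + 1) r p)) -fp; apply: ctoM; first exact: cf.
  exact: isd_cto (isd_kern r hn p0).
- rewrite -[X in cto _ _ X](mul0r (kern (nu + 1) r 1)); apply: ctoM => //.
  by apply: cto_at_left; exact: isd_cto (isd_kern r hn ltr01).
Qed.

(** The n-th derivative is asked to be C^1, one order beyond the n integrations by parts, as the
    final Riemann-Lebesgue step needs a C^1 amplitude. *)
Fixpoint smooth_int n f : Prop :=
  cintegrable `]p, 1[ f /\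
  match n with
  | 0%N => Ck 1 `]0, 1[ f
  | n'.+1 => exists f', (forall t, `]0, 1[%classic t -> isd f t (f' t)) /\ smooth_int n' f'
  end.

Lemma smooth_int_Ck n f : smooth_int n f -> Ck 1 `]0, 1[ f.
Proof.
elim: n f => [|n IH] f [_ //] [f' [df /IH cf']].
by exists f'; split => // t Dt; exact: (Ck_cont cf').
Qed.

Lemma smooth_int_le n f : smooth_int n.+1 f -> smooth_int n f.
Proof.
elim: n f => [|n IH] f [fi [f' [df hf']]].
  by split => //; apply: (@smooth_int_Ck 1); split => //; exists f'.
by split => //; exists f'; split => //; exact: IH.
Qed.

(** Only the behaviour at 1 matters: on the compact [p, c] inside (0, 1) smoothness alone gives
    integrable derivatives. This transfers the hypotheses from psi to its cut-off version. *)
Lemma smooth_int_near n f g : smooth_int n f -> Ck n.+1 `]0, 1[ g ->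
  (forall t, c < t < 1 -> f t = g t) -> smooth_int n g.
Proof.
have gint f' g' : cintegrable `]p, 1[ f' -> Ck 0 `]0, 1[ g' ->
    (forall t, c < t < 1 -> f' t = g' t) -> cintegrable `]p, 1[ g'.
  move=> fi cg fg; have mc : mbl `]c, 1[ by exact: measurable_itv.
  apply: (cintegrable_split mbl_p1 mc).
    apply: cintegrable_ext mc _ (cintegrable_sub mbl_p1 mc _ fi).
      by move=> t; rewrite /= in_itv /= => /fg.
    by move=> t; rewrite /= !in_itv /= => /andP[h ->]; rewrite (lt_trans pc).
  have mpc : mbl `[p, c] by exact: measurable_itv.
  apply: (@cintegrable_sub _ `[p, c]) => //.
  - exact: measurableD.
  - move=> t [/in_p1[h1 h2] h3]; rewrite /= in_itv /= (ltW h1) leNgt; apply/negP => h4.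
    by apply: h3; rewrite /= in_itv /= h4.
  - apply: cintegrable_cc; apply: Ck_sub cg => t; rewrite /= !in_itv /= => /andP[h1 h2].
    by rewrite (lt_le_trans p0 h1) (le_lt_trans h2).
elim: n f g => [|n IH] f g [fi].
  by move=> _ cg fg; split => //; apply: gint fi (Ck_pred cg) fg.
move=> [f' [df hf']] [g' [dg cg']] fg; split.
  by apply: gint fi _ fg => t /dg /isd_cto.
exists g'; split => //; apply: IH hf' cg' _ => t /andP[h1 h2].
have Dt : `]0, 1[%classic t by rewrite /= in_itv /= h2 (lt_trans p0) // (lt_trans pc).
apply: isd_uniq (dg t Dt); apply: isd_near (df t Dt); near=> u; apply: fg.
suff : u \in `]c, 1[ by rewrite in_itv.
by near: u; apply: near_in_itvoo; rewrite in_itv /= h1.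
Unshelve. all: end_near. Qed.

Lemma cpow_onem_le1 z t : 0 <= Re z -> 0 < t < 1 -> normc (cpow (1 - t) z) <= 1.
Proof.
move=> hz /andP[t0 t1]; rewrite normc_cpow ?subr_gt0 // powR_le1 // subr_gt0 t1 /=.
by rewrite gerBl ltW.
Qed.

Lemma smooth_int_pow0 La psi : 0 <= Re La -> cintegrable `]p, 1[ psi -> Ck 1 `]0, 1[ psi ->
  Ck 1 `]0, 1[ (fun t => cpow (1 - t) La * psi t) /\
  cintegrable `]p, 1[ (fun t => cpow (1 - t) La * psi t).
Proof.
move=> hL fi cf; have cg : Ck 1 `]0, 1[ (fun t => cpow (1 - t) La * psi t).
  by apply: CkM => //; apply: Ck_cpowr => t /in01[_]; rewrite subr_gt0.
split => //; apply: (cintegrable_le mbl_p1 _ _ (rint_normc mbl_p1 fi)).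
  by apply: cmeas_Ck => //; apply: Ck_sub sub_p1 _; exact: Ck_pred.
move=> t Dt; have /in01[t0 t1] := sub_p1 Dt.
by rewrite normcM ler_piMl ?normc_ge0 // cpow_onem_le1 // t0 -subr_gt0.
Qed.

(** Integrability of the derivative bounds psi(t) - psi(c) uniformly in t; hence a power of 1 - t
    with positive real exponent kills the boundary term at 1. *)
Lemma bounded_near1 psi psi' : (forall t, `]0, 1[%classic t -> isd psi t (psi' t)) ->
  Ck 0 `]0, 1[ psi' -> cintegrable `]p, 1[ psi' ->
  exists M : R, forall t, c < t < 1 -> normc (psi t) <= M.
Proof.
move=> dpsi cpsi' pi'; have ni := rint_normc mbl_p1 pi'.
exists (normc (psi c) + 2 * \int[mu]_(t in `]p, 1[) normc (psi' t)) => t /andP[h1 h2].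
have in' u : c <= u <= t -> `]0, 1[%classic u.
  move=> /andP[h3 h4]; rewrite /= in_itv /= (le_lt_trans h4 h2) (lt_le_trans _ h3) //.
  exact: lt_trans pc.
have cc : Ck 0 `[c, t] psi' by apply: Ck_sub cpsi' => u; rewrite /= in_itv /= => /in'.
have e : cintegral `[c, t] psi' = psi t - psi c by apply: cftc_cc => // u /in' /dpsi.
rewrite -[psi t](subrK (psi c)) -e addrC; apply: le_trans (normcD _ _) _; rewrite lerD2l.
have sub : `[c, t] `<=` (`]p, 1[%classic : set R).
  by move=> u; rewrite /= !in_itv /= => /andP[h3 h4]; rewrite (lt_le_trans pc h3) (le_lt_trans h4).
have mct : mbl `[c, t] by exact: measurable_itv.
apply: le_trans (normc_cint_le mct (cintegrable_cc cc) (rint_sub mbl_p1 mct sub ni) _) _ => //.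
rewrite ler_pM2l //; apply: Rintegral_subset => // u _; exact: normc_ge0.
Qed.

Lemma pow_psi_to0 La psi psi' : 0 < Re La -> (forall t, `]0, 1[%classic t -> isd psi t (psi' t)) ->
  Ck 0 `]0, 1[ psi' -> cintegrable `]p, 1[ psi' ->
  cto 1^'- (fun t => cpow (1 - t) La * psi t) 0.
Proof.
move=> hL dpsi cpsi' pi'; have [M hM] := bounded_near1 dpsi cpsi' pi'.
apply: (@cto0_le _ _ _ _ _ (fun t => (1 - t) `^ Re La * M)); last first.
  rewrite -[X in _ --> X](mul0r M); apply: cvgM; last exact: cvg_cst.
  exact: cvg_comp onem_at_left (powR_cvg0 hL).
near=> t; have t1 : t < 1 by near: t; exact: nbhs_left_lt.
have ct : c < t by near: t; exact: nbhs_left_gt.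
rewrite normcM normc_cpow ?subr_gt0 // ler_wpM2l ?powR_ge0 //; apply: hM.
by rewrite ct.
Unshelve. all: end_near. Qed.

Lemma vanish_at f : Ck 0 `]0, 1[ f -> (forall t, 0 < t < p -> f t = 0) -> f p = 0.
Proof.
move=> cf fz; have pin : `]0, 1[%classic p by rewrite /= in_itv /= p0 lt_p1.
apply: (@cto_uniq _ _ p^'- _ f); first by apply: cto_at_left; exact: cf.
apply: cto_near (@cto_cst _ _ p^'- _ 0); near=> t; rewrite fz //; apply/andP; split.
  by near: t; exact: nbhs_left_gt.
by near: t; exact: nbhs_left_lt.
Unshelve. all: end_near. Qed.

Lemma vanish_deriv f f' : (forall t, `]0, 1[%classic t -> isd f t (f' t)) ->
  (forall t, 0 < t < p -> f t = 0) -> forall t, 0 < t < p -> f' t = 0.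
Proof.
move=> df fz t /andP[t0 tp].
have Dt : `]0, 1[%classic t by rewrite /= in_itv /= t0 (lt_trans tp) // lt_p1.
apply: isd_uniq (df t Dt) _; apply: isd_near (isd_cst 0 t); near=> u; rewrite fz //.
suff : u \in `]0, p[ by rewrite in_itv.
by near: u; apply: near_in_itvoo; rewrite in_itv /= t0.
Unshelve. all: end_near. Qed.

(* n-fold integration by parts against the kernels, using kern (nu + 1)' = kern nu. *)
Lemma ibp_kern n La psi : n%:R <= Re La -> smooth_int n psi ->
  (forall t, 0 < t < p -> psi t = 0) ->
  exists f, [/\ Ck 1 `]0, 1[ f, cintegrable `]p, 1[ f & forall nu r, -1 < Re nu ->
    cintegral `]p, 1[ (fun t => cpow (1 - t) La * psi t * kern nu r t) =
    (-1) ^+ n * cintegral `]p, 1[ (fun t => f t * kern (nu + n%:R) r t)].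
Proof.
elim: n La psi => [|n IH] La psi hL.
  move=> [pi cpsi] _; have [cg gi] := smooth_int_pow0 hL pi cpsi.
  by eexists; split; [exact: cg|exact: gi|] => nu r hn; rewrite expr0 mul1r addr0.
move=> hpsi pz; have hpsi0 := smooth_int_le hpsi; have [pi [psi' [dpsi hpsi']]] := hpsi.
have cpsi' := smooth_int_Ck hpsi'; have cpsi := smooth_int_Ck hpsi.
have pi' : cintegrable `]p, 1[ psi' by case: (n) hpsi' => [|m] [].
have hn1 : n%:R + 1 <= Re La by rewrite natr1.
have n0 : 0 <= n%:R :> R by [].
have hL1 : n%:R <= Re (La - 1) by rewrite ReB /=; lra.
have hL' : n%:R <= Re La by lra.
have pz' := vanish_deriv dpsi pz.
(* Differentiating (1-t)^La psi gives a term with La - 1 and psi and a term with La and psi'. The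
   first spends one unit of the exponent and the second one derivative, so the induction hypothesis
   at n applies to both. *)
have [f1 [cf1 fi1 hf1]] := IH _ _ hL1 hpsi0 pz.
have [f2 [cf2 fi2 hf2]] := IH _ _ hL' hpsi' pz'.
have m1 := mbl_p1.
exists (fun t => - La * f1 t + f2 t); split.
- by apply: CkD => //; exact: CkZ.
- by apply: cintegrableD => //; exact: cintegrableZ.
move=> nu r hn; have h1 := Re_nu1 hn.
have [cg1 gi1] : Ck 1 `]0, 1[ (fun t => cpow (1 - t) (La - 1) * psi t) /\
    cintegrable `]p, 1[ (fun t => cpow (1 - t) (La - 1) * psi t).
  by apply: smooth_int_pow0 => //; exact: le_trans hL1.
have [cg2 gi2] : Ck 1 `]0, 1[ (fun t => cpow (1 - t) La * psi' t) /\
    cintegrable `]p, 1[ (fun t => cpow (1 - t) La * psi' t).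
  by apply: smooth_int_pow0 => //; exact: le_trans hL'.
have [cg gi] : Ck 1 `]0, 1[ (fun t => cpow (1 - t) La * psi t) /\
    cintegrable `]p, 1[ (fun t => cpow (1 - t) La * psi t).
  by apply: smooth_int_pow0 => //; exact: le_trans hL'.
have kz : Ck 0 `[p, 1] (kern (nu + 1) r) by exact: Ck_kern_p1.
have kz2 : Ck 0 `[p, 1] (kern (nu + n.+1%:R) r).
  by apply: Ck_kern_p1; rewrite ReD Re_nat ltr_wpDr.
have c0 f : Ck 1 `]0, 1[ f -> Ck 0 `]p, 1[ f by move=> cf; exact: Ck_sub sub_p1 (Ck_pred cf).
apply: etrans.
  apply: (@ibp_step (fun t => cpow (1 - t) La * psi t)
    (fun t => - La * (cpow (1 - t) (La - 1) * psi t) + cpow (1 - t) La * psi' t) nu r hn) => //.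
  - move=> t Dt; have /in01[t0 t1] := Dt.
    apply: isd_eq (isdM (isd_cpowr La _) (dpsi t Dt)) _; first by rewrite -subr_gt0.
    by ring.
  - by apply: CkD; [apply: CkZ|]; exact: Ck_pred.
  - by apply: cintegrableD => //; exact: cintegrableZ.
  - by rewrite (vanish_at (Ck_pred cpsi) pz) mulr0.
  - apply: pow_psi_to0 dpsi _ pi'; last exact: Ck_pred cpsi'.
    by apply: lt_le_trans hn1; rewrite ltr_wpDl.
have e : nu + 1 + n%:R = nu + n.+1%:R by rewrite -natr1; ring.
  have := hf1 (nu + 1) r h1; have := hf2 (nu + 1) r h1; rewrite e => e2 e1.
  have j1 := cintegrableM_bnd kz (c0 _ cg1) gi1; have j2 := cintegrableM_bnd kz (c0 _ cg2) gi2.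
  have j3 := cintegrableM_bnd kz2 (c0 _ cf1) fi1; have j4 := cintegrableM_bnd kz2 (c0 _ cf2) fi2.
  transitivity (- (- La * cintegral `]p, 1[ (fun t => cpow (1 - t) (La - 1) * psi t * kern (nu + 1) r t)
     + cintegral `]p, 1[ (fun t => cpow (1 - t) La * psi' t * kern (nu + 1) r t))).
    rewrite -cintZ // -cintD //; last exact: cintegrableZ.
    by congr (- _); apply: cint_ext => t _; ring.
have comb (A B C D q : R[i]) : A = q * C -> B = q * D ->
    - (- La * A + B) = (-1 * q) * (- La * C + D) by move=> -> ->; ring.
apply: etrans; first exact: (comb _ _ _ _ _ e1 e2).
have ex : -1 * (-1) ^+ n = (-1) ^+ n.+1 :> R[i] by rewrite exprS.
apply: etrans; first exact: (congr1 (fun z => z * _) ex).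
apply: (congr1 (fun z => _ * z)).
rewrite -cintZ // -cintD //; last exact: cintegrableZ.
by apply: cint_ext => t _; ring.
Qed.

End RemainderKernel.

(** * Decay of integrals against the kernels *)

Section Decay.
Context {R : realType}.
Local Notation mu := (@lebesgue_measure R).
Local Notation mbl D := (@measurable _ (measurableTypeR R) D).
Implicit Types (t u x y r s : R) (z a b nu la La k : R[i]) (f g psi h : R -> R[i]).

(** Exhibits the size r^(-(nu+1/2)) of the kernel; the leftover power of t is smooth and bounded on
    [p, 1] and joins the amplitude. *)
Lemma kern_Bn nu r t : -1 < Re nu -> 0 < r -> 0 < t ->
  cpow r (nu + 1 / 2) * kern nu r t =
  cpow 2 nu * cpow t ((nu - 1 / 2) / 2) * Bn nu (r * Num.sqrt t).
Proof.
move=> hn r0 t0; have s0 : 0 < Num.sqrt t by rewrite sqrtr_gt0.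
have ts : t = Num.sqrt t ^+ 2 by rewrite sqr_sqrtr // ltW.
rewrite {1 2}ts; move: (Num.sqrt t) s0 => s s0.
have rs0 : 0 < r * s by rewrite mulr_gt0.
rewrite /kern /Bn besselJE // cpow_div // !(cpowM _ r0 s0) !cpow_sqr //.
have -> : (r * s) ^+ 2 / 4 = r ^+ 2 / 4 * s ^+ 2 by field.
have -> : 2%:R * ((nu - 1 / 2) / 2) = nu - 1 / 2 by field.
have -> : cpow s (2%:R * nu) = cpow s (nu - 1 / 2) * cpow s (1 / 2) * cpow s nu.
  by rewrite -!cpowD; congr cpow; ring.
rewrite (cpowD r); have := @cpow_neq0 R 2 nu.
move: (bj _ _) (cpow 2 nu) => B c cn; move: (cpow r nu) (cpow r _) (cpow s nu) (cpow s _) (cpow s _) => p1 p2 p3 p4 p5.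
by field; rewrite cn.
Qed.

Lemma Ln_osc nu : exists P Q : R[i], forall x,
  Ln nu x = P * cexp (cI * (1 * x)%:C) + Q * cexp (cI * (-1 * x)%:C).
Proof.
pose d := cI * (- (pi / 2)%:C * nu - (pi / 4)%:C).
exists (cpow 2 (1 / 2) / cpow pi (1 / 2) / 2 * cexp d), (cpow 2 (1 / 2) / cpow pi (1 / 2) / 2 * cexp (- d)) => x.
rewrite /Ln ccosE.
have -> : cI * (x%:C - (pi / 2)%:C * nu - (pi / 4)%:C) = d + cI * x%:C by rewrite /d; ring.
rewrite opprD !cexpD (mul1r x) (mulN1r x) realCN mulrN.
by move: (cexp d) (cexp (- d)) (cexp _) (cexp _) (cpow _ _) (cpow _ _) => e1 e2 e3 e4 e5 e6; ring.
Qed.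

Lemma cpow_sqrt t : 0 < t -> cpow t (2^-1) = (Num.sqrt t)%:C :> R[i].
Proof.
move=> t0; have -> : 2^-1 = (2^-1)%:C :> R[i] by rewrite realCV -natC.
by rewrite cpow_real // powR12_sqrt // ltW.
Qed.

Context (p : R).
Context (p0 : 0 < p) (p1 : p < 1).

Let mbl_p : mbl `]p, 1[. Proof. exact: measurable_itv. Qed.
#[local] Hint Resolve mbl_p : core.

Let in_p t : `]p, 1[%classic t -> 0 < t.
Proof. by rewrite /= in_itv /= => /andP[h _]; exact: lt_trans h. Qed.

Definition sosc s r t : R[i] := cexp (cI * (s * r * Num.sqrt t)%:C).

Lemma normc_sosc s r t : normc (sosc s r t) = 1.
Proof. by rewrite /sosc normc_cexp !ReImE /= mul0r mulr0 subrr expR0. Qed.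

Lemma Ck_sosc s r D : Ck 0 D (sosc s r).
Proof.
move=> t _; apply: cto_cexp; apply: ctoM; first exact: cto_cst.
by apply: cto_real; apply: cvgM; [exact: cvg_cst|exact: sqrt_continuous].
Qed.

Lemma sosc_int h s r : Ck 1 `]p, 1[ h -> cintegrable `]p, 1[ h ->
  cintegrable `]p, 1[ (fun t => h t * sosc s r t).
Proof.
move=> ch hi; apply: cintegrable_le (rint_normc mbl_p hi) => //.
  by apply: cmeas_Ck => //; apply: CkM; [exact: Ck_pred|exact: Ck_sosc].
by move=> t _; rewrite normcM normc_sosc mulr1.
Qed.

(** The phase sqrt t is never stationary: dividing [h] by its derivative gives 2 h sqrt t, still C^1
    since t > p > 0. *)
Lemma RL_sqrt h s : Ck 1 `]p, 1[ h -> cintegrable `]p, 1[ h -> s != 0 ->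
  cto +oo (fun r => cintegral `]p, 1[ (fun t => h t * sosc s r t)) 0.
Proof.
move=> ch hi s0.
have [g [dg cg]] : Ck 1 `]p, 1[ (fun t => h t * (2 * cpow t (2^-1))).
  by apply: CkM => //; apply: CkZ; apply: Ck_cpow => t /in_p.
apply: (@riemann_lebesgue _ _ _ _ h g (fun t => h t * (2 * cpow t (2^-1))) Num.sqrt
  (fun t => (2 * Num.sqrt t)^-1) s (exh_oo p1)) => //.
- exact: Ck_pred.
- by move=> t /in_p t0; exact: is_derive1_sqrt.
- move=> t /in_p t0; rewrite cpow_sqrt // realCV realCM -(natC 2) -mulrA divff ?mulr1 //.
  by rewrite mulf_neq0 ?pnatr_eq0 // realC_eq0 gt_eqF // sqrtr_gt0.
Qed.

Lemma Ln_int h nu r : Ck 1 `]p, 1[ h -> cintegrable `]p, 1[ h ->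
  cintegrable `]p, 1[ (fun t => h t * Ln nu (r * Num.sqrt t)).
Proof.
move=> ch hi; have [P [Q hPQ]] := Ln_osc nu.
apply: (@cintegrable_ext _ _ (fun t => P * (h t * sosc 1 r t) + Q * (h t * sosc (-1) r t))) => //.
  by move=> t _; rewrite hPQ /sosc !mulrA; ring.
by apply: cintegrableD => //; apply: cintegrableZ => //; exact: sosc_int.
Qed.

Lemma Ln_decay h nu : Ck 1 `]p, 1[ h -> cintegrable `]p, 1[ h ->
  cto +oo (fun r => cintegral `]p, 1[ (fun t => h t * Ln nu (r * Num.sqrt t))) 0.
Proof.
move=> ch hi; have [P [Q hPQ]] := Ln_osc nu.
have N1 : -1 != 0 :> R by rewrite oppr_eq0 oner_eq0.
have := ctoD (ctoM (@cto_cst _ _ +oo _ P) (RL_sqrt ch hi (oner_neq0 R)))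
  (ctoM (@cto_cst _ _ +oo _ Q) (RL_sqrt ch hi N1)).
rewrite !mulr0 addr0 => H; apply: cto_ext (H _ _ _ _ _) => r.
have i1 := sosc_int 1 r ch hi; have i2 := sosc_int (-1) r ch hi.
rewrite -(cintZ P mbl_p i1) -(cintZ Q mbl_p i2) -(cintD mbl_p (cintegrableZ P mbl_p i1) (cintegrableZ Q mbl_p i2)).
by apply: cint_ext => t _; rewrite hPQ /sosc !mulrA; ring.
Qed.

(** As t > p, the argument r sqrt t is at least r sqrt p, so the Bessel asymptotics holds uniformly
    in t. *)
Lemma asym_decay h nu : -1 < Re nu -> cintegrable `]p, 1[ h ->
  (forall r, 0 < r -> cintegrable `]p, 1[ (fun t => h t * (Bn nu (r * Num.sqrt t) - Ln nu (r * Num.sqrt t)))) ->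
  cto +oo (fun r => cintegral `]p, 1[
    (fun t => h t * (Bn nu (r * Num.sqrt t) - Ln nu (r * Num.sqrt t)))) 0.
Proof.
move=> hn hi hiB; have ni := rint_normc mbl_p hi.
apply/cto0_normc/cvgrPdist_le => e e0.
pose M := 2 * \int[mu]_(t in `]p, 1[) normc (h t) + 1.
have I0 : 0 <= \int[mu]_(t in `]p, 1[) normc (h t) by apply: Rintegral_ge0 => t _; exact: normc_ge0.
have M0 : 0 < M by rewrite ltr_wpDl // mulr_ge0.
have eM : 0 < e / M by rewrite divr_gt0.
have /cto0_normc/cvgrPdist_lt/(_ _ eM)[X [_ hX]] := bessel_asymP hn.
have sp : 0 < Num.sqrt p by rewrite sqrtr_gt0.
near=> r; have r0 : 0 < r by near: r; exact: nbhs_pinfty_gt.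
have rX : X / Num.sqrt p < r by near: r; apply: nbhs_pinfty_gt; exact: num_real.
rewrite sub0r normrN ger0_norm ?normc_ge0 //.
apply: le_trans (normc_cint_le mbl_p (hiB r r0) (rintZ (e / M) mbl_p ni) _) _.
  move=> t Dt; have t0 := in_p Dt; rewrite normcM mulrC ler_wpM2r ?normc_ge0 //.
  have := hX (r * Num.sqrt t); rewrite sub0r normrN ger0_norm ?normc_ge0 // => H; apply/ltW/H.
  apply: lt_le_trans (_ : r * Num.sqrt p <= _); first by rewrite -ltr_pdivrMr.
  rewrite ler_pM2l // ler_sqrt //; last exact: ltW.
  by move: Dt; rewrite /= in_itv /= => /andP[/ltW].
rewrite RintegralZl // mulrCA -ler_pdivlMl // invf_div.
by rewrite divfK ?gt_eqF // /M lerDl.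
Unshelve. all: end_near. Qed.

(** The Bessel function is replaced by its leading term with uniform error ([asym_decay]); the
    leading term, a pair of exponentials, is handled by Riemann-Lebesgue. *)
Lemma kern_decay f nu : -1 < Re nu -> Ck 1 `]p, 1[ f -> cintegrable `]p, 1[ f ->
  cto +oo (fun r => cpow r (nu + 1 / 2) * cintegral `]p, 1[ (fun t => f t * kern nu r t)) 0.
Proof.
move=> hn cf fi; pose g t : R[i] := cpow 2 nu * cpow t ((nu - 1 / 2) / 2).
have cg n D : (forall t, D t -> 0 < t) -> Ck n D g by move=> D0; apply: CkZ; exact: Ck_cpow.
have ch : Ck 1 `]p, 1[ (fun t => f t * g t) by apply: CkM => //; exact: cg.
have pcc t : `[p, 1]%classic t -> 0 < t.
  by rewrite /= in_itv /= => /andP[h _]; exact: lt_le_trans h.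
have [pm m1] : p < (p + 1) / 2 /\ (p + 1) / 2 < 1 by move: p1; split; lra.
have hi : cintegrable `]p, 1[ (fun t => f t * g t).
  by apply: (cintegrableM_bnd pm m1) => //; [exact: cg|exact: Ck_pred].
have ki r : cintegrable `]p, 1[ (fun t => f t * kern nu r t).
  by apply: (cintegrableM_bnd pm m1) => //; [exact: Ck_kern|exact: Ck_pred].
have e r t : 0 < r -> `]p, 1[%classic t ->
    cpow r (nu + 1 / 2) * (f t * kern nu r t) = f t * g t * Bn nu (r * Num.sqrt t).
  by move=> r0 /in_p t0; rewrite mulrCA kern_Bn // mulrA.
have Bi r : 0 < r -> cintegrable `]p, 1[ (fun t => f t * g t * Bn nu (r * Num.sqrt t)).
  move=> r0; apply: (cintegrable_ext mbl_p (fun t Dt => e r t r0 Dt)).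
  exact: cintegrableZ (ki r).
have Li r := Ln_int nu r ch hi.
have h1 := @asym_decay (fun t => f t * g t) nu hn hi.
have {}h1 := ctoD (h1 _) (Ln_decay nu ch hi); rewrite addr0 in h1.
apply: cto_near (h1 _ _); last first.
  move=> r r0; apply: (@cintegrable_ext _ _ (fun t => f t * g t * Bn nu (r * Num.sqrt t) -
    f t * g t * Ln nu (r * Num.sqrt t))) => //; first by move=> t _; rewrite mulrBr.
  by apply: cintegrableB => //; exact: Bi.
near=> r; have r0 : 0 < r by near: r; exact: nbhs_pinfty_gt.
rewrite -(cintZ _ mbl_p (ki r)) (cint_ext (fun t Dt => e r t r0 Dt)).
apply/eqP; rewrite eq_sym -subr_eq -(cintB mbl_p (Bi r r0) (Li r)); apply/eqP.
by apply: cint_ext => t _; rewrite mulrBr.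
Unshelve. all: end_near. Qed.

End Decay.

(** * The asymptotic formula *)

Section Assembly.
Context {R : realType}.
Local Notation mu := (@lebesgue_measure R).
Local Notation mbl D := (@measurable _ (measurableTypeR R) D).
Implicit Types (t u x y r s p : R) (z a b nu la La : R[i]) (f g psi h : R -> R[i]).

Lemma isd_cderiv k f t : csmooth `]0, 1[ f -> `]0, 1[%classic t ->
  isd (cderiv k f) t (cderiv k.+1 f t).
Proof.
move=> sf Dt; have [d1 d2] := sf k t Dt.
by split; [apply: DeriveDef d1 _|apply: DeriveDef d2 _]; rewrite -derive1E.
Qed.

Lemma Ck_cderiv n k f : csmooth `]0, 1[ f -> Ck n `]0, 1[ (cderiv k f).
Proof.
move=> sf; elim: n k => [|n IH] k.
  by move=> t Dt; exact: isd_cto (isd_cderiv k sf Dt).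
by exists (cderiv k.+1 f); split => [t Dt|]; [exact: isd_cderiv|exact: IH].
Qed.

Lemma cderiv0 f : cderiv 0 f = f.
Proof. by apply/funext => t; rewrite /cderiv /=; case: (f t). Qed.

Lemma smooth_int_cderiv p n k f : csmooth `]0, 1[ f ->
  (forall j, (j <= n + k)%N -> cintegrable `]p, 1[ (cderiv j f)) ->
  smooth_int p n (cderiv k f).
Proof.
move=> sf; elim: n k => [|n IH] k hi; split; try by apply: hi; rewrite leq_addl.
  exact: Ck_cderiv.
exists (cderiv k.+1 f); split; first by move=> t; exact: isd_cderiv.
by apply: IH => j hj; apply: hi; rewrite addSnnS.
Qed.

Lemma remainder_decay p c n La psi nu : 0 < p -> p < c -> c < 1 -> n%:R <= Re La ->
  smooth_int p n psi -> (forall t, 0 < t < p -> psi t = 0) -> -1 < Re nu ->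
  cto +oo (fun r => cpow r (nu + n%:R + 1 / 2) *
    cintegral `]p, 1[ (fun t => cpow (1 - t) La * psi t * kern nu r t)) 0.
Proof.
move=> p0 pc c1 hL hpsi pz hn; have p1 := lt_trans pc c1.
have [f [cf fi hf]] := ibp_kern p0 pc c1 hL hpsi pz.
have hm : -1 < Re (nu + n%:R) by rewrite ReD Re_nat ltr_wpDr.
have cfp : Ck 1 `]p, 1[ f by apply: Ck_sub (sub_p1 p0) cf.
have := ctoM (@cto_cst _ _ +oo _ ((-1) ^+ n)) (kern_decay p0 p1 hm cfp fi).
rewrite mulr0 => H; apply: cto_ext (H _ _) => r.
apply: etrans; last exact: (congr1 (fun z => _ * z) (esym (hf nu r hn))).
exact: mulrCA.
Qed.

Lemma bessel_kern nu r s : -1 < Re nu -> 0 < r -> 0 < s ->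
  cpow s (nu + 1) * besselJ nu (r * s) = cpow (r / 2) nu * s%:C * kern nu r (s ^+ 2).
Proof.
move=> hn r0 s0; rewrite /kern besselJE ?mulr_gt0 // cpowS // cpow_sqr //.
have r2 : 0 < r / 2 by rewrite divr_gt0.
have -> : r * s / 2 = r / 2 * s by field.
have -> : (r * s) ^+ 2 / 4 = r ^+ 2 / 4 * s ^+ 2 by field.
rewrite (cpowM nu r2 s0) (_ : 2%:R * nu = nu + nu); last by rewrite mulr_natl.
by rewrite (cpowD s nu nu); ring.
Qed.

Lemma hankel_kern phi nu r : -1 < Re nu -> 0 < r -> Ck 0 `]0, 1[ phi ->
  cintegrable `]0, 1[ (fun t => phi t * kern nu r t) ->
  cintegral `]0, 1[ (fun s => cpow s (nu + 1) * phi (s ^+ 2) * besselJ nu (r * s)) =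
  cpow (r / 2) nu / 2 * cintegral `]0, 1[ (fun t => phi t * kern nu r t).
Proof.
move=> hn r0 cphi fi.
have cf : Ck 0 `]0, 1[ (fun t => phi t * kern nu r t).
  by apply: CkM => //; apply: Ck_kern => // t /in01[].
have [gi <-] := cint_sqr cf fi.
rewrite -(cintZ (cpow (r / 2) nu / 2) mbl_01 gi); apply: cint_ext => s /in01[s0 _].
rewrite mulrAC bessel_kern // realCM -(natC 2); move: (cpow _ _) (kern _ _ _) (phi _) => A K P.
by field.
Qed.

Lemma sonine_kern nu la r : -1 < Re nu -> -1 < Re la ->
  cintegrable `]0, 1[ (fun t => cpow (1 - t) la * kern nu r t) /\
  cintegral `]0, 1[ (fun t => cpow (1 - t) la * kern nu r t) =
  Gamma (la + 1) * bj (nu + la + 1) (r ^+ 2 / 4).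
Proof.
move=> hn hl; have [fi fe] := sonine (r ^+ 2 / 4) hn hl.
have e t : betaf (nu + 1) (la + 1) t * bj nu (r ^+ 2 / 4 * t) = cpow (1 - t) la * kern nu r t.
  by rewrite /betaf !addrK /kern; ring.
split; first by apply: (cintegrable_ext mbl_01 (fun t _ => e t)).
by rewrite -fe; apply: cint_ext => t _; rewrite e.
Qed.

Lemma bj_Bn nu la r : -1 < Re (nu + la + 1) -> 0 < r ->
  cpow r (1 / 2) * cpow (r / 2) nu * bj (nu + la + 1) (r ^+ 2 / 4) =
  cpow 2 (la + 1) * cpow r (- (la + 1)) * Bn (nu + la + 1) r.
Proof.
move=> hm r0; rewrite /Bn besselJE // -addrA cpow_div // cpow_div // (cpowD r nu) (cpowD 2 nu) cpowN.
have := @cpow_neq0 R 2 nu; have := @cpow_neq0 R 2 (la + 1); have := @cpow_neq0 R r (la + 1).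
move: (bj _ _) (cpow 2 nu) (cpow 2 _) (cpow r (la + 1)) (cpow r nu) (cpow r _) => B a1 a2 b1 b2 b3 h1 h2 h3.
by field; rewrite h1 h2 h3.
Qed.

Lemma cto_cpow_Bn nu z : -1 < Re nu -> Re z < 0 -> cto +oo (fun r => cpow r z * Bn nu r) 0.
Proof.
move=> hn hz; have [M hM] := normc_Ln nu; have h0 := cto_cpow_inv hz.
have h1 : cto +oo (fun x => Ln nu x * cpow x z) 0.
  by apply: (@cto0_bnd _ _ _ _ _ _ M) => //; near=> x; exact: hM.
have := ctoD (ctoM h0 (bessel_asymP hn)) h1; rewrite mulr0 addr0 => H.
by apply: cto_ext (H _ _) => x; ring.
Unshelve. all: end_near. Qed.

(** Since |r^z| = r^(Re z), both sides express the same smallness; a positive epsilon of [R[i]] is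
    real, which reduces the claim to real inequalities. *)
Lemma cto_littleo (f g : R -> R[i]^o) z :
  cto +oo (fun r => cpow r z * (f r - g r)) 0 ->
  f = g +o_ (pinfty_nbhs R) (fun r : R => (r `^ (- Re z))%:C : R[i]^o).
Proof.
move=> h; apply/eqaddoP => e e0.
have [ei er] : Im e = 0 /\ 0 < Re e by move: e0; rewrite ltcE => /andP[/eqP]; split.
have /cto0_normc/cvgrPdist_le/(_ _ er) hh := h.
near=> r; have r0 : 0 < r by near: r; exact: nbhs_pinfty_gt.
have : `|0 - normc (cpow r z * (f r - g r))| <= Re e by near: r; exact: hh.
rewrite sub0r normrN ger0_norm ?normc_ge0 // normcM normc_cpow // => hr.
have -> : e = (Re e)%:C by apply: complex_eqP.
have -> : `|(f - g) r| = (normc (f r - g r))%:C by rewrite -normc_norm.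
have -> : `|(r `^ (- Re z))%:C : R[i]^o| = (r `^ (- Re z))%:C.
  by rewrite normc_norm normc_real ger0_norm // powR_ge0.
rewrite -realCM lecR powRN -ler_pdivrMr ?invr_gt0 ?powR_gt0 // invrK mulrC.
exact: hr.
Unshelve. all: end_near. Qed.

End Assembly.

Theorem proposition4p4 (R : realType) (eps : R) (N m : nat)
  (nu Lambda : R[i]) (lambda a : 'I_m.+1 -> R[i])
  (phi psi chi1 phit : R -> R[i])
  (heps : 0 < eps < 1 / 3)
  (hnu : -1 < complex.Re nu)
  (hlambda0 : -1 < complex.Re (lambda ord0))
  (hlambda : forall i j : 'I_m.+1, (i < j)%N ->
     complex.Re (lambda i) < complex.Re (lambda j))
  (hLambda : complex.Re (lambda ord_max) < complex.Re Lambda)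
  (hNLambda : N%:R <= complex.Re Lambda)
  (hNlambda0 : complex.Re (lambda ord0) <= N%:R - 1)
  (hphi : forall t : R, 1 - 2 * eps < t < 1 ->
     phi t = \sum_(k < m.+1) a k * cpow (1 - t) (lambda k)
             + cpow (1 - t) Lambda * psi t)
  (ha0 : a ord0 != 0)
  (hpsi : csmooth `]0, 1[ psi)
  (hpsi_int : forall k : nat, (k <= N)%N ->
     cintegrable `]1 - 2 * eps, 1[ (cderiv k psi))
  (hchi1 : csmooth `]0, 1[ chi1)
  (hchi1_0 : forall t : R, 0 < t <= 1 - 2 * eps -> chi1 t = 0)
  (hchi1_1 : forall t : R, 1 - eps <= t < 1 -> chi1 t = 1)
  (hphit : forall t : R, 0 < t < 1 ->
     phit t = \sum_(k < m.+1) a k * cpow (1 - t) (lambda k)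
              + chi1 t * cpow (1 - t) Lambda * psi t) :
  let l0 := lambda ord0 in
  ((fun r : R =>
      cintegral `]0, 1[
        (fun s : R => cpow s (nu + 1) * phit (s ^+ 2) * besselJ nu (r * s)))
     : R -> R[i]^o) =
  (fun r : R =>
     a ord0 * (cpow 2 (l0 + 1 / 2) / cpow pi (1 / 2)) * Gamma (l0 + 1)
     * cpow r (- (l0 + 3 / 2))
     * ccos (r%:C - (pi / 2)%:C * (nu + l0 + 1) - (pi / 4)%:C))
  +o_ (pinfty_nbhs R)
  (fun r : R => (r `^ (- complex.Re (l0 + 3 / 2)))%:C : R[i]^o).
Proof.
move=> l0; pose p := 1 - 2 * eps; pose c := 1 - eps.
have [p0 pc c1] : [/\ 0 < p, p < c & c < 1] by rewrite /p /c; move: heps; split; lra.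
have p1 : p < 1 := lt_trans pc c1.
have L0 : 0 <= Re Lambda by apply: le_trans hNLambda.
have hl k : -1 < Re (lambda k).
  have [->|k0] := eqVneq k ord0; first exact: hlambda0.
  by apply: lt_trans hlambda0 (hlambda _ _ _); rewrite lt0n.
have hm k : -1 < Re (nu + lambda k + 1) by rewrite !ReD /=; have := hl k; lra.
(* The cut-off is absorbed into psi, so that the remainder vanishes up to [p] and its integral over
   (0, 1) reduces to (p, 1). *)
pose psit t := chi1 t * psi t.
have cpsit n : Ck n `]0, 1[ psit.
  by rewrite /psit -(cderiv0 chi1) -(cderiv0 psi); apply: CkM; exact: Ck_cderiv.
have spsi : smooth_int p N psi.
  by rewrite -(cderiv0 psi); apply: smooth_int_cderiv => // j; rewrite addn0; exact: hpsi_int.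
have spsit : smooth_int p N psit.
  apply: (smooth_int_near p0 pc c1 spsi) => // t /andP[ct t1].
  by rewrite /psit hchi1_1 ?mul1r // (ltW ct).
have psit0 t : 0 < t <= p -> psit t = 0 by move=> tp; rewrite /psit hchi1_0 ?mul0r.
have psit_int : cintegrable `]p, 1[ psit by case: (N) spsit => [|n] [].
have mp : measurable (`]p, 1[%classic : set (measurableTypeR R)) by exact: measurable_itv.
pose err r t := cpow (1 - t) Lambda * psit t * kern nu r t.
have err_p r : cintegrable `]p, 1[ (err r).
  have [cg gi] := smooth_int_pow0 p0 L0 psit_int (cpsit 1%N).
  apply: (cintegrableM_bnd pc c1) => //; first exact: Ck_kern_p1.
  by apply: Ck_sub (sub_p1 p0) _; exact: Ck_pred.
have sub := sub_p1 (R := R) p0.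
have err0 r t : (`]0, 1[ `\` `]p, 1[)%classic t -> err r t = 0.
  move=> [/in01[t0 t1] h]; rewrite /err psit0 ?mulr0 ?mul0r // t0 leNgt; apply/negP => pt.
  by apply: h; rewrite /= in_itv /= pt -subr_gt0.
have mD : measurable ((`]0, 1[ `\` `]p, 1[)%classic : set (measurableTypeR R)) by exact: measurableD.
have err_i r : cintegrable `]0, 1[ (err r).
  apply: (cintegrable_split mbl_01 mp) => //.
  by apply: (cintegrable_ext mD _ (cintegrable0 mD)) => t /err0 ->.
have err_e r : cintegral `]0, 1[ (err r) = cintegral `]p, 1[ (err r).
  rewrite (cint_split mbl_01 mp sub (err_i r)) [X in _ + X](_ : _ = 0) ?addr0 //.
  by rewrite (cint_ext (err0 r)) cint0.
pose phi2 t := \sum_(k < m.+1) a k * cpow (1 - t) (lambda k) + cpow (1 - t) Lambda * psit t.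
have phi2E t : 0 < t < 1 -> phit t = phi2 t.
  by move=> /hphit ->; rewrite /phi2 /psit; congr (_ + _); ring.
pose S r t := \sum_(k < m.+1) a k * (cpow (1 - t) (lambda k) * kern nu r t).
have phi2K r t : S r t + err r t = phi2 t * kern nu r t.
  by rewrite /phi2 mulrDl mulr_suml; congr (_ + _); apply: eq_bigr => k _; rewrite mulrA.
have Si r k : cintegrable `]0, 1[ (fun t => a k * (cpow (1 - t) (lambda k) * kern nu r t)).
  by apply: cintegrableZ => //; case: (sonine_kern r hnu (hl k)).
have Sint r : cintegrable `]0, 1[ (S r) by apply: cintegrable_sum.
have cphi2 : Ck 0 `]0, 1[ phi2.
  have cp z : Ck 0 `]0, 1[ (fun t => cpow (1 - t) z).
    by apply: Ck_cpowr => t /in01[_]; rewrite subr_gt0.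
  apply: CkD; last exact: CkM.
  by apply: Ck_sum => k; apply: CkZ; exact: cp.
have intE r : 0 < r -> cintegral `]0, 1[
    (fun s : R => cpow s (nu + 1) * phit (s ^+ 2) * besselJ nu (r * s)) =
    cpow (r / 2) nu / 2 * (\sum_(k < m.+1) a k * (Gamma (lambda k + 1) *
      bj (nu + lambda k + 1) (r ^+ 2 / 4)) + cintegral `]p, 1[ (err r)).
  move=> r0.
  have -> : cintegral `]0, 1[ (fun s : R => cpow s (nu + 1) * phit (s ^+ 2) * besselJ nu (r * s)) =
      cintegral `]0, 1[ (fun s : R => cpow s (nu + 1) * phi2 (s ^+ 2) * besselJ nu (r * s)).
    apply: cint_ext => s /in01[s0 s1]; rewrite phi2E // exprn_gt0 //= expr_lt1 ?(ltW s0) //.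
    by rewrite -subr_gt0.
  have fi : cintegrable `]0, 1[ (fun t => phi2 t * kern nu r t).
    apply: (cintegrable_ext mbl_01 (fun t _ => phi2K r t)).
    exact: (cintegrableD mbl_01 (Sint r) (err_i r)).
  rewrite (hankel_kern hnu r0 cphi2 fi) -(cint_ext (fun t _ => phi2K r t)).
  rewrite (cintD mbl_01 (Sint r) (err_i r)) err_e cint_sum //; congr (_ * (_ + _)).
  apply: eq_bigr => k _; have [ki <-] := sonine_kern r hnu (hl k).
  by rewrite (cintZ (a k) mbl_01 ki).
pose C k := a k * Gamma (lambda k + 1) * cpow 2 (lambda k + 1) / 2.
(* The k-th Sonine term multiplied by r^(l0+3/2), minus the leading term when k = 0. For the other k
   the power r^(l0 - lambda k) tends to 0. *)
pose G k r := C k * (cpow r (l0 - lambda k) * Bn (nu + lambda k + 1) r) -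
  (if k == ord0 then C ord0 * Ln (nu + l0 + 1) r else 0).
have hG k : cto +oo (G k) 0.
  rewrite /G; case: eqVneq => [->|k0].
    have := ctoM (@cto_cst _ _ +oo _ (C ord0)) (bessel_asymP (hm ord0)); rewrite mulr0 => H.
    by apply: cto_ext (H _ _) => r; rewrite subrr cpow0 mul1r mulrBr.
  have neg : Re (l0 - lambda k) < 0.
    by rewrite ReB subr_lt0; apply: hlambda; rewrite lt0n.
  have := ctoM (@cto_cst _ _ +oo _ (C k)) (cto_cpow_Bn (hm k) neg); rewrite mulr0 => H.
  by apply: cto_ext (H _ _) => r; rewrite subr0.
have hR := remainder_decay p0 pc c1 hNLambda spsit
  (fun t tp => psit0 t (andb_true_intro (conj (proj1 (andP tp)) (ltW (proj2 (andP tp)))))) hnu.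
(* The exponent nu + l0 + 3/2 of the scaled remainder is split as (l0 + 1 - N) + (nu + N + 1/2): the
   second power is compensated by [remainder_decay], the first is bounded because Re l0 <= N - 1. *)
have hR' : cto +oo (fun r => cpow 2 (- nu) / 2 * (cpow r (l0 + 1 - N%:R) *
    (cpow r (nu + N%:R + 1 / 2) * cintegral `]p, 1[ (err r)))) 0.
  apply: (@cto0_bnd _ _ _ _ _ _ (normc (cpow 2 (- nu) / 2))); first by near=> r.
  apply: (@cto0_bnd _ _ _ _ _ _ 1) => //.
  near=> r; have r1 : 1 <= r by near: r; exact: nbhs_pinfty_ge.
  rewrite normc_cpow ?(lt_le_trans ltr01 r1) // -(powRr0 r) ler_powR //.
  by rewrite ReB ReD Re_nat /=; move: hNlambda0; rewrite -/l0; lra.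
apply: cto_littleo.
have := ctoD (cto_sum (index_enum 'I_m.+1) hG) hR'.
rewrite big1 // addr0 => H; apply: cto_near (H _ _); near=> r.
have r0 : 0 < r by near: r; exact: nbhs_pinfty_gt.
rewrite intE //.
have mainE : cpow r (l0 + 3%:R / 2) * (a ord0 * (cpow 2 (l0 + 1 / 2) / cpow pi (1 / 2)) * Gamma (l0 + 1)
     * cpow r (- (l0 + 3%:R / 2))
     * ccos (r%:C - (pi / 2)%:C * (nu + l0 + 1) - (pi / 4)%:C)) = C ord0 * Ln (nu + l0 + 1) r.
  rewrite /C /Ln -/l0 cpowN cpowS // (cpowD 2 l0) -(natC 2).
  have := @cpow_neq0 R r (l0 + 3%:R / 2); have := @cpow_neq0 R pi (1 / 2).
  move: (cpow r _) (cpow pi _) (cpow 2 l0) (cpow 2 _) (Gamma _) (ccos _) (a _) => x1 x2 x3 x4 x5 x6 x7 h2 h1.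
  by field; rewrite h1 h2.
rewrite mulrBr mainE /G sumrB -big_mkcond big_pred1_eq addrAC; congr (_ - _).
have -> : cpow r (l0 + 3%:R / 2) = cpow r (l0 + 1) * cpow r (1 / 2).
  by rewrite -cpowD; congr cpow; field.
rewrite !mulrDr; congr (_ + _).
  rewrite !mulr_sumr; apply: eq_bigr => k _.
  have -> : cpow r (l0 - lambda k) = cpow r (l0 + 1) * cpow r (- (lambda k + 1)).
    by rewrite -cpowD; congr cpow; ring.
  transitivity (a k * Gamma (lambda k + 1) / 2 * cpow r (l0 + 1) *
    (cpow r (1 / 2) * cpow (r / 2) nu * bj (nu + lambda k + 1) (r ^+ 2 / 4))).
    rewrite (bj_Bn (hm k) r0) /C.
    move: (cpow r _) (cpow r _) (cpow 2 _) (Gamma _) (Bn _ _) (a _) => x1 x2 x3 x4 x5 x6.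
    by field.
  move: (cpow r _) (cpow r _) (cpow (r / 2) _) (Gamma _) (bj _ _) (a _) => x1 x2 x3 x4 x5 x6.
  by field.
have -> : cpow r (l0 + 1 - N%:R) = cpow r (l0 + 1) / cpow r N%:R by rewrite cpowB.
rewrite cpow_div // !(cpowD r (nu + N%:R)) (cpowD r nu) cpowN.
have := @cpow_neq0 R 2 nu; have := @cpow_neq0 R r N%:R.
move: (cpow r N%:R) (cpow r _) (cpow r _) (cpow r _) (cpow 2 _) (cintegral _ _) => x1 x2 x3 x4 x5 x6 h1 h2.
by field; rewrite h1 h2.
Unshelve. all: end_near. Qed.
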